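(* Let $n,m,T\in\mathbb{N}$ with $1\le m\le n$, and let $\sigma_x,\sigma_y>0$, $C_x,C_y>0$. Set $\mu_0=\sqrt{1/\sigma_x^2+1/\sigma_y^2}$ and $$f=\Big(\tfrac{m}{n}G_{\mu_0}+\big(1-\tfrac{m}{n}\big)\mathrm{Id}\Big)^{\otimes T}.$$ Then the DPFMix mechanism (described in the context) is $\min\{f,f^{-1}\}^{**}$-DP. Moreover, if $n=n(T)$ and $m=m(T)$ vary with $T$ so that $m\sqrt{T}/n\to\nu$ for a constant $\nu>0$ as $T\to\infty$, then the mechanism is asymptotically $\mu$-GDP with $$\mu=\nu\sqrt{e^{1/\sigma_x^2+1/\sigma_y^2}-1},$$ in the sense that $\big(\tfrac{m}{n}G_{\mu_0}+(1-\tfrac{m}{n})\mathrm{Id}\big)^{\otimes T}\to G_\mu$ uniformly on $[0,1]$ as $T\to\infty$.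
   Context: DPFMix mechanism: input is a dataset $S=\{(x_1,y_1),\dots,(x_n,y_n)\}$ ($y_i$ one-hot labels), a fixed (data-independent) feature map $f_1$, a mixup degree $m$, noise multipliers $\sigma_x,\sigma_y$, clipping bounds $C_x,C_y$ and output size $T$. For each $t=1,\dots,T$ independently: draw $a_i\sim\mathrm{Bernoulli}(m/n)$ independently for $i=1,\dots,n$ (Poisson subsampling) and let $I_t=\{i:a_i=1\}$; for $i\in I_t$ set $x_i^{(t)}=f_1(x_i)/\max(1,\|f_1(x_i)\|_2/C_x)$ and $y_i^{(t)}=y_i/\max(1,\|y_i\|_2/C_y)$; release $\bar x_t=\frac1m\sum_{i\in I_t}x_i^{(t)}+\mathcal N(0,(C_x\sigma_x/m)^2I)$ and $\bar y_t=\frac1m\sum_{i\in I_t}y_i^{(t)}+\mathcal N(0,(C_y\sigma_y/m)^2I)$, with fresh independent noise. The output is $\{(\bar x_t,\bar y_t)\}_{t=1}^T$. Neighboring datasets differ by adding or removing one record. For distributions $P,Q$, the trade-off function is $T(P,Q)(\alpha)=\inf_\phi\{1-\mathbb{E}_Q[\phi]:\mathbb{E}_P[\phi]\le\alpha\}$ over rejection rules $\phi$. For a trade-off function $f$, a randomized mechanism $M$ is $f$-DP if $T(M(S),M(S'))\ge f$ pointwise for all neighboring $S,S'$. $G_\mu(\alpha)=\Phi(\Phi^{-1}(1-\alpha)-\mu)=T(\mathcal N(0,1),\mathcal N(\mu,1))$ with $\Phi$ the standard normal CDF; $\mu$-GDP means $G_\mu$-DP. $\mathrm{Id}(\alpha)=1-\alpha$.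 For trade-off functions $f=T(P,Q)$, $g=T(P',Q')$, $f\otimes g=T(P\times P',Q\times Q')$ and $f^{\otimes T}$ is the $T$-fold product. $f^{-1}$ denotes the (generalized) inverse function of $f$, and $h^{**}$ denotes the double convex conjugate (greatest convex lower bound) of $h$. *)

(* Defs.v *)
From HB Require Import structures.
From mathcomp Require Import all_boot all_order all_algebra.
From mathcomp Require Import all_classical all_reals all_analysis.
From Stdlib Require List.
Set Implicit Arguments. Unset Strict Implicit. Unset Printing Implicit Defensive.
Import Order.TTheory GRing.Theory Num.Theory.
Import numFieldNormedType.Exports.
Local Open Scope classical_set_scope.
Local Open Scope ring_scope.

Section DPFMix_defs.
Variable R : realType.

(* each X i is measurable, and for every choice of measurable sets A i,
   P (/\_i {X i \in A i}) = prod_i P {X i \in A i}  (product rule over the whole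
   family; taking A i = setT gives it for every subfamily). *)
Definition mutually_independent {dO} {Omega : measurableType dO}
  (P : probability Omega R) {dY} {Y : measurableType dY} {I : finType}
  (X : I -> Omega -> Y) : Prop :=
  (forall i, measurable_fun setT (X i)) /\
  (forall A : I -> set Y, (forall i, measurable (A i)) ->
     P (\bigcap_i (X i @^-1` A i)) = (\prod_(i : I) P (X i @^-1` A i))%E).

Definition tradeoff {d1 d2 dY} {O1 : measurableType d1} {O2 : measurableType d2}
  {Y : measurableType dY} (P1 : probability O1 R) (X1 : O1 -> Y)
  (P2 : probability O2 R) (X2 : O2 -> Y) (alpha : R) : R :=
  inf [set r : R | exists phi : Y -> R,
     [/\ measurable_fun setT phi,
         (forall y, 0 <= phi y <= 1),
         (\int[P1]_w (phi (X1 w))%:E <= alpha%:E)%E &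
         r = 1 - fine (\int[P2]_w (phi (X2 w))%:E)]].

Definition Phi (x : R) : R := fine (normal_prob 0 1 `]-oo, x]).
(* its inverse on (0,1) *)
Definition Phi_inv (q : R) : R := sup [set x : R | Phi x <= q].
(* G_mu(alpha) = Phi(Phi^{-1}(1-alpha) - mu), with the limiting values at 0, 1 *)
Definition G (mu : R) (alpha : R) : R :=
  if alpha <= 0 then 1 else if 1 <= alpha then 0
  else Phi (Phi_inv (1 - alpha) - mu).
Definition Id_tf (alpha : R) : R := 1 - alpha.
Definition mixG (p mu : R) (alpha : R) : R := p * G mu alpha + (1 - p) * Id_tf alpha.

Definition tf_inv (f : R -> R) (alpha : R) : R :=
  inf [set t : R | 0 <= t <= 1 /\ f t <= alpha].
(* convex conjugate of h restricted to [0,1] (h = +oo outside [0,1]) *)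
Definition conj01 (h : R -> R) (y : R) : R :=
  sup [set r : R | exists x, 0 <= x <= 1 /\ r = x * y - h x].
Definition biconj (h : R -> R) (x : R) : R :=
  sup [set r : R | exists y, r = x * y - conj01 h y].
Definition minf (f g : R -> R) (x : R) : R := Num.min (f x) (g x).

(* (P1,U) and (P2,V) realize P^T and Q^T where T(P,Q) = g:
   U_0..U_{T-1} i.i.d. with law P, V_0..V_{T-1} i.i.d. with law Q,
   and T(P,Q) = g on [0,1].  Then g^{\otimes T} = T(law U, law V). *)
Definition tensor_realization (g : R -> R) (T : nat) {d1 d2 dY}
  {O1 : measurableType d1} {O2 : measurableType d2} {Y : measurableType dY}
  (P1 : probability O1 R) (U : 'I_T -> O1 -> Y)
  (P2 : probability O2 R) (V : 'I_T -> O2 -> Y) : Prop :=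
  [/\ mutually_independent P1 U, mutually_independent P2 V,
      (forall i j (A : set Y), measurable A ->
         P1 (U i @^-1` A) = P1 (U j @^-1` A) /\ P2 (V i @^-1` A) = P2 (V j @^-1` A)) &
      (forall i alpha, 0 <= alpha <= 1 -> tradeoff P1 (U i) P2 (V i) alpha = g alpha)].

Definition tensor_tf {T : nat} {d1 d2 dY}
  {O1 : measurableType d1} {O2 : measurableType d2} {Y : measurableType dY}
  (P1 : probability O1 R) (U : 'I_T -> O1 -> Y)
  (P2 : probability O2 R) (V : 'I_T -> O2 -> Y) : R -> R :=
  tradeoff P1 (fun w => [tuple U i w | i < T]) P2 (fun w => [tuple V i w | i < T]).

Arguments tensor_realization g {T d1 d2 dY O1 O2 Y} P1 U P2 V.

Definition norm2 {k : nat} (v : k.-tuple R) : R := Num.sqrt (\sum_(j < k) tnth v j ^+ 2).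
Definition clip {k : nat} (C : R) (v : k.-tuple R) : k.-tuple R :=
  [tuple tnth v j / Num.max 1 (norm2 v / C) | j < k].
Definition one_hot {K : nat} (y : K.-tuple R) : Prop :=
  exists k : 'I_K, forall j, tnth y j = (j == k)%:R.

Definition valid_dataset {X : Type} {K : nat} (S : seq (X * K.-tuple R)) : Prop :=
  forall r, List.In r S -> one_hot r.2.
Definition neighboring {X : Type} {K : nat} (S S' : seq (X * K.-tuple R)) : Prop :=
  exists s1 s2 r, (S = s1 ++ s2 /\ S' = s1 ++ r :: s2) \/
                  (S' = s1 ++ s2 /\ S = s1 ++ r :: s2).

(* the randomness used by the mechanism on a dataset of N records:
   a_{t,i} (Bernoulli selectors), the standard normal coordinates of the x-noise
   and of the y-noise. *)
Definition mech_index (T N D K : nat) : finType :=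
  (('I_T * 'I_N) + (('I_T * 'I_D) + ('I_T * 'I_K)))%type.

Definition mech_randomness {dO} {Omega : measurableType dO} (P : probability Omega R)
  (q : R) (T N D K : nat) (Z : mech_index T N D K -> Omega -> R) : Prop :=
  [/\ mutually_independent P Z,
      (forall t i, P (Z (inl (t, i)) @^-1` [set 1]) = q%:E /\
                   P (Z (inl (t, i)) @^-1` [set 0]) = (1 - q)%:E),
      (forall t j (A : set R), measurable A ->
         P (Z (inr (inl (t, j))) @^-1` A) = normal_prob 0 1 A) &
      (forall t k (A : set R), measurable A ->
         P (Z (inr (inr (t, k))) @^-1` A) = normal_prob 0 1 A)].

Arguments mech_randomness {dO Omega} P q T N D K Z.

Definition dpfmix {X : Type} {D K : nat} (f1 : X -> D.-tuple R) (m T : nat)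
  (sx sy Cx Cy : R) (S : seq (X * K.-tuple R)) {dO} {Omega : measurableType dO}
  (Z : mech_index T (size S) D K -> Omega -> R) (w : Omega)
  : T.-tuple (D.-tuple R * K.-tuple R) :=
  [tuple
    ([tuple (m%:R)^-1 * (\sum_(i < size S | Z (inl (t, i)) w == 1)
                 tnth (clip Cx (f1 (tnth (in_tuple S) i).1)) j)
            + (Cx * sx / m%:R) * Z (inr (inl (t, j))) w | j < D],
     [tuple (m%:R)^-1 * (\sum_(i < size S | Z (inl (t, i)) w == 1)
                 tnth (clip Cy (tnth (in_tuple S) i).2) k)
            + (Cy * sy / m%:R) * Z (inr (inr (t, k))) w | k < K])
  | t < T].

Arguments dpfmix {X D K} f1 m T sx sy Cx Cy S {dO Omega} Z w.

Definition dpfmix_fDP {X : Type} (D K : nat) (f1 : X -> D.-tuple R) (n m T : nat)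
  (sx sy Cx Cy : R) (g : R -> R) : Prop :=
  forall (S S' : seq (X * K.-tuple R)), valid_dataset S -> valid_dataset S' ->
  neighboring S S' ->
  forall dO (Omega : measurableType dO) (P : probability Omega R) Z,
  mech_randomness P (m%:R / n%:R) T (size S) D K Z ->
  forall dO' (Omega' : measurableType dO') (P' : probability Omega' R) Z',
  mech_randomness P' (m%:R / n%:R) T (size S') D K Z' ->
  forall alpha, 0 <= alpha <= 1 ->
    g alpha <= tradeoff P (dpfmix f1 m T sx sy Cx Cy S Z)
                        P' (dpfmix f1 m T sx sy Cx Cy S' Z') alpha.

End DPFMix_defs.

(* Main.v *)
(** The hockey-stick divergences [sup_phi (b E_Q phi - a E_P phi)] of a pair of laws
    determine its trade-off function, and they compose along independent products: if
    those of each factor are bounded by the integrals of [max(0, b L - a)] for a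
    likelihood ratio [L] over a standard normal variable, then those of the [n]-fold
    product are bounded by the same integrals for the product of [n] independent copies
    of [L]; the same holds for lower bounds. The pair with trade-off function
    [p G_mu + (1 - p) Id] has exactly the divergences of [L = 1 - p + p lrn mu], where
    [lrn mu] is the likelihood ratio of N(mu, 1) against N(0, 1). One release of the
    mechanism is dominated by the same [L]: with probability [p] the extra record shifts
    the noise, by a vector of length at most [mu0] after rescaling, and conditioning on the
    other selections is removed by convexity. This gives the bound for adding a record, and
    exchanging the two kinds of error gives the one for removing a record.

    For the limit, [L] is replaced factor by factor by [lrn m] with [m] chosen so that the
    second moments agree. The third power of [max(0, y - a)] has a Lipschitz second
    derivative, so one replacement costs a multiple of the third absolute moment of
    [L - 1], which is of order [p^3 = O(T^(-3/2))]; a second difference in [a] then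
    recovers [max(0, y - a)] itself. The product of [T] copies of [lrn m] has the law of
    [lrn (m sqrt T)], and [m sqrt T] tends to [mu]. *)

Require Import Defs.
From HB Require Import structures.
From mathcomp Require Import all_boot all_order all_algebra.
From mathcomp Require Import all_classical all_reals all_analysis.
From mathcomp Require Import measurable_realfun ring lra.
Set Implicit Arguments. Unset Strict Implicit. Unset Printing Implicit Defensive.
Import Order.TTheory GRing.Theory Num.Theory.
Import numFieldNormedType.Exports.
Local Open Scope classical_set_scope.
Local Open Scope ring_scope.

(** The realizations of the tensor product are arbitrary: only a trade-off function is known, so
    everything about the two laws has to be read from tests. Hence divergences are bounded through
    tests with two free weights [a] and [b]; densities, with respect to the sum of the two laws,
    appear only inside the composition. Fixing a first coordinate [y] turns the weights into
    [a * p y] and [b * q y], so bounds for all weights at once are what an induction can carry.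
    Lower bounds are harder than upper ones: the test for the remaining coordinates must depend
    measurably on [y]. The way back to trade-off functions uses supporting lines, which may be
    vertical at level 0; there a second moment bound, which makes the divergence decay like [1 / a],
    takes their place. The constant of the limit comes from second moments: that of [lrn mu0] is
    [expR (mu0 ^+ 2)] with [mu0 ^+ 2 = sx ^-2 + sy ^-2], so [L - 1] has second moment
    [p ^+ 2 * (expR (mu0 ^+ 2) - 1)], and [T * p ^+ 2] tends to [nu ^+ 2]. Most estimates move
    negative terms across the inequality, so that integrands stay nonnegative. *)

Lemma ge0_integral_density {d} {T : measurableType d} {R : realType}
    (nu : {finite_measure set T -> \bar R})
    (mu : {sigma_finite_measure set T -> \bar R}) (g : T -> R) (f : T -> \bar R) :
  measurable_fun setT g -> (forall x, 0 <= g x) ->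
  (forall A, measurable A -> nu A = \int[mu]_(x in A) (g x)%:E)%E ->
  measurable_fun setT f -> (forall x, 0 <= f x)%E ->
  (\int[nu]_x f x = \int[mu]_x (f x * (g x)%:E))%E.
Proof.
move=> mg g0 nuE mf f0.
have numu : nu `<< mu.
  apply/null_content_dominatesP => A mA A0; rewrite nuE//.
  apply: null_set_integral => //.
  by apply/measurable_EFinP; exact: measurable_funTS.
rewrite -(Radon_Nikodym_SigmaFinite.change_of_variables numu)//.
have mRN := measurable_int _ (Radon_Nikodym_SigmaFinite.f_integrable numu).
apply: ae_eq_integral => //.
- exact: emeasurable_funM.
- by apply: emeasurable_funM => //; exact/measurable_EFinP.
(* [g] and the Radon-Nikodym derivative have the same integral over every measurable set, hence
   agree almost everywhere. *)
- apply: ae_eqe_mul2l; apply: integral_ae_eq => //.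
  + exact: Radon_Nikodym_SigmaFinite.f_integrable.
  + exact/measurable_EFinP.
  + by move=> A AT mA; rewrite -Radon_Nikodym_SigmaFinite.f_integral// nuE.
Qed.

Definition pushm {d d'} {T1 : measurableType d} {T2 : measurableType d'}
    {R : realType} (m : {measure set T1 -> \bar R}) (f : T1 -> T2)
    (mf : measurable_fun setT f) : {measure set T2 -> \bar R} :=
  measure_function_pushforward__canonical__measure_function_Measure m mf.

(* Lebesgue measure and the standard normal law, as measures on [R] with its own
   display instead of the one of [measurableTypeR R]. *)
Section measures_on_R.
Context {R : realType}.

Definition leb : set R -> \bar R := @lebesgue_measure R.

Let leb0 : leb set0 = 0%E.
Proof. exact: (@measure0 _ _ _ lebesgue_measure). Qed.
Let leb_ge0 A : (0 <= leb A)%E.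
Proof. exact: (@measure_ge0 _ _ _ lebesgue_measure). Qed.
Let leb_sigma_additive : semi_sigma_additive leb.
Proof. exact: (@measure_semi_sigma_additive _ _ _ lebesgue_measure). Qed.
HB.instance Definition _ :=
  isMeasure.Build _ R R leb leb0 leb_ge0 leb_sigma_additive.
Let leb_sigma_finite : sigma_finite setT leb.
Proof. exact: (@sigma_finiteT _ _ _ lebesgue_measure). Qed.
HB.instance Definition _ := @Measure_isSigmaFinite.Build _ R R leb leb_sigma_finite.

Definition gam : set R -> \bar R := normal_prob 0 1.

Let gam0 : gam set0 = 0%E.
Proof. exact: (@measure0 _ _ _ (normal_prob 0 1)). Qed.
Let gam_ge0 A : (0 <= gam A)%E.
Proof. exact: (@measure_ge0 _ _ _ (normal_prob 0 1)). Qed.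
Let gam_sigma_additive : semi_sigma_additive gam.
Proof. exact: (@measure_semi_sigma_additive _ _ _ (normal_prob 0 1)). Qed.
HB.instance Definition _ :=
  isMeasure.Build _ R R gam gam0 gam_ge0 gam_sigma_additive.
Let gamT : gam setT = 1%E.
Proof. exact: (@probability_setT _ _ _ (normal_prob 0 1)). Qed.
HB.instance Definition _ := @Measure_isProbability.Build _ R R gam gamT.

Lemma ge0_integral_leb (D : set R) (f : R -> \bar R) : measurable D ->
  measurable_fun D f -> (forall x, D x -> 0 <= f x)%E ->
  (\int[leb]_(x in D) f x = \int[lebesgue_measure]_(x in D) f x)%E.
Proof.
move=> mD mf f0.
have mid : measurable_fun [set: measurableTypeR R] (fun x : measurableTypeR R => x : R).
  by move=> _ A mA; rewrite setTI.
transitivity (\int[pushm lebesgue_measure mid]_(x in D) f x)%E.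
  exact: eq_measure_integral.
by rewrite ge0_integral_pushforward// => x; rewrite inE => Dx; exact: f0.
Qed.

End measures_on_R.

(** * Lebesgue measure under affine maps *)

Section affine_change.
Context {R : realType}.

Lemma measurable_affine (a b : R) : measurable_fun setT (fun x : R => a * x + b).
Proof. by apply: measurable_funD => //; exact: measurable_funM. Qed.

(** Both sides are measures in [A] that agree on half-open intervals, and these values determine
    Lebesgue measure. *)
Lemma lebesgue_measure_affine (a b : R) (A : set R) : 0 < a -> measurable A ->
  (a%:E * leb ((fun x : R => a * x + b)%R @^-1` A) = leb A)%E.
Proof.
move=> a0 mA.
have mf : measurable_fun setT ((fun x : R => a * x + b) : R -> R).
  exact: measurable_affine.
have mf' : measurable_fun setT ((fun x : R => a * x + b) : measurableTypeR R -> measurableTypeR R).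
  exact: measurable_affine.
pose m1 : {measure set (measurableTypeR R) -> \bar R} :=
  mscale (NngNum (ltW a0)) (pushm lebesgue_measure mf').
rewrite [RHS](@lebesgue_measure_unique R m1)// => _ [[c d]] _ <-.
rewrite -[RHS]/(a%:E * lebesgue_measure ((fun x : R => a * x + b)%R @^-1` `]c, d]))%E.
rewrite (_ : _ @^-1` _ = `](c - b) / a, (d - b) / a]%classic); last first.
  apply/seteqP; split => x/=; rewrite !in_itv/= ltr_pdivrMr// ler_pdivlMr// [x * a]mulrC; lra.
rewrite !lebesgue_measure_itv/= !lte_fin ltr_pM2r ?invr_gt0// ltrD2r.
case: ifP => _; last by rewrite mule0.
by rewrite -EFinB -EFinM; congr EFin; field; rewrite gt_eqF.
Qed.

Lemma ge0_integral_affine (a b : R) (f : R -> \bar R) : 0 < a ->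
  measurable_fun setT f -> (forall x, 0 <= f x)%E ->
  (\int[leb]_x f x = a%:E * \int[leb]_x f (a * x + b)%R)%E.
Proof.
move=> a0 mf f0.
have mg : measurable_fun setT ((fun x : R => a * x + b) : R -> R).
  exact: measurable_affine.
transitivity (\int[mscale (NngNum (ltW a0)) (pushm leb mg)]_x f x)%E.
  apply: eq_measure_integral => A mA _.
  by rewrite -[RHS]/(a%:E * leb ((fun x : R => a * x + b)%R @^-1` A))%E lebesgue_measure_affine.
rewrite ge0_integral_mscale//; congr (_ * _)%E.
by rewrite ge0_integral_pushforward.
Qed.
End affine_change.

(** * Gaussian integrals: shifts, reflection, convolution *)

Section gaussian.
Context {R : realType}.
Implicit Types (s t r x : R) (f : R -> \bar R).

Definition npdf (x : R) : R := normal_peak 1 * expR (- (x ^+ 2 / 2)).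
(* The likelihood ratio of N(s, 1) against N(0, 1). *)
Definition lrn (s x : R) : R := expR (s * x - s ^+ 2 / 2).

Lemma npdfE : normal_pdf (0 : R) 1 = npdf.
Proof.
rewrite normal_pdfE ?oner_neq0//; apply/funext => x; rewrite /npdf /normal_fun.
by rewrite subr0 expr1n mulNr.
Qed.

Lemma npdf_ge0 x : 0 <= npdf x.
Proof. by rewrite mulr_ge0 ?normal_peak_ge0 ?expR_ge0. Qed.

Lemma measurable_npdf : measurable_fun setT npdf.
Proof. by rewrite -npdfE; exact: measurable_normal_pdf. Qed.

Lemma measurable_lrn s : measurable_fun setT (lrn s).
Proof.
apply: measurableT_comp; first exact: measurable_expR.
exact: measurable_affine.
Qed.

Lemma lrn_ge0 s x : 0 <= lrn s x. Proof. exact: expR_ge0. Qed.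

Lemma integral_npdf : (\int[leb]_x (npdf x)%:E = 1)%E.
Proof.
rewrite -npdfE ge0_integral_leb//; first exact: integral_normal_pdf.
  by apply/measurable_EFinP; exact: measurable_normal_pdf.
by move=> x _; rewrite lee_fin normal_pdf_ge0.
Qed.

Lemma ge0_integral_gam f : measurable_fun setT f -> (forall x, 0 <= f x)%E ->
  (\int[gam]_x f x = \int[leb]_x (f x * (npdf x)%:E))%E.
Proof.
move=> mf f0.
apply: (@ge0_integral_density _ R R gam leb npdf f) => //; first exact: measurable_npdf.
  exact: npdf_ge0.
move=> A mA; rewrite -npdfE ge0_integral_leb//.
  by apply/measurable_funTS/measurable_EFinP; exact: measurable_normal_pdf.
by move=> x _; rewrite lee_fin normal_pdf_ge0.
Qed.

Lemma measurable_comp_affine (a b : R) f : measurable_fun setT f ->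
  measurable_fun setT (fun x => f (a * x + b)).
Proof. by move=> mf; apply: measurableT_comp => //; exact: measurable_affine. Qed.

(** The Cameron-Martin formula in dimension one: translation moves the shift into the density, and
    [npdf (x - s)] equals [npdf x * lrn s x] by expanding the square. *)
Lemma ge0_integral_gam_shift s f : measurable_fun setT f -> (forall x, 0 <= f x)%E ->
  (\int[gam]_x f (x + s)%R = \int[gam]_x (f x * (lrn s x)%:E))%E.
Proof.
move=> mf f0.
have mfs : measurable_fun setT (fun x => f (x + s)).
  by under eq_fun do rewrite -[X in X + s]mul1r; exact: measurable_comp_affine.
have mn : measurable_fun setT (fun x => (npdf (x - s))%:E).
  under eq_fun do rewrite -[X in X - s]mul1r.
  apply: (@measurable_comp_affine _ _ (fun x => (npdf x)%:E)).
  by apply/measurable_EFinP; exact: measurable_npdf.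
rewrite !ge0_integral_gam//; last 2 first.
- apply: emeasurable_funM => //; apply/measurable_EFinP; exact: measurable_lrn.
- by move=> x; rewrite mule_ge0// lee_fin lrn_ge0.
pose h x := (f x * (npdf (x - s))%:E)%E.
transitivity (\int[leb]_x h x)%E.
  rewrite [RHS](@ge0_integral_affine _ 1 s)//; last 2 first.
  - by rewrite /h; apply: emeasurable_funM.
  - by move=> x; rewrite mule_ge0// lee_fin npdf_ge0.
  by rewrite mul1e; apply: eq_integral => x _; rewrite /h mul1r addrK.
apply: eq_integral => x _; rewrite /h -muleA -EFinM; congr (_ * _%:E)%E.
rewrite /npdf /lrn mulrCA -expRD; congr (_ * expR _); by field.
Qed.

Lemma ge0_integral_gamN f : measurable_fun setT f -> (forall x, 0 <= f x)%E ->
  (\int[gam]_x f (- x)%R = \int[gam]_x f x)%E.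
Proof.
move=> mf f0.
have mN : measurable_fun setT (-%R : R -> R) by [].
have mfN : measurable_fun setT (fun x => f (- x)) by exact: measurableT_comp.
rewrite !ge0_integral_gam//.
pose h x := (f x * (npdf x)%:E)%E.
transitivity (\int[pushm leb mN]_x h x)%E; last first.
  by apply: eq_measure_integral => A mA _; exact: lebesgue_measureN.
have mh : measurable_fun setT h.
  by apply: emeasurable_funM => //; apply/measurable_EFinP; exact: measurable_npdf.
rewrite (@ge0_integral_pushforward _ _ _ _ R _ mN leb setT h measurableT mh); last first.
  by move=> x _; rewrite mule_ge0// lee_fin npdf_ge0.
by apply: eq_integral => x _; rewrite /h/= /npdf sqrrN.
Qed.

(** Completing the square in [x] factors the integrand into [r^-1 * npdf (u / r)] and the density in
    [x] of a normal law with mean [s * u / r ^+ 2] and standard deviation [t / r], which integrates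
    to 1. *)
Lemma npdf_conv s t r (u : R) : 0 < t -> 0 < r -> r ^+ 2 = s ^+ 2 + t ^+ 2 ->
  (\int[leb]_x (npdf x * (t^-1 * npdf ((u - s * x) / t)))%:E = (r^-1 * npdf (u / r))%:E)%E.
Proof.
move=> t0 r0 rE.
have r0' := gt_eqF r0; have t0' := gt_eqF t0.
have -> : (\int[leb]_x (npdf x * (t^-1 * npdf ((u - s * x) / t)))%:E =
  \int[leb]_x ((r^-1 * npdf (u / r))%:E * ((r / t)%:E * (npdf (r / t * x + (- (s * u) / (r * t))))%:E)))%E.
  apply: eq_integral => x _; rewrite -!EFinM; congr EFin.
  rewrite /npdf.
  set a := normal_peak 1.
  transitivity (a * a * t^-1 * expR (- (x ^+ 2 / 2) + - (((u - s * x) / t) ^+ 2 / 2))).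
    by rewrite expRD; ring.
  transitivity (a * a * t^-1 * expR (- ((u / r) ^+ 2 / 2) + - ((r / t * x + - (s * u) / (r * t)) ^+ 2 / 2))); last first.
    by rewrite expRD; field; rewrite ?r0' ?t0'.
  congr (_ * expR _).
  have -> : - (x ^+ 2 / 2) + - (((u - s * x) / t) ^+ 2 / 2) =
    - (x ^+ 2 * (s ^+ 2 + t ^+ 2) - 2 * s * u * x + u ^+ 2) / (2 * t ^+ 2) by field; rewrite ?t0'.
  have -> : - ((u / r) ^+ 2 / 2) + - ((r / t * x + - (s * u) / (r * t)) ^+ 2 / 2) =
    - (x ^+ 2 * r ^+ 2 - 2 * s * u * x + u ^+ 2 * (s ^+ 2 + t ^+ 2) / r ^+ 2) / (2 * t ^+ 2).
    by field; rewrite ?r0' ?t0'.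
  by rewrite -rE mulfK// expf_neq0// r0'.
have mn : measurable_fun setT (fun x => (npdf x)%:E).
  by apply/measurable_EFinP; exact: measurable_npdf.
have rt0 : 0 < r / t by rewrite divr_gt0.
have n0 x : (0 <= (npdf x)%:E)%E by rewrite lee_fin npdf_ge0.
rewrite ge0_integralZl_EFin//.
- rewrite ge0_integralZl_EFin// ?(ltW rt0)//.
    by rewrite -(@ge0_integral_affine _ _ _ (fun x => (npdf x)%:E) rt0)// integral_npdf mule1.
  exact: (@measurable_comp_affine _ _ (fun x => (npdf x)%:E)).
- by move=> x _; rewrite mule_ge0// lee_fin ltW.
- apply: emeasurable_funM => //.
  exact: (@measurable_comp_affine _ _ (fun x => (npdf x)%:E)).
- by rewrite mulr_ge0 ?invr_ge0 ?(ltW r0) ?npdf_ge0.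
Qed.

Lemma ge0_integral_gam_conv_pos s t r f : 0 < t -> 0 < r -> r ^+ 2 = s ^+ 2 + t ^+ 2 ->
  measurable_fun setT f -> (forall x, 0 <= f x)%E ->
  (\int[gam]_x \int[gam]_y f (s * x + t * y)%R = \int[gam]_z f (r * z)%R)%E.
Proof.
move=> t0 r0 rE mf f0.
have mn : measurable_fun setT (fun x => (npdf x)%:E).
  by apply/measurable_EFinP; exact: measurable_npdf.
have n0 x : (0 <= (npdf x)%:E)%E by rewrite lee_fin npdf_ge0.
have mfr : measurable_fun setT (fun z => f (r * z)).
  by under eq_fun do rewrite -[r * _]addr0; exact: measurable_comp_affine.
have mn2 : measurable_fun setT (fun xu : R * R => (npdf ((xu.2 - s * xu.1) / t))%:E).
  apply: (measurableT_comp mn); apply: measurable_funM => //.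
  by apply: measurable_funB => //; exact: measurable_funM.
have mn2R : measurable_fun setT (fun xu : R * R => npdf ((xu.2 - s * xu.1) / t)).
  by apply/measurable_EFinP.
have innerE x : (\int[gam]_y f (s * x + t * y)%R =
   \int[leb]_u (f u * (t^-1 * npdf ((u - s * x) / t))%:E))%E.
  rewrite ge0_integral_gam//; last first.
    by under eq_fun do rewrite [s * x + _]addrC; exact: measurable_comp_affine.
  have mh : measurable_fun setT (fun u => f u * (t^-1 * npdf ((u - s * x) / t))%:E)%E.
    apply: emeasurable_funM => //; apply/measurable_EFinP; apply: measurable_funM => //.
    apply/measurable_EFinP.
    exact: (measurableT_comp mn2 (pair1_measurable x)).
  rewrite [RHS](@ge0_integral_affine _ t (s * x))//; last first.
    by move=> u; rewrite mule_ge0// lee_fin mulr_ge0 ?npdf_ge0// invr_ge0 ltW.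
  rewrite -ge0_integralZl_EFin ?(ltW t0)//.
  - apply: eq_integral => y _; rewrite addrK [t * y + _]addrC [t * y]mulrC mulfK ?gt_eqF//.
    rewrite muleCA; congr (_ * _)%E; rewrite -EFinM mulrA divff ?gt_eqF// ?mul1r//.
  - by move=> u _; rewrite mule_ge0// lee_fin mulr_ge0 ?npdf_ge0// invr_ge0 ltW.
  - exact: (@measurable_comp_affine _ _ (fun u => f u * (t^-1 * npdf ((u - s * x) / t))%:E)%E).
pose h (xu : R * R) := (f xu.2 * (npdf xu.1 * (t^-1 * npdf ((xu.2 - s * xu.1) / t)))%:E)%E.
have mh : measurable_fun setT h.
  apply: emeasurable_funM; first exact: measurableT_comp.
  apply/measurable_EFinP; apply: measurable_funM.
    by apply: measurableT_comp => //; exact: measurable_npdf.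
  by apply: measurable_funM.
have h0 xu : (0 <= h xu)%E.
  by rewrite mule_ge0// lee_fin mulr_ge0 ?npdf_ge0// mulr_ge0 ?npdf_ge0// invr_ge0 ltW.
have mh2 : measurable_fun setT (fun xu : R * R => f xu.2 * (t^-1 * npdf ((xu.2 - s * xu.1) / t))%:E)%E.
  apply: emeasurable_funM; first exact: measurableT_comp.
  by apply/measurable_EFinP; apply: measurable_funM.
transitivity (\int[gam]_x \int[leb]_u (f u * (t^-1 * npdf ((u - s * x) / t))%:E))%E.
  by apply: eq_integral => x _; rewrite innerE.
rewrite ge0_integral_gam//; last 2 first.
- apply: (@measurable_fun_fubini_tonelli_F _ _ _ _ _ leb
    (fun xu : R * R => f xu.2 * (t^-1 * npdf ((xu.2 - s * xu.1) / t))%:E)%E) => //.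
  by move=> xu; rewrite mule_ge0// lee_fin mulr_ge0 ?npdf_ge0// invr_ge0 ltW.
- move=> x; apply: integral_ge0 => u _.
  by rewrite mule_ge0// lee_fin mulr_ge0 ?npdf_ge0// invr_ge0 ltW.
transitivity (\int[leb]_x \int[leb]_u h (x, u))%E.
  apply: eq_integral => x _; rewrite -ge0_integralZr//.
  - by apply: eq_integral => u _; rewrite /h/= -muleA -EFinM [_ * npdf x]mulrC.
  - exact: (measurableT_comp mh2 (pair1_measurable x)).
  - by move=> u _; rewrite mule_ge0// lee_fin mulr_ge0 ?npdf_ge0// invr_ge0 ltW.
rewrite (@fubini_tonelli _ _ _ _ _ leb leb h)//.
rewrite ge0_integral_gam//.
pose g u := (f u * (r^-1 * npdf (u / r))%:E)%E.
transitivity (\int[leb]_u g u)%E.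
  apply: eq_integral => u _; rewrite /h/= ge0_integralZl//.
  - by rewrite (npdf_conv _ t0 r0 rE).
  - apply/measurable_EFinP; apply: measurable_funM; first exact: measurable_npdf.
    apply: measurable_funM => //; apply/measurable_EFinP.
    exact: (measurableT_comp mn2 (pair2_measurable u)).
  - by move=> x _; rewrite lee_fin mulr_ge0 ?npdf_ge0// mulr_ge0 ?npdf_ge0// invr_ge0 ltW.
have mg : measurable_fun setT g.
  apply: emeasurable_funM => //; apply/measurable_EFinP; apply: measurable_funM => //.
  by apply: measurableT_comp; [exact: measurable_npdf|exact: measurable_funM].
rewrite (@ge0_integral_affine _ r 0)//; last first.
  by move=> u; rewrite mule_ge0// lee_fin mulr_ge0 ?npdf_ge0// invr_ge0 ltW.
rewrite -ge0_integralZl_EFin ?(ltW r0)//.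
- apply: eq_integral => z _; rewrite /g addr0 [r * z]mulrC mulfK ?gt_eqF//.
  by rewrite muleCA -EFinM mulrA divff ?gt_eqF// mul1r.
- by move=> z _; rewrite mule_ge0// lee_fin mulr_ge0 ?npdf_ge0// invr_ge0 ltW.
- exact: (measurable_comp_affine r 0 mg).
Qed.

(** In the degenerate case [t = 0] the number [r] is [s] or [- s], and the sign is absorbed by the
    symmetry of the standard normal law. This case occurs when the remaining coordinates of a shift
    vanish. *)
Lemma ge0_integral_gam_conv s t r f : 0 <= t -> 0 <= r -> r ^+ 2 = s ^+ 2 + t ^+ 2 ->
  measurable_fun setT f -> (forall x, 0 <= f x)%E ->
  (\int[gam]_x \int[gam]_y f (s * x + t * y)%R = \int[gam]_z f (r * z)%R)%E.
Proof.
move=> t0 r0 rE mf f0.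
move: t0; rewrite le_eqVlt => /predU1P[t0|t0]; last first.
  apply: ge0_integral_gam_conv_pos => //; rewrite lt_neqAle r0 andbT eq_sym.
  by rewrite -sqrf_eq0 rE gt_eqF// ltr_wpDl ?sqr_ge0// exprn_gt0.
move: rE; rewrite -t0 expr0n addr0 => /eqP; rewrite eqf_sqr => rs.
transitivity (\int[gam]_x f (s * x)%R)%E.
  apply: eq_integral => x _; under eq_integral do rewrite mul0r addr0.
  by rewrite integral_cst// [X in (_ * X)%E]probability_setT mule1.
case/orP : rs => /eqP -> //.
transitivity (\int[gam]_x f (s * - x)%R)%E.
  apply/esym/(@ge0_integral_gamN (fun x => f (s * x))) => //.
  by under eq_fun do rewrite -[s * _]addr0; exact: measurable_comp_affine.
by under eq_integral do rewrite mulrN -mulNr.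
Qed.

End gaussian.

(** * Expectations of nonnegative functions and moments of the likelihood ratio *)

Section expectation.
Context {d} {T : measurableType d} {R : realType} (P : probability T R).
Implicit Types (f g : T -> R).

Lemma ge0_expD f g : measurable_fun setT f -> measurable_fun setT g ->
  (forall x, 0 <= f x) -> (forall x, 0 <= g x) ->
  (\int[P]_x (f x + g x)%:E = \int[P]_x (f x)%:E + \int[P]_x (g x)%:E)%E.
Proof.
move=> mf mg f0 g0; under eq_integral do rewrite EFinD.
rewrite ge0_integralD//; try (by move=> x _; rewrite lee_fin).
- exact/measurable_EFinP.
- exact/measurable_EFinP.
Qed.

Lemma ge0_expZ (c : R) f : measurable_fun setT f -> 0 <= c ->
  (forall x, 0 <= f x) -> (\int[P]_x (c * f x)%:E = c%:E * \int[P]_x (f x)%:E)%E.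
Proof.
move=> mf c0 f0; under eq_integral do rewrite EFinM.
rewrite ge0_integralZl_EFin//; first by move=> x _; rewrite lee_fin.
exact/measurable_EFinP.
Qed.

Lemma exp_cst (c : R) : (\int[P]_x c%:E = c%:E)%E.
Proof. by rewrite integral_cst// [X in (_ * X)%E]probability_setT mule1. Qed.

Lemma ge0_exp_le f g : measurable_fun setT f -> measurable_fun setT g ->
  (forall x, 0 <= f x) -> (forall x, f x <= g x) ->
  (\int[P]_x (f x)%:E <= \int[P]_x (g x)%:E)%E.
Proof.
move=> mf mg f0 fg; apply: ge0_le_integral => //.
- by move=> x _; rewrite lee_fin.
- exact/measurable_EFinP.
- exact/measurable_EFinP.
- by move=> x _; rewrite lee_fin.
Qed.

End expectation.

Section moments.
Context {R : realType}.
Implicit Types (s x : R).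

Lemma exp_lrn s : (\int[gam]_x (lrn s x)%:E = 1)%E.
Proof.
transitivity (\int[gam]_x ((fun=> 1%:E) x * (lrn s x)%:E))%E.
  by apply: eq_integral => x _; rewrite mul1e.
by rewrite -(@ge0_integral_gam_shift _ s (fun=> 1%:E))// exp_cst.
Qed.

(** A power of a Gaussian likelihood ratio is a constant times the ratio for a shift [k] times as
    long, and every such ratio has mean 1. *)
Lemma lrnX s x k : lrn s x ^+ k = expR (s ^+ 2 * (k * k.-1)%:R / 2) * lrn (k%:R * s) x.
Proof.
rewrite /lrn -expRM_natl -expRD; congr expR.
case: k => [|k] /=; first by rewrite !mul0r mulr0 expr0n/= !mul0r subr0 addr0.
by rewrite natrM -natr1; field.
Qed.

(** Writing the moments as powers of the single quantity [expR (s ^+ 2)] turns the later moment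
    estimates into polynomial inequalities. *)
Lemma exp_lrnX s k : (\int[gam]_x (lrn s x ^+ k)%:E = (expR (s ^+ 2) ^+ 'C(k, 2))%:E)%E.
Proof.
under eq_integral do rewrite lrnX.
rewrite ge0_expZ ?expR_ge0//; last 2 first.
- exact: measurable_lrn.
- by move=> x; exact: lrn_ge0.
rewrite exp_lrn mule1 -expRM_natl bin2; congr (expR _)%:E.
have /(congr1 (fun n : nat => n%:R : R)) : (k * k.-1)%N = ((k * k.-1)./2 * 2)%N.
  rewrite muln2 -[LHS]odd_double_half; case: k => //= k.
  by rewrite oddM/= andNb.
by move=> ->; rewrite natrM; field.
Qed.

End moments.

(** * Joint laws, independence and decoupling *)

Section tuple_laws.
Context {R : realType} {dY : measure_display} {Y : measurableType dY}.

(** Boxes are stable under intersection and generate the product sigma-algebra, so a finite measure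
    is determined by its values on them. *)
Lemma eq_measure_tuple (n : nat) (m1 m2 : {measure set (n.-tuple Y) -> \bar R}) :
  (forall A : 'I_n -> set Y, (forall i, measurable (A i)) ->
    m1 [set z | forall i, A i (tnth z i)] = m2 [set z | forall i, A i (tnth z i)]) ->
  (m1 setT < +oo)%E -> forall B, measurable B -> m1 B = m2 B.
Proof.
move=> m12 m1oo.
pose G : set (set (n.-tuple Y)) := [set B | exists A : 'I_n -> set Y,
  (forall i, measurable (A i)) /\ B = [set z | forall i, A i (tnth z i)]].
have GT : G setT.
  by exists (fun=> setT); split => //; apply/seteqP; split.
apply: (measure_unique G (fun=> setT)) => //.
- apply/seteqP; split.
  + apply: smallest_sub; first exact: smallest_sigma_algebra.
    move=> B; rewrite -bigcup_seq/= => -[i _] [C mC <-].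
    apply: sub_sigma_algebra; exists (fun j => if j == i then C else setT).
    split; first by move=> j; case: ifP.
    apply/seteqP; split => z /=.
      by move=> [_ Cz] j; case: eqVneq => // ->.
    by move=> /(_ i); rewrite eqxx.
  + apply: smallest_sub; first exact: sigma_algebra_measurable.
    move=> _ [A [mA ->]].
    rewrite (_ : [set z | _] = \big[setI/setT]_(i < n) ((@tnth n Y ^~ i) @^-1` A i)).
      by apply: bigsetI_measurable => i _; rewrite -[X in measurable X]setTI; exact: measurable_tnth.
    by rewrite -bigcap_seq; apply/seteqP; split => z /= Hz i; [move=> _|]; apply: Hz; rewrite /= mem_index_enum.
- move=> _ _ [A [mA ->]] [B [mB ->]].
  exists (fun i => A i `&` B i); split; first by move=> i; exact: measurableI.
  apply/seteqP; split => z /=; first by move=> [Az Bz] i; split.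
  by move=> ABz; split => i; have [] := ABz i.
- by apply: bigcup_const; exists 0%N.
- by move=> _ [A [mA ->]]; exact: m12.
Qed.

End tuple_laws.

Section independence.
Context {R : realType} {dY : measure_display} {Y : measurableType dY}.

Lemma measurable_mktuple {d} {T : measurableType d} (n : nat) (X : 'I_n -> T -> Y) :
  (forall i, measurable_fun setT (X i)) ->
  measurable_fun setT (fun w => [tuple X i w | i < n]).
Proof.
move=> mX; apply/measurable_fun_tnthP => i.
by rewrite (_ : _ \o _ = X i)//; apply/funext => w /=; rewrite tnth_mktuple.
Qed.

Lemma ind_exp_eq {d d'} {T : measurableType d} {T' : measurableType d'} (n : nat)
    (P : probability T R) (P' : probability T' R)
    (X : 'I_n -> T -> Y) (X' : 'I_n -> T' -> Y) (F : n.-tuple Y -> \bar R) :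
  mutually_independent P X -> mutually_independent P' X' ->
  (forall i A, measurable A -> P (X i @^-1` A) = P' (X' i @^-1` A)) ->
  measurable_fun setT F -> (forall z, 0 <= F z)%E ->
  (\int[P]_w F [tuple X i w | i < n] = \int[P']_w F [tuple X' i w | i < n])%E.
Proof.
move=> [mX iX] [mX' iX'] XX' mF F0.
have mt := measurable_mktuple mX; have mt' := measurable_mktuple mX'.
transitivity (\int[pushm P mt]_z F z)%E.
  by rewrite ge0_integral_pushforward.
transitivity (\int[pushm P' mt']_z F z)%E; last by rewrite ge0_integral_pushforward.
apply: eq_measure_integral => B mB _; apply: eq_measure_tuple => //; last first.
  by rewrite -[ltLHS]/(P setT) probability_setT ltry.
move=> A mA.
have cap d0 (T0 : measurableType d0) (X0 : 'I_n -> T0 -> Y) :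
    (fun w => [tuple X0 i w | i < n]) @^-1` [set z | forall i, A i (tnth z i)] =
    \bigcap_i (X0 i @^-1` A i).
  apply/seteqP; split => w /= Aw i; first by move=> _; have := Aw i; rewrite tnth_mktuple.
  by rewrite tnth_mktuple; exact: Aw.
rewrite -[LHS]/(P ((fun w => [tuple X i w | i < n]) @^-1` [set z | forall i, A i (tnth z i)])).
rewrite -[RHS]/(P' ((fun w => [tuple X' i w | i < n]) @^-1` [set z | forall i, A i (tnth z i)])).
by rewrite !cap iX// iX'//; apply: eq_bigr => i _; exact: XX'.
Qed.

Lemma ind_reindex {d} {T : measurableType d} (P : probability T R)
    (I J : finType) (X : I -> T -> Y) (e : J -> I) (e' : I -> J) :
  cancel e e' -> cancel e' e ->
  mutually_independent P X -> mutually_independent P (X \o e).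
Proof.
move=> ee' e'e [mX iX]; split=> [j|A mA]; first exact: mX.
rewrite (_ : \bigcap_j _ = \bigcap_i (X i @^-1` (A (e' i)))); last first.
  apply/seteqP; split => w /= Aw i _; first by have := Aw (e' i) Logic.I; rewrite /= e'e; exact.
  by have := Aw (e i) Logic.I; rewrite /= ee'; exact.
rewrite iX//; rewrite (reindex e) /=; last by exists e' => i _.
by apply: eq_bigr => j _; rewrite ee'.
Qed.

End independence.

Section decoupling.
Context {R : realType} {dY : measure_display} {Y : measurableType dY}.

(** The enumeration of [I] identifies families with tuples, whose product sigma-algebra gives the
    notion of measurability. *)
Definition fmeasurable {I : finType} (F : (I -> Y) -> \bar R) :=
  measurable_fun setT (fun z : #|I|.-tuple Y => F (fun i => tnth z (enum_rank i))).

Lemma ind_exp_eqF {d d'} {T : measurableType d} {T' : measurableType d'} {I : finType}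
    (P : probability T R) (P' : probability T' R)
    (X : I -> T -> Y) (X' : I -> T' -> Y) (F : (I -> Y) -> \bar R) :
  mutually_independent P X -> mutually_independent P' X' ->
  (forall i A, measurable A -> P (X i @^-1` A) = P' (X' i @^-1` A)) ->
  fmeasurable F -> (forall z, 0 <= F z)%E ->
  (\int[P]_w F (X ^~ w) = \int[P']_w F (X' ^~ w))%E.
Proof.
move=> iX iX' XX' mF F0.
have iY := ind_reindex (@enum_valK I) (@enum_rankK I) iX.
have iY' := ind_reindex (@enum_valK I) (@enum_rankK I) iX'.
have YY' (i : 'I_#|I|) A : measurable A -> P ((X \o enum_val) i @^-1` A) = P' ((X' \o enum_val) i @^-1` A).
  exact: XX'.
have := ind_exp_eq iY iY' YY' mF (fun z => F0 _).
have fE d0 (T0 : measurableType d0) (X0 : I -> T0 -> Y) w :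
    (fun i => tnth [tuple (X0 \o enum_val) k w | k < #|I|] (enum_rank i)) = X0 ^~ w.
  by apply/funext => i; rewrite tnth_mktuple /= enum_rankK.
by under eq_integral do rewrite fE; under [in RHS]eq_integral do rewrite fE.
Qed.

Lemma fmeasurable_comp {d} {T : measurableType d} {I : finType}
    (X : I -> T -> Y) (F : (I -> Y) -> \bar R) :
  fmeasurable F -> (forall i, measurable_fun setT (X i)) ->
  measurable_fun setT (fun w => F (X ^~ w)).
Proof.
move=> mF mX.
have mt := measurable_mktuple (fun k : 'I_#|I| => mX (enum_val k)).
have := measurableT_comp mF mt; apply: eq_measurable_fun => w _ /=.
by congr F; apply/funext => i; rewrite tnth_mktuple enum_rankK.
Qed.

Lemma ind_sub {d} {T : measurableType d} (P : probability T R) {I : finType}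
    (X : I -> T -> Y) (p : pred I) (A : I -> set Y) :
  mutually_independent P X -> (forall i, measurable (A i)) ->
  P [set w | forall i, p i -> A i (X i w)] = (\prod_(i | p i) P (X i @^-1` A i))%E.
Proof.
move=> [mX iX] mA.
have -> : [set w | forall i, p i -> A i (X i w)] =
    \bigcap_i (X i @^-1` (if p i then A i else setT)).
  apply/seteqP; split => w /= Aw i; first by move=> _; case: ifP => // pi; exact: Aw.
  by move=> pi; have := Aw i Logic.I; rewrite /= pi.
rewrite iX; last by move=> i; case: ifP.
rewrite [RHS]big_mkcond; apply: eq_bigr => i _; case: ifP => // _.
by rewrite preimage_setT probability_setT.
Qed.

Lemma measurable_forall {d} {T : measurableType d} {I : finType}
    (X : I -> T -> Y) (p : pred I) (A : I -> set Y) :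
  (forall i, measurable_fun setT (X i)) -> (forall i, measurable (A i)) ->
  measurable [set w | forall i, p i -> A i (X i w)].
Proof.
move=> mX mA.
rewrite (_ : [set w | _] = \bigcap_(i in [set` p]) (X i @^-1` A i)); last first.
  by apply/seteqP; split => w /= Aw i; exact: Aw.
apply: fin_bigcap_measurable => [|i _]; first exact: finite_finset.
by rewrite -[X in measurable X]setTI; exact: mX.
Qed.

(** The coordinates in [p] are read at one sample point and the others at a second, independent one.
    An event given by one condition per coordinate becomes a rectangle in [T * T], and its two sides
    have the probabilities prescribed by independence of the original family. *)
Lemma ind_decouple {d} {T : measurableType d} (P : probability T R) {I : finType}
    (X : I -> T -> Y) (p : pred I) :
  mutually_independent P X ->
  mutually_independent ((P \x P)%E : probability (T * T)%type R)
    (fun i (ww : T * T) => X i (if p i then ww.1 else ww.2)).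
Proof.
move=> iX; have [mX _] := iX; split=> [i|A mA].
  by case: (p i); exact: measurableT_comp.
have -> : \bigcap_i ((fun ww : T * T => X i (if p i then ww.1 else ww.2)) @^-1` A i) =
    [set w | forall i, p i -> A i (X i w)] `*` [set w | forall i, ~~ p i -> A i (X i w)].
  apply/seteqP; split => -[w1 w2] /=.
    by move=> Aw; split => i pi; have := Aw i Logic.I; rewrite /= ?pi ?(negbTE pi).
  by move=> [A1 A2] i _ /=; case: ifPn => pi; [exact: A1|exact: A2].
rewrite [LHS]product_measure1E; [|exact: measurable_forall..].
have E1 := ind_sub p iX mA; have E2 := ind_sub (predC p) iX mA.
rewrite [X in (X * _)%E]E1 [X in (_ * X)%E]E2 [RHS](bigID p)/=; congr (_ * _)%E; apply: eq_bigr => i pi.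
  rewrite pi (_ : _ @^-1` _ = (X i @^-1` A i) `*` setT); last first.
    by apply/seteqP; split => -[w1 w2] //= [].
  rewrite [RHS]product_measure1E//.
    by rewrite [X in (_ * X)%E]probability_setT mule1.
  by rewrite -[X in measurable X]setTI; exact: mX.
rewrite (negbTE pi) (_ : _ @^-1` _ = setT `*` (X i @^-1` A i)); last first.
  by apply/seteqP; split => -[w1 w2] //= [].
rewrite [RHS]product_measure1E//.
  by rewrite [X in (X * _)%E]probability_setT mul1e.
by rewrite -[X in measurable X]setTI; exact: mX.
Qed.

(** This takes the place of conditioning on the coordinates in [p]: the family and its decoupled
    version have the same law, and Fubini applies to the latter. *)
Lemma exp_decouple {d} {T : measurableType d} (P : probability T R) {I : finType}
    (X : I -> T -> Y) (p : pred I) (F : (I -> Y) -> \bar R) :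
  mutually_independent P X -> fmeasurable F -> (forall z, 0 <= F z)%E ->
  (\int[P]_w F (X ^~ w) =
   \int[P]_w1 \int[P]_w2 F (fun i => X i (if p i then w1 else w2)))%E.
Proof.
move=> iX mF F0; have [mX _] := iX.
have iX2 := ind_decouple p iX.
rewrite (ind_exp_eqF iX iX2)//.
  rewrite fubini_tonelli1//; exact: (fmeasurable_comp mF iX2.1).
move=> i A mA; have mXA : measurable (X i @^-1` A).
  by rewrite -[X in measurable X]setTI; exact: mX.
case: (boolP (p i)) => pi.
  rewrite (_ : _ @^-1` _ = (X i @^-1` A) `*` setT); last first.
    by apply/seteqP; split => -[w1 w2] //= [].
  rewrite [RHS]product_measure1E//.
  by rewrite [X in (_ * X)%E]probability_setT mule1.
rewrite (_ : _ @^-1` _ = setT `*` (X i @^-1` A)); last first.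
  by apply/seteqP; split => -[w1 w2] //= [].
rewrite [RHS]product_measure1E//.
by rewrite [X in (X * _)%E]probability_setT mul1e.
Qed.

End decoupling.

Section tuples_and_blocks.
Context {R : realType} {dY : measure_display} {Y : measurableType dY}.

Lemma fmeasurable_tuple (n : nat) (F : n.-tuple Y -> \bar R) :
  measurable_fun setT F -> fmeasurable (fun z : 'I_n -> Y => F [tuple z i | i < n]).
Proof.
move=> mF; apply: (measurableT_comp mF).
by apply: (measurable_mktuple (X := fun i (z : #|'I_n|.-tuple Y) => tnth z (enum_rank i))) => i;
  exact: measurable_tnth.
Qed.

Lemma exp_tupleS {d} {T : measurableType d} (P : probability T R) (n : nat)
    (X : 'I_n.+1 -> T -> Y) (F : n.+1.-tuple Y -> \bar R) :
  mutually_independent P X -> measurable_fun setT F -> (forall z, 0 <= F z)%E ->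
  (\int[P]_w F [tuple X i w | i < n.+1] =
   \int[P]_w1 \int[P]_w2 F [tuple of X ord0 w1 :: [tuple X (lift ord0 i) w2 | i < n]])%E.
Proof.
move=> iX mF F0.
rewrite (exp_decouple (pred1 ord0) iX (fmeasurable_tuple mF)); last by move=> z; exact: F0.
apply: eq_integral => w1 _; apply: eq_integral => w2 _; congr F.
apply: eq_from_tnth => i; rewrite tnth_mktuple.
case: (unliftP ord0 i) => [j ->|->] /=; last by rewrite tnth0.
by rewrite tnthS tnth_mktuple.
Qed.

Lemma ind_tail {d} {T : measurableType d} (P : probability T R) (n : nat)
    (X : 'I_n.+1 -> T -> Y) : mutually_independent P X ->
  mutually_independent P (fun i : 'I_n => X (lift ord0 i)).
Proof.
move=> iX; have [mX _] := iX; split=> // A mA.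
pose B (i : 'I_n.+1) := if unlift ord0 i is Some j then A j else setT.
have mB i : measurable (B i) by rewrite /B; case: unlift.
have := ind_sub (fun i : 'I_n.+1 => i != ord0) iX mB.
rewrite (_ : [set w | _] = \bigcap_i (X (lift ord0 i) @^-1` A i)).
  move=> ->; rewrite big_mkcond big_ord_recl eqxx /= mul1e.
  by apply: eq_bigr => i _; rewrite /B liftK.
apply/seteqP; split => w /= Aw i.
  by move=> _; have := Aw (lift ord0 i) isT; rewrite /B liftK.
by case: (unliftP ord0 i) => [j ->|->]//= _; rewrite /B liftK; exact: Aw.
Qed.

Lemma exp_mul {d} {T : measurableType d} (P : probability T R) (f g : T -> \bar R) :
  measurable_fun setT f -> measurable_fun setT g ->
  (forall x, 0 <= f x)%E -> (forall x, 0 <= g x)%E ->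
  (\int[P]_x \int[P]_y (f x * g y) = (\int[P]_x f x) * (\int[P]_y g y))%E.
Proof.
move=> mf mg f0 g0.
under eq_integral do rewrite ge0_integralZl//.
by rewrite ge0_integralZr//; exact: integral_ge0.
Qed.

End tuples_and_blocks.

Section grouping.
Context {R : realType} {dY dW : measure_display} {Y : measurableType dY}
  {W : measurableType dW}.

(** Each [h j] reads only the coordinates in the block [j], so one block at a time can be decoupled
    from the others, which splits one indicator off a product of indicators. *)
Lemma ind_group {d} {T : measurableType d} (P : probability T R) {I J : finType}
    (Z : I -> T -> Y) (blk : I -> J) (h : J -> (I -> Y) -> W) :
  mutually_independent P Z ->
  (forall j, measurable_fun setT
     (fun z : #|I|.-tuple Y => h j (fun i => tnth z (enum_rank i)))) ->
  (forall j z z', (forall i, blk i = j -> z i = z' i) -> h j z = h j z') ->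
  mutually_independent P (fun j w => h j (Z ^~ w)).
Proof.
move=> iZ mh hblk; have [mZ _] := iZ.
have mW j : measurable_fun setT (fun w => h j (Z ^~ w)).
  have mt := measurable_mktuple (fun k : 'I_#|I| => mZ (enum_val k)).
  have := measurableT_comp (mh j) mt; apply: eq_measurable_fun => w _ /=.
  by congr (h j); apply/funext => i; rewrite tnth_mktuple enum_rankK.
split=> // A mA.
have key (s : seq J) : uniq s ->
    (\int[P]_w (\prod_(j <- s) \1_(A j) (h j (Z ^~ w)) : R)%:E =
     \prod_(j <- s) \int[P]_w (\1_(A j) (h j (Z ^~ w)) : R)%:E)%E.
  elim: s => [_|j s IH /= /andP[js us]].
    by under eq_integral do rewrite big_nil; rewrite big_nil exp_cst.
  rewrite big_cons -IH//.
  pose a z : R := \1_(A j) (h j z).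
  pose b z : R := \prod_(k <- s) \1_(A k) (h k z).
  have m1 k : measurable_fun setT (\1_(A k) : W -> R) by exact: measurable_indic.
  have b0 z : 0 <= b z by exact: prodr_ge0.
  have mfa : fmeasurable (fun z => (a z)%:E).
    by apply/measurable_EFinP; exact: (measurableT_comp (m1 j) (mh j)).
  have mfb : fmeasurable (fun z => (b z)%:E).
    apply/measurable_EFinP; apply: measurable_prod => k _.
    exact: (measurableT_comp (m1 k) (mh k)).
  have mfab : fmeasurable (fun z => (a z)%:E * (b z)%:E)%E by exact: emeasurable_funM.
  transitivity (\int[P]_w ((a (Z ^~ w))%:E * (b (Z ^~ w))%:E))%E.
    by apply: eq_integral => w _; rewrite big_cons EFinM.
  rewrite (exp_decouple (fun i => blk i == j) iZ mfab); last first.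
    by move=> z; rewrite mule_ge0// lee_fin.
  rewrite -exp_mul; last first.
  - by move=> x; rewrite lee_fin; exact: b0.
  - by move=> x; rewrite lee_fin.
  - exact: (fmeasurable_comp mfb mZ).
  - exact: (fmeasurable_comp mfa mZ).
  apply: eq_integral => w1 _; apply: eq_integral => w2 _; congr (_ * _)%E; congr EFin.
    by rewrite /a (hblk j _ (Z ^~ w1))// => i ->; rewrite eqxx.
  rewrite /b; apply: eq_big_seq => k ks; rewrite (hblk k _ (Z ^~ w2))// => i ->.
  by case: eqVneq js ks => // -> /negP.
transitivity (\int[P]_w (\prod_(j : J) \1_(A j) (h j (Z ^~ w)) : R)%:E)%E.
  rewrite -[X in P X]setIT -(@integral_indic _ _ _ P setT)//; last first.
    rewrite (_ : \bigcap_j _ = [set w | forall j, predT j -> A j (h j (Z ^~ w))]).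
      exact: (measurable_forall (X := fun j w => h j (Z ^~ w))).
    by apply/seteqP; split => w /= Aw j _; exact: Aw.
  apply: eq_integral => w _; congr EFin; rewrite indicE.
  case: (boolP (w \in _)) => [/set_mem Aw|/negP nAw].
    by rewrite big1// => j _; rewrite indicE mem_set//; exact: (Aw j).
  have [j Aj] : exists j, ~ A j (h j (Z ^~ w)).
    apply/existsNP => H; apply: nAw; apply/mem_set => j _; exact: H.
  by rewrite (bigD1 j)//= indicE memNset// mul0r.
rewrite key ?index_enum_uniq//; apply: eq_bigr => j _.
rewrite -[X in P X]setIT -(@integral_indic _ _ _ P setT)//.
by rewrite -[X in measurable X]setTI; exact: mW.
Qed.

End grouping.

(** * The iterated hockey-stick integrals *)

Section hockey_stick_iteration.
Context {R : realType}.
Implicit Types (L : R -> R) (F : R -> \bar R) (a b : R).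

Definition payoff a b : \bar R := (Num.max 0 (b - a))%:E.
(** The transition operator of the multiplicative random walk started at [b] whose steps are
    independent copies of [L]. *)
Definition kop L F b : \bar R := (\int[gam]_x F (b * L x)%R)%E.
(* [hs L n a b] is [E max(0, b * L(x_1) * ... * L(x_n) - a)] for [x_1, ..., x_n]
   independent standard normal. *)
Definition hs L (n : nat) a b : \bar R := iter n (kop L) (payoff a) b.
Arguments payoff (_ _)%_ring_scope.
Arguments kop _%_function_scope _%_function_scope _%_ring_scope.
Arguments hs _%_function_scope _%_nat_scope (_ _)%_ring_scope.

Lemma hsS L n a b : hs L n.+1 a b = (\int[gam]_x hs L n a (b * L x)%R)%E.
Proof. by []. Qed.

Lemma payoff_ge0 a b : (0 <= payoff a b)%E.
Proof. by rewrite lee_fin le_max lexx. Qed.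

Lemma kop_ge0 L F : (forall b, 0 <= F b)%E -> forall b, (0 <= kop L F b)%E.
Proof. by move=> F0 b; exact: integral_ge0. Qed.

Lemma iter_kop_ge0 L n F : (forall b, 0 <= F b)%E ->
  forall b, (0 <= iter n (kop L) F b)%E.
Proof. by move=> F0; elim: n => //= n IH; exact: kop_ge0. Qed.

Lemma hs_ge0 L n a b : (0 <= hs L n a b)%E.
Proof. by apply: iter_kop_ge0; exact: payoff_ge0. Qed.

(** The passive parameter [z.1] is carried along because compositions evaluate [hs L n] at two
    weights that both vary with the observed point, which requires joint measurability. *)
Lemma measurable_kop2 {d} {T : measurableType d} L (G : T * R -> \bar R) :
  measurable_fun setT L -> measurable_fun setT G -> (forall z, 0 <= G z)%E ->
  measurable_fun setT (fun z : T * R => kop L (fun b => G (z.1, b)) z.2).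
Proof.
move=> mL mG G0.
apply: (@measurable_fun_fubini_tonelli_F _ _ _ R R gam
  (fun zx : T * R * R => G (zx.1.1, zx.1.2 * L zx.2))) => //.
apply: measurableT_comp => //; apply: measurable_fun_pair => /=.
  exact: measurableT_comp.
by apply: measurable_funM; exact: measurableT_comp.
Qed.

Lemma measurable_kop L F : measurable_fun setT L -> measurable_fun setT F ->
  (forall b, 0 <= F b)%E -> measurable_fun setT (kop L F).
Proof.
move=> mL mF F0.
have mG : measurable_fun setT (fun z : unit * R => F z.2) by exact: measurableT_comp.
exact: (measurableT_comp (measurable_kop2 mL mG (fun z => F0 z.2)) (pair1_measurable tt)).
Qed.

Lemma measurable_iter_kop L n F : measurable_fun setT L -> measurable_fun setT F ->
  (forall b, 0 <= F b)%E -> measurable_fun setT (iter n (kop L) F).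
Proof.
move=> mL mF F0; elim: n => //= n IH; apply: measurable_kop => //.
exact: iter_kop_ge0.
Qed.

Lemma measurable_payoff2 : measurable_fun setT (fun ab : R * R => payoff ab.1 ab.2).
Proof.
by apply/measurable_EFinP; apply: measurable_maxr => //; exact: measurable_funB.
Qed.

Lemma measurable_payoff a : measurable_fun setT (payoff a).
Proof. by apply: (measurableT_comp measurable_payoff2 (pair1_measurable a)). Qed.

Lemma measurable_hs2 L n : measurable_fun setT L ->
  measurable_fun setT (fun ab : R * R => hs L n ab.1 ab.2).
Proof.
move=> mL; elim: n => [|n IH]; first exact: measurable_payoff2.
apply: (@measurable_kop2 _ _ L (fun ab : R * R => hs L n ab.1 ab.2)) => //.
by move=> z; exact: hs_ge0.
Qed.

Lemma measurable_hs_comp {d} {T : measurableType d} L n (f g : T -> R) :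
  measurable_fun setT L -> measurable_fun setT f -> measurable_fun setT g ->
  measurable_fun setT (fun t => hs L n (f t) (g t)).
Proof.
move=> mL mf mg.
exact: (measurableT_comp (measurable_hs2 n mL) (measurable_fun_pair mf mg)).
Qed.

Lemma measurable_payoff_comp {d} {T : measurableType d} (f g : T -> R) :
  measurable_fun setT f -> measurable_fun setT g ->
  measurable_fun setT (fun t => payoff (f t) (g t)).
Proof. exact: (@measurable_hs_comp _ _ (cst 0) 0). Qed.

Lemma kop_le L F F' b : measurable_fun setT L -> (forall x, 0 <= L x) -> 0 <= b ->
  measurable_fun setT F -> measurable_fun setT F' ->
  (forall b, 0 <= F b)%E -> (forall b, 0 <= F' b)%E ->
  (forall c, (0 <= c)%R -> F c <= F' c)%E -> (kop L F b <= kop L F' b)%E.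
Proof.
move=> mL L0 b0 mF mF' F0 F'0 FF'; apply: ge0_le_integral => //.
- by apply: measurableT_comp => //; exact: measurable_funM.
- by apply: measurableT_comp => //; exact: measurable_funM.
- by move=> x _; apply: FF'; rewrite mulr_ge0.
Qed.

End hockey_stick_iteration.

Arguments payoff {R} (_ _)%_ring_scope.
Arguments kop {R} _%_function_scope _%_function_scope _%_ring_scope.
Arguments hs {R} _%_function_scope _%_nat_scope (_ _)%_ring_scope.

(** * Common densities for a pair of laws *)

Section sum_of_probabilities.
Context {d} {T : measurableType d} {R : realType} (P Q : probability T R).

(** A finite measure that dominates both laws, so that any pair of laws has densities with respect
    to it. *)
Definition sum_prob (A : set T) : \bar R := (P A + Q A)%E.

Let sum_prob0 : sum_prob set0 = 0%E.
Proof. by rewrite /sum_prob !measure0 adde0. Qed.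
Let sum_prob_ge0 A : (0 <= sum_prob A)%E.
Proof. by rewrite adde_ge0. Qed.
Let sum_prob_sigma_additive : semi_sigma_additive sum_prob.
Proof.
have -> : sum_prob = measure_add P Q by apply/funext => A; rewrite measure_addE.
exact: measure_semi_sigma_additive.
Qed.
HB.instance Definition _ :=
  isMeasure.Build _ _ _ sum_prob sum_prob0 sum_prob_ge0 sum_prob_sigma_additive.
Let sum_prob_finite : fin_num_fun sum_prob.
Proof. by move=> A mA; rewrite /sum_prob fin_numD !fin_num_measure. Qed.
HB.instance Definition _ := Measure_isFinite.Build _ _ _ sum_prob sum_prob_finite.

End sum_of_probabilities.

Section densities.
Context {d} {T : measurableType d} {R : realType}.

Lemma ex_density (P : probability T R) (mu : {finite_measure set T -> \bar R}) :
  (forall A, P A <= mu A)%E ->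
  exists p : T -> R, [/\ measurable_fun setT p, forall x, 0 <= p x &
    forall f : T -> \bar R, measurable_fun setT f -> (forall x, 0 <= f x)%E ->
      (\int[P]_x f x = \int[mu]_x (f x * (p x)%:E))%E].
Proof.
move=> Pmu.
have Pdom : P `<< mu.
  apply/null_content_dominatesP => A mA A0; apply/eqP; rewrite eq_le measure_ge0 andbT.
  by rewrite -A0.
pose g := Radon_Nikodym_SigmaFinite.f P mu.
have gfin x : g x \is a fin_num by exact: Radon_Nikodym_SigmaFinite.f_fin_num.
have g0 x : (0 <= g x)%E by exact: Radon_Nikodym_SigmaFinite.f_ge0.
have mg : measurable_fun setT g.
  exact: measurable_int (Radon_Nikodym_SigmaFinite.f_integrable Pdom).
exists (fine \o g); split.
- exact: measurableT_comp.
- by move=> x /=; exact: fine_ge0.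
- move=> f mf f0; rewrite -(Radon_Nikodym_SigmaFinite.change_of_variables Pdom)//.
  by apply: eq_integral => x _; rewrite /= fineK.
Qed.

Lemma ex_common_density (P Q : probability T R) :
  exists (mu : {finite_measure set T -> \bar R}) (p q : T -> R),
  [/\ measurable_fun setT p, forall x, 0 <= p x,
      measurable_fun setT q & forall x, 0 <= q x] /\
  forall f : T -> \bar R, measurable_fun setT f -> (forall x, 0 <= f x)%E ->
    (\int[P]_x f x = \int[mu]_x (f x * (p x)%:E))%E /\
    (\int[Q]_x f x = \int[mu]_x (f x * (q x)%:E))%E.
Proof.
pose mu : {finite_measure set T -> \bar R} := sum_prob P Q.
have [p [mp p0 pE]] : exists p, _ := @ex_density P mu (fun A => leeDl (P A) (measure_ge0 Q A)).
have [q [mq q0 qE]] := @ex_density Q mu (fun A => leeDr (Q A) (measure_ge0 P A)).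
exists mu, p, q; split; first by split.
by move=> f mf f0; split; [exact: pE|exact: qE].
Qed.

End densities.

(* [p] and [q] are densities of laws P and Q with respect to [mu], so that integrating
   [payoff (a * p) (b * q)] gives the hockey-stick divergence of [b Q] from [a P]. *)
Section iterated_densities.
Context {d} {T : measurableType d} {R : realType}.
Variables (mu : {finite_measure set T -> \bar R}) (p q : T -> R) (L : R -> R).
Hypotheses (mp : measurable_fun setT p) (p0 : forall x, 0 <= p x)
  (mq : measurable_fun setT q) (q0 : forall x, 0 <= q x)
  (mL : measurable_fun setT L) (L0 : forall x, 0 <= L x).

Lemma measurable_hs_density n a b :
  measurable_fun setT (fun y => hs L n (a * p y)%R (b * q y)%R).
Proof.
by apply: measurable_hs_comp => //; exact: measurable_funM.
Qed.

Lemma int_hs_densityS n a b :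
  (\int[mu]_y hs L n.+1 (a * p y) (b * q y) =
   \int[gam]_x \int[mu]_y hs L n (a * p y) (b * L x * q y)%R)%E.
Proof.
pose f (yx : T * R) := hs L n (a * p yx.1) (b * q yx.1 * L yx.2).
transitivity (\int[gam]_x \int[mu]_y f (y, x))%E; last first.
  by apply: eq_integral => x _; apply: eq_integral => y _; rewrite /f/= mulrAC.
apply: (@fubini_tonelli _ _ T R R mu gam f) => [|z]; last exact: hs_ge0.
apply: measurable_hs_comp => //; first by apply: measurable_funM => //; exact: measurableT_comp.
apply: measurable_funM; last exact: measurableT_comp.
by apply: measurable_funM => //; exact: measurableT_comp.
Qed.

Lemma measurable_int_hs_density n a :
  measurable_fun setT (fun b : R => \int[mu]_y hs L n (a * p y)%R (b * q y)%R)%E.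
Proof.
apply: (@measurable_fun_fubini_tonelli_F _ _ R T R mu
   (fun by' : R * T => hs L n (a * p by'.2) (by'.1 * q by'.2))) => /=; last first.
  by move=> z; exact: hs_ge0.
apply: measurable_hs_comp => //; first by apply: measurable_funM => //; exact: measurableT_comp.
by apply: measurable_funM => //; exact: measurableT_comp.
Qed.

(** [hs L n a b] is an average of payoffs with the same [a] and with [b] multiplied by [n] random
    factors. The hypothesis holds for all weights, so it applies to each term of the average, where
    it contributes one more factor [L]. *)
Lemma int_hs_density_le :
  (forall a b, (0 <= a)%R -> (0 <= b)%R ->
    \int[mu]_y payoff (a * p y)%R (b * q y)%R <= hs L 1 a b)%E ->
  forall n a b, 0 <= a -> 0 <= b ->
    (\int[mu]_y hs L n (a * p y)%R (b * q y)%R <= hs L n.+1 a b)%E.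
Proof.
move=> H; elim=> [|n IH] a b a0 b0; first exact: H.
rewrite int_hs_densityS hsS; apply: ge0_le_integral => //.
- by move=> x _; apply: integral_ge0 => y _; exact: hs_ge0.
- apply: (measurableT_comp (measurable_int_hs_density n a)).
  exact: measurable_funM.
- by apply: measurable_hs_comp => //; exact: measurable_funM.
- by move=> x _; apply: IH => //; rewrite mulr_ge0.
Qed.

Lemma int_hs_density_ge :
  (forall a b, (0 <= a)%R -> (0 <= b)%R ->
    hs L 1 a b <= \int[mu]_y payoff (a * p y)%R (b * q y)%R)%E ->
  forall n a b, 0 <= a -> 0 <= b ->
    (hs L n.+1 a b <= \int[mu]_y hs L n (a * p y)%R (b * q y)%R)%E.
Proof.
move=> H; elim=> [|n IH] a b a0 b0; first exact: H.
rewrite int_hs_densityS [leLHS]hsS; apply: ge0_le_integral => //.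
- by move=> x _; exact: hs_ge0.
- by apply: measurable_hs_comp => //; exact: measurable_funM.
- apply: (measurableT_comp (measurable_int_hs_density n a)).
  exact: measurable_funM.
- by move=> x _; apply: IH => //; rewrite mulr_ge0.
Qed.

End iterated_densities.

Section laws.
Context {d dY} {T : measurableType d} {Y : measurableType dY} {R : realType}.

Definition mfun_of (X : T -> Y) (mX : measurable_fun setT X) : {mfun T >-> Y} :=
  HB.pack X (isMeasurableFun.Build _ _ _ _ X mX).

Definition law (P : probability T R) (X : T -> Y) (mX : measurable_fun setT X) :
  probability Y R := distribution P (mfun_of mX).

Lemma ge0_integral_law (P : probability T R) (X : T -> Y)
    (mX : measurable_fun setT X) (f : Y -> \bar R) :
  measurable_fun setT f -> (forall y, 0 <= f y)%E ->
  (\int[law P mX]_y f y = \int[P]_w f (X w))%E.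
Proof. by move=> mf f0; rewrite ge0_integral_distribution. Qed.

Definition is_test (phi : Y -> R) :=
  measurable_fun setT phi /\ forall y, 0 <= phi y <= 1.

Lemma test_ge0 phi y : is_test phi -> 0 <= phi y.
Proof. by case=> _ /(_ y)/andP[]. Qed.

Lemma test_le1 phi y : is_test phi -> phi y <= 1.
Proof. by case=> _ /(_ y)/andP[]. Qed.

Lemma exp_test_ge0 (P : probability T R) (X : T -> Y) phi : is_test phi ->
  (0 <= \int[P]_w (phi (X w))%:E)%E.
Proof. by move=> tp; apply: integral_ge0 => w _; rewrite lee_fin test_ge0. Qed.

Lemma exp_test_le1 (P : probability T R) (X : T -> Y) phi :
  measurable_fun setT X -> is_test phi -> (\int[P]_w (phi (X w))%:E <= 1)%E.
Proof.
move=> mX tp; rewrite -[leRHS](exp_cst P 1); apply: ge0_exp_le => //.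
- exact: measurableT_comp tp.1 mX.
- by move=> w; exact: test_ge0.
- by move=> w; exact: test_le1.
Qed.

Lemma exp_test_fin (P : probability T R) (X : T -> Y) phi :
  measurable_fun setT X -> is_test phi -> (\int[P]_w (phi (X w))%:E)%E \is a fin_num.
Proof.
move=> mX tp; rewrite ge0_fin_numE; last exact: exp_test_ge0.
by rewrite (le_lt_trans (exp_test_le1 P mX tp))// ltry.
Qed.

End laws.

(** * Hockey-stick bounds stated through tests *)

Section hockey_stick_bounds.
Context {R : realType} {d d' dY} {T : measurableType d} {T' : measurableType d'}
  {Y : measurableType dY}.

Definition hs_dominated (P : probability T R) (X : T -> Y) (P' : probability T' R)
    (X' : T' -> Y) (h : R -> R -> \bar R) :=
  forall (phi : Y -> R) (a b : R), is_test phi -> 0 <= a -> 0 <= b ->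
  (b%:E * \int[P']_w (phi (X' w))%:E <= a%:E * \int[P]_w (phi (X w))%:E + h a b)%E.

(** The slack [e] is there because a trade-off function is an infimum over tests, from which only
    nearly optimal tests can be extracted. *)
Definition hs_approached (P : probability T R) (X : T -> Y) (P' : probability T' R)
    (X' : T' -> Y) (h : R -> R -> \bar R) :=
  forall a b e : R, 0 <= a -> 0 <= b -> 0 < e -> exists2 phi : Y -> R, is_test phi &
  (h a b + a%:E * \int[P]_w (phi (X w))%:E <= b%:E * \int[P']_w (phi (X' w))%:E + e%:E)%E.

Variables (P : probability T R) (P' : probability T' R) (X : T -> Y) (X' : T' -> Y)
  (mX : measurable_fun setT X) (mX' : measurable_fun setT X')
  (mu : {finite_measure set Y -> \bar R}) (p q : Y -> R).
Hypotheses (mp : measurable_fun setT p) (p0 : forall x, 0 <= p x)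
  (mq : measurable_fun setT q) (q0 : forall x, 0 <= q x)
  (pE : forall f : Y -> \bar R, measurable_fun setT f -> (forall y, 0 <= f y)%E ->
    (\int[P]_w f (X w) = \int[mu]_y (f y * (p y)%:E))%E)
  (qE : forall f : Y -> \bar R, measurable_fun setT f -> (forall y, 0 <= f y)%E ->
    (\int[P']_w f (X' w) = \int[mu]_y (f y * (q y)%:E))%E).

Let scaleE (c : R) (f : Y -> \bar R) (r : Y -> R) : 0 <= c ->
  measurable_fun setT f -> (forall y, 0 <= f y)%E ->
  measurable_fun setT r -> (forall x, 0 <= r x) ->
  (c%:E * \int[mu]_y (f y * (r y)%:E) = \int[mu]_y (f y * (c * r y)%:E))%E.
Proof.
move=> c0 mf f0 mr r0; rewrite -ge0_integralZl_EFin//.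
- by apply: eq_integral => y _; rewrite muleCA EFinM.
- by move=> y _; rewrite mule_ge0// lee_fin.
- by apply: emeasurable_funM => //; exact/measurable_EFinP.
Qed.

Lemma density_scale_l (a : R) (f : Y -> \bar R) : 0 <= a ->
  measurable_fun setT f -> (forall y, 0 <= f y)%E ->
  (a%:E * \int[P]_w f (X w) = \int[mu]_y (f y * (a * p y)%:E))%E.
Proof. by move=> a0 mf f0; rewrite pE// scaleE. Qed.

Lemma density_scale_r (b : R) (f : Y -> \bar R) : 0 <= b ->
  measurable_fun setT f -> (forall y, 0 <= f y)%E ->
  (b%:E * \int[P']_w f (X' w) = \int[mu]_y (f y * (b * q y)%:E))%E.
Proof. by move=> b0 mf f0; rewrite qE// scaleE. Qed.

Let mpay a b : measurable_fun setT (fun y => payoff (a * p y) (b * q y)).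
Proof.
by apply: measurable_payoff_comp; exact: measurable_funM.
Qed.

Let mtest (phi : Y -> R) : is_test phi -> measurable_fun setT (EFin \o phi).
Proof. by move=> tp; apply/measurable_EFinP; exact: tp.1. Qed.

Let test0 (phi : Y -> R) : is_test phi -> forall y, (0 <= (EFin \o phi) y)%E.
Proof. by move=> tp y; rewrite lee_fin test_ge0. Qed.

Let mfr (phi : Y -> R) (c : R) (r : Y -> R) : is_test phi -> measurable_fun setT r ->
  measurable_fun setT (fun y => (EFin \o phi) y * (c * r y)%:E)%E.
Proof.
move=> tp mr; apply: emeasurable_funM; first exact: mtest.
by apply/measurable_EFinP; exact: measurable_funM.
Qed.

Lemma payoff_density_le h : hs_dominated P X P' X' h ->
  forall a b : R, 0 <= a -> 0 <= b ->
  (\int[mu]_y payoff (a * p y) (b * q y) <= h a b)%E.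
Proof.
move=> H a b a0 b0.
(* The Neyman-Pearson test: it collects [b * q y - a * p y] exactly where this is positive, so its
   gain is the integral of the payoff. *)
pose psi y : R := ((a * p y < b * q y)%R : bool)%:R.
have tpsi : is_test psi.
  split; last by move=> y; rewrite /psi; case: ltP => _ /=; rewrite ?lexx ?ler01.
  rewrite (_ : psi = fun y => if a * p y < b * q y then 1 else 0); last first.
    by apply/funext => y; rewrite /psi; case: ltP.
  by apply: measurable_fun_ifT => //; apply: measurable_fun_ltr; exact: measurable_funM.
have := H psi a b tpsi a0 b0.
have finP := exp_test_fin P mX tpsi.
have finaP : (a%:E * \int[P]_w (psi (X w))%:E)%E \is a fin_num by exact: fin_numM.
rewrite (@density_scale_r b (EFin \o psi))//; [|exact: mtest|exact: test0].
suff -> : (\int[mu]_y ((EFin \o psi) y * (b * q y)%:E) =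
    a%:E * \int[P]_w (psi (X w))%:E + \int[mu]_y payoff (a * p y) (b * q y))%E.
  by rewrite leeD2lE.
rewrite (@density_scale_l a (EFin \o psi))//; [|exact: mtest|exact: test0].
rewrite -ge0_integralD//.
- apply: eq_integral => y _; rewrite /psi /payoff/= -!EFinM -EFinD; congr EFin.
  have [lt|le] := ltP (a * p y) (b * q y).
    by rewrite max_r ?subr_ge0 ?ltW//= !mul1r addrC subrK.
  by rewrite max_l ?subr_le0//= !mul0r addr0.
- by move=> y _; rewrite mule_ge0 ?test0// lee_fin mulr_ge0.
- exact: mfr.
- by move=> y _; exact: payoff_ge0.
Qed.

(** Pointwise, no test gains more than the positive part of [b * q y - a * p y]. The payoff integral
    no longer depends on the test, so [e] can tend to 0. *)
Lemma payoff_density_ge h : hs_approached P X P' X' h ->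
  forall a b : R, 0 <= a -> 0 <= b ->
  (h a b <= \int[mu]_y payoff (a * p y) (b * q y))%E.
Proof.
move=> H a b a0 b0; apply/lee_addgt0Pr => e e0.
have [phi tp] := H a b e a0 b0 e0.
have finaP : (a%:E * \int[P]_w (phi (X w))%:E)%E \is a fin_num.
  by apply: fin_numM => //; exact: exp_test_fin.
move=> hphi; rewrite -(leeD2rE _ _ finaP); apply: (le_trans hphi).
rewrite addeAC leeD2r// (@density_scale_r b (EFin \o phi))//; [|exact: mtest|exact: test0].
rewrite (@density_scale_l a (EFin \o phi))//; [|exact: mtest|exact: test0].
rewrite -ge0_integralD//; last 3 first.
- by move=> y _; exact: payoff_ge0.
- by move=> y _; rewrite mule_ge0 ?test0// lee_fin mulr_ge0.
- exact: mfr.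
apply: ge0_le_integral => //.
- by move=> y _; rewrite mule_ge0 ?test0// lee_fin mulr_ge0.
- exact: mfr.
- by apply: emeasurable_funD; [exact: mpay|exact: mfr].
- move=> y _; rewrite /payoff/= -!EFinM -EFinD lee_fin.
  have /andP[c0 c1] := tp.2 y; set c := phi y in c0 c1 *.
  have h1 : 0 <= Num.max 0 (b * q y - a * p y) by rewrite le_max lexx.
  have h2 : b * q y - a * p y <= Num.max 0 (b * q y - a * p y) by rewrite le_max lexx orbT.
  have : c * (b * q y - a * p y) <= c * Num.max 0 (b * q y - a * p y) by rewrite ler_wpM2l.
  have : c * Num.max 0 (b * q y - a * p y) <= Num.max 0 (b * q y - a * p y) by rewrite ler_piMl.
  lra.
Qed.

End hockey_stick_bounds.

(** * Composition over independent coordinates *)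

Section composition.
Context {R : realType} {dY : measure_display} {Y : measurableType dY}.

Lemma exp_first {d} {T : measurableType d} (P : probability T R) (n : nat)
    (X : 'I_n.+1 -> T -> Y) (mX : measurable_fun setT (X ord0))
    (phi : n.+1.-tuple Y -> R) :
  mutually_independent P X -> is_test phi ->
  let g y := (\int[P]_w (phi [tuple of y :: [tuple X (lift ord0 i) w | i < n]])%:E)%E in
  measurable_fun setT g /\
  (\int[P]_w (phi [tuple X i w | i < n.+1])%:E = \int[P]_w g (X ord0 w))%E.
Proof.
move=> iX tp g.
have mg : measurable_fun setT g.
  apply: (@measurable_fun_fubini_tonelli_F _ _ Y T R P (fun yw : Y * T =>
    (phi [tuple of yw.1 :: [tuple X (lift ord0 i) yw.2 | i < n]])%:E)).
    apply/measurable_EFinP; apply: (measurableT_comp tp.1).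
    apply: measurable_cons => //.
    exact: (measurableT_comp (measurable_mktuple (fun i => iX.1 (lift ord0 i)))).
  by move=> yw; rewrite lee_fin test_ge0.
split => //; rewrite (exp_tupleS (F := fun z => (phi z)%:E) iX)//.
- by apply/measurable_EFinP; exact: tp.1.
- by move=> z; rewrite lee_fin test_ge0.
Qed.

Lemma is_test_cons (n : nat) (phi : n.+1.-tuple Y -> R) (y : Y) : is_test phi ->
  is_test (fun z : n.-tuple Y => phi [tuple of y :: z]).
Proof.
move=> tp; split=> [|z]; last exact: tp.2.
by apply: (measurableT_comp tp.1); exact: measurable_cons.
Qed.

Context {d d'} {T : measurableType d} {T' : measurableType d'}.
Variables (P : probability T R) (P' : probability T' R) (L : R -> R).
Hypotheses (mL : measurable_fun setT L) (L0 : forall x, 0 <= L x).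

(** For a fixed first coordinate [y] the test of the remaining coordinates is weighed by [a * p y]
    and [b * q y], and the induction hypothesis bounds it by [hs L n] at these weights. Averaging
    over [y] is then absorbed by one more factor [L]. *)
Lemma hs_composition_upper (n : nat) (X : 'I_n -> T -> Y) (X' : 'I_n -> T' -> Y) :
  mutually_independent P X -> mutually_independent P' X' ->
  (forall i, hs_dominated P (X i) P' (X' i) (hs L 1)) ->
  hs_dominated P (fun w => [tuple X i w | i < n]) P' (fun w => [tuple X' i w | i < n])
    (hs L n).
Proof.
elim: n X X' => [|n IH] X X' iX iX' H phi a b tp a0 b0.
  pose z0 : 0.-tuple Y := [tuple].
  have E w : [tuple X i w | i < 0] = z0 by exact: tuple0.
  have E' w : [tuple X' i w | i < 0] = z0 by exact: tuple0.
  under eq_integral do rewrite E'.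
  under [in leRHS]eq_integral do rewrite E.
  rewrite !exp_cst -!EFinM -EFinD lee_fin.
  have := test_ge0 z0 tp; have := test_le1 z0 tp; set c := phi z0 => c1 c0.
  have h1 : 0 <= Num.max 0 (b - a) by rewrite le_max lexx.
  have h2 : b - a <= Num.max 0 (b - a) by rewrite le_max lexx orbT.
  have : (b - a) * c <= Num.max 0 (b - a) * c by rewrite ler_wpM2r.
  have : Num.max 0 (b - a) * c <= Num.max 0 (b - a) by rewrite ler_piMr.
  lra.
have mX0 := iX.1 ord0; have mX0' := iX'.1 ord0.
pose g y : \bar R := (\int[P]_w (phi [tuple of y :: [tuple X (lift ord0 i) w | i < n]])%:E)%E.
pose g' y : \bar R := (\int[P']_w (phi [tuple of y :: [tuple X' (lift ord0 i) w | i < n]])%:E)%E.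
have [mg Eg] : measurable_fun setT g /\
    (\int[P]_w (phi [tuple X i w | i < n.+1])%:E = \int[P]_w g (X ord0 w))%E := exp_first mX0 iX tp.
have [mg' Eg'] : measurable_fun setT g' /\
    (\int[P']_w (phi [tuple X' i w | i < n.+1])%:E = \int[P']_w g' (X' ord0 w))%E := exp_first mX0' iX' tp.
have g0 y : (0 <= g y)%E by apply: integral_ge0 => w _; rewrite lee_fin test_ge0.
have g'0 y : (0 <= g' y)%E by apply: integral_ge0 => w _; rewrite lee_fin test_ge0.
have [mu [p [q [[mp p0 mq q0] pq]]]] := ex_common_density (law P mX0) (law P' mX0').
have pE (f : Y -> \bar R) (mf : measurable_fun setT f) (f0 : forall y, (0 <= f y)%E) :
    (\int[P]_w f (X ord0 w) = \int[mu]_y (f y * (p y)%:E))%E.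
  by have [<- _] := pq f mf f0; rewrite ge0_integral_law.
have qE (f : Y -> \bar R) (mf : measurable_fun setT f) (f0 : forall y, (0 <= f y)%E) :
    (\int[P']_w f (X' ord0 w) = \int[mu]_y (f y * (q y)%:E))%E.
  by have [_ <-] := pq f mf f0; rewrite ge0_integral_law.
have Hpay := payoff_density_le mX0 mp p0 mq q0 pE qE (H ord0).
rewrite [X in (b%:E * X)%E]Eg' [X in (a%:E * X)%E]Eg.
rewrite (density_scale_r mq q0 qE b0 mg' g'0) (density_scale_l mp p0 pE a0 mg g0).
have Hn := int_hs_density_le mp mq mL L0 Hpay n a0 b0.
apply: (le_trans _ (leeD2l _ Hn)).
have m1 : measurable_fun setT (fun y => g y * (a * p y)%:E)%E.
  by apply: emeasurable_funM => //; apply/measurable_EFinP; exact: measurable_funM.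
have m2 : measurable_fun setT (fun y => g' y * (b * q y)%:E)%E.
  by apply: emeasurable_funM => //; apply/measurable_EFinP; exact: measurable_funM.
have m3 := measurable_hs_density mp mq mL n a b.
rewrite -ge0_integralD//; last 2 first.
- by move=> y _; rewrite mule_ge0// lee_fin mulr_ge0.
- by move=> y _; exact: hs_ge0.
apply: ge0_le_integral => //.
- by move=> y _; rewrite mule_ge0// lee_fin mulr_ge0.
- exact: emeasurable_funD.
- move=> y _; rewrite [X in (X <= _)%E]muleC [X in (_ <= X + _)%E]muleC.
  apply: (IH _ _ (ind_tail iX) (ind_tail iX') _ _ _ _ (is_test_cons y tp)).
  + by move=> i; exact: H.
  + by rewrite mulr_ge0.
  + by rewrite mulr_ge0.
Qed.

(** One test, jointly measurable in the weights and the observations, serves all weights: in the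
    induction step the weights depend on the first coordinate, and choosing a test separately for
    each of its values would lose measurability. The bound has no slack because, once densities are
    fixed, the likelihood ratio test is optimal. *)
Lemma hs_composition_lower_joint (n : nat) (X : 'I_n -> T -> Y) (X' : 'I_n -> T' -> Y) :
  mutually_independent P X -> mutually_independent P' X' ->
  (forall i, hs_approached P (X i) P' (X' i) (hs L 1)) ->
  exists Phi : (R * R) * n.-tuple Y -> R,
    is_test Phi /\ forall a b : R, 0 <= a -> 0 <= b ->
    (hs L n a b + a%:E * \int[P]_w (Phi ((a, b), [tuple X i w | i < n]))%:E <=
     b%:E * \int[P']_w (Phi ((a, b), [tuple X' i w | i < n]))%:E)%E.
Proof.
elim: n X X' => [|n IH] X X' iX iX' H.
  exists (fun z => if z.1.1 < z.1.2 then 1 else 0); split.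
    split; last by move=> z; case: ifP => _; rewrite ?lexx ?ler01.
    apply: measurable_fun_ifT => //; apply: measurable_fun_ltr.
      exact: measurableT_comp.
    exact: measurableT_comp.
  move=> a b a0 b0 /=; rewrite !exp_cst -!EFinM -EFinD lee_fin.
  have [ab|ba] := ltP a b.
    by rewrite max_r ?mulr1 ?subrK// subr_ge0 ltW.
  by rewrite max_l ?subr_le0// !mulr0 addr0.
have mX0 := iX.1 ord0; have mX0' := iX'.1 ord0.
have [mu [p [q [[mp p0 mq q0] pq]]]] := ex_common_density (law P mX0) (law P' mX0').
have pE (f : Y -> \bar R) (mf : measurable_fun setT f) (f0 : forall y, (0 <= f y)%E) :
    (\int[P]_w f (X ord0 w) = \int[mu]_y (f y * (p y)%:E))%E.
  by have [<- _] := pq f mf f0; rewrite ge0_integral_law.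
have qE (f : Y -> \bar R) (mf : measurable_fun setT f) (f0 : forall y, (0 <= f y)%E) :
    (\int[P']_w f (X' ord0 w) = \int[mu]_y (f y * (q y)%:E))%E.
  by have [_ <-] := pq f mf f0; rewrite ge0_integral_law.
have Hpay := payoff_density_ge mX0 mp p0 mq q0 pE qE (H ord0).
have [Phi [tPhi HPhi]] := IH _ _ (ind_tail iX) (ind_tail iX') (fun i => H (lift ord0 i)).
(* The weights are updated by the densities of the first coordinate and handed to the test of the
   others. Unfolded, the test compares [a] and [b] multiplied by the densities of all the
   coordinates. *)
exists (fun z => Phi ((z.1.1 * p (thead z.2), z.1.2 * q (thead z.2)), [tuple of behead z.2])).
have mhd : measurable_fun setT (fun z : R * R * n.+1.-tuple Y => thead z.2).
  by apply: (measurableT_comp (measurable_tnth ord0)).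
split.
  split; last by move=> z; exact: tPhi.2.
  apply: (measurableT_comp tPhi.1); apply: measurable_fun_pair.
    apply: measurable_fun_pair; apply: measurable_funM.
    - exact: measurableT_comp.
    - exact: measurableT_comp.
    - exact: measurableT_comp.
    - exact: measurableT_comp.
  exact: (measurableT_comp (@measurable_behead _ _ n)).
move=> a b a0 b0.
pose phi (z : n.+1.-tuple Y) := Phi ((a * p (thead z), b * q (thead z)), [tuple of behead z]).
have tp : is_test phi.
  split; last by move=> z; exact: tPhi.2.
  apply: (measurableT_comp tPhi.1); apply: measurable_fun_pair.
    apply: measurable_fun_pair; apply: measurable_funM => //.
    - exact: (measurableT_comp mp (measurable_tnth ord0)).
    - exact: (measurableT_comp mq (measurable_tnth ord0)).
  exact: measurable_behead.
pose g y : \bar R := (\int[P]_w (phi [tuple of y :: [tuple X (lift ord0 i) w | i < n]])%:E)%E.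
pose g' y : \bar R := (\int[P']_w (phi [tuple of y :: [tuple X' (lift ord0 i) w | i < n]])%:E)%E.
have [mg Eg] : measurable_fun setT g /\
    (\int[P]_w (phi [tuple X i w | i < n.+1])%:E = \int[P]_w g (X ord0 w))%E := exp_first mX0 iX tp.
have [mg' Eg'] : measurable_fun setT g' /\
    (\int[P']_w (phi [tuple X' i w | i < n.+1])%:E = \int[P']_w g' (X' ord0 w))%E := exp_first mX0' iX' tp.
have g0 y : (0 <= g y)%E by apply: integral_ge0 => w _; rewrite lee_fin test_ge0.
have g'0 y : (0 <= g' y)%E by apply: integral_ge0 => w _; rewrite lee_fin test_ge0.
rewrite [X in (b%:E * X)%E]Eg' [X in (a%:E * X)%E]Eg.
rewrite (density_scale_r mq q0 qE b0 mg' g'0) (density_scale_l mp p0 pE a0 mg g0).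
have Hn := int_hs_density_ge mp mq mL L0 Hpay n a0 b0.
apply: (le_trans (leeD2r _ Hn)).
have m1 : measurable_fun setT (fun y => g y * (a * p y)%:E)%E.
  by apply: emeasurable_funM => //; apply/measurable_EFinP; exact: measurable_funM.
have m2 : measurable_fun setT (fun y => g' y * (b * q y)%:E)%E.
  by apply: emeasurable_funM => //; apply/measurable_EFinP; exact: measurable_funM.
have m3 := measurable_hs_density mp mq mL n a b.
rewrite -ge0_integralD//; last 2 first.
- by move=> y _; exact: hs_ge0.
- by move=> y _; rewrite mule_ge0// lee_fin mulr_ge0.
apply: ge0_le_integral => //.
- by move=> y _; rewrite adde_ge0 ?hs_ge0// mule_ge0// lee_fin mulr_ge0.
- exact: emeasurable_funD.
- move=> y _; rewrite [X in (_ <= X)%E]muleC [X in (_ + X <= _)%E]muleC.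
  have := HPhi (a * p y) (b * q y) (mulr_ge0 a0 (p0 y)) (mulr_ge0 b0 (q0 y)).
  have tE (z : n.-tuple Y) : [tuple of behead [tuple of y :: z]] = z by exact: val_inj.
  rewrite /g /g' /phi.
  under [in X in (_ <= X -> _)%E]eq_integral => w _ do rewrite -[X in (_, X)]tE.
  by under [in X in (_ + X <= _ -> _)%E]eq_integral => w _ do rewrite -[X in (_, X)]tE.
Qed.

Lemma hs_composition_lower (n : nat) (X : 'I_n -> T -> Y) (X' : 'I_n -> T' -> Y) :
  mutually_independent P X -> mutually_independent P' X' ->
  (forall i, hs_approached P (X i) P' (X' i) (hs L 1)) ->
  hs_approached P (fun w => [tuple X i w | i < n]) P' (fun w => [tuple X' i w | i < n])
    (hs L n).
Proof.
move=> iX iX' H a b e a0 b0 e0.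
have [Phi [tPhi HPhi]] := hs_composition_lower_joint iX iX' H.
exists (fun z => Phi ((a, b), z)).
  split=> [|z]; last exact: tPhi.2.
  exact: (measurableT_comp tPhi.1 (pair1_measurable (a, b))).
by apply: (le_trans (HPhi a b a0 b0)); rewrite leeDl// lee_fin ltW.
Qed.

End composition.

(** * Testing a shift of Gaussian noise *)

Section gaussian_shift.
Context {R : realType}.
Implicit Types (s t r b c : R).

Lemma measurable_max0 {d} {T : measurableType d} (f : T -> R) :
  measurable_fun setT f -> measurable_fun setT (fun x => (Num.max 0 (f x))%:E).
Proof. by move=> mf; apply/measurable_EFinP; exact: measurable_maxr. Qed.

Lemma max0_ge0 c : 0 <= Num.max 0 c. Proof. by rewrite le_max lexx. Qed.
Lemma max0_ge c : c <= Num.max 0 c. Proof. by rewrite le_max lexx orbT. Qed.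

(* The hockey-stick integral of the likelihood ratio of a Gaussian shift of length [s]. *)
Definition gpay b c s : \bar R := (\int[gam]_x (Num.max 0 (b * lrn s x + c))%:E)%E.

Lemma measurable_gpay_integrand b c s :
  measurable_fun setT (fun x => (Num.max 0 (b * lrn s x + c))%:E).
Proof.
apply: measurable_max0; apply: measurable_funD => //; apply: measurable_funM => //.
exact: measurable_lrn.
Qed.

(** The logarithms of the two ratios are independent Gaussians, so the product has the law of the
    ratio for the Euclidean length [r] of [(s, t)]. *)
Lemma ge0_integral_lrn_conv s t r (h : R -> \bar R) : 0 <= t -> 0 <= r ->
  r ^+ 2 = s ^+ 2 + t ^+ 2 -> measurable_fun setT h -> (forall x, 0 <= h x)%E ->
  (\int[gam]_x \int[gam]_z h (lrn s x * lrn t z)%R = \int[gam]_z h (lrn r z))%E.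
Proof.
move=> t0 r0 rE mh h0.
pose f u := h (expR (u - r ^+ 2 / 2)).
have mf : measurable_fun setT f.
  apply: measurableT_comp => //; apply: measurableT_comp; first exact: measurable_expR.
  by apply: measurable_funB.
rewrite -[RHS](ge0_integral_gam_conv t0 r0 rE mf (fun u => h0 _)).
apply: eq_integral => x _; apply: eq_integral => z _; rewrite /f /lrn -expRD.
by congr (h (expR _)); rewrite rE; field.
Qed.

Lemma gpay_conv b c s t r : 0 <= t -> 0 <= r -> r ^+ 2 = s ^+ 2 + t ^+ 2 ->
  (\int[gam]_x gpay (b * lrn s x) c t = gpay b c r)%E.
Proof.
move=> t0 r0 rE; rewrite /gpay.
pose h y : \bar R := (Num.max 0 (b * y + c))%:E.
have mh : measurable_fun setT h.
  by apply: measurable_max0; apply: measurable_funD => //; exact: measurable_funM.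
have h0 y : (0 <= h y)%E by rewrite lee_fin max0_ge0.
rewrite -[RHS](ge0_integral_lrn_conv t0 r0 rE mh h0).
by apply: eq_integral => x _; apply: eq_integral => z _; rewrite /h mulrA.
Qed.

(** Jensen's inequality for the positive part, since [lrn s] has mean 1. *)
Lemma gpay_ge b c s : 0 <= b -> ((Num.max 0 (b + c))%:E <= gpay b c s)%E.
Proof.
move=> b0; have g0 : (0 <= gpay b c s)%E.
  by apply: integral_ge0 => x _; rewrite lee_fin max0_ge0.
have [_|le0] := leP 0 (b + c); last by [].
have ml := measurable_lrn s.
have mm : measurable_fun setT (fun x => Num.max 0 (b * lrn s x + c)).
  by apply/measurable_EFinP; exact: measurable_gpay_integrand.
(* The constant of unknown sign is split so that the two integrals compared below have nonnegative
   integrands. *)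
pose c1 := Num.max 0 c; pose c2 := Num.max 0 (- c).
have cE : c = c1 - c2.
  rewrite /c1 /c2; have [c0|c0] := leP 0 c.
    by rewrite max_l ?oppr_le0// subr0.
  by rewrite max_r ?oppr_ge0 ?ltW// opprK add0r.
have c10 : 0 <= c1 by exact: max0_ge0.
have c20 : 0 <= c2 by exact: max0_ge0.
have : (\int[gam]_x (b * lrn s x + c1)%:E <=
        \int[gam]_x (Num.max 0 (b * lrn s x + c) + c2)%:E)%E.
  apply: ge0_exp_le => //.
  - by apply: measurable_funD => //; exact: measurable_funM.
  - exact: measurable_funD.
  - by move=> x; rewrite addr_ge0// mulr_ge0// lrn_ge0.
  - by move=> x; have := max0_ge (b * lrn s x + c); rewrite {1}cE; lra.
rewrite !ge0_expD//; last 3 first.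
- by move=> x; exact: max0_ge0.
- exact: measurable_funM.
- by move=> x; rewrite mulr_ge0// lrn_ge0.
rewrite ge0_expZ//; last by move=> x; exact: lrn_ge0.
rewrite exp_lrn mule1 !exp_cst -/(gpay b c s) => H.
have -> : b + c = b + c1 - c2 by rewrite -addrA -cE.
by rewrite EFinB leeBlDr.
Qed.

(** The ratio for the longer shift is the one for [s] times an independent factor of mean 1, for the
    shift completing [s] to [r]; Jensen's inequality is applied to that factor. *)
Lemma gpay_le b c s r : 0 <= b -> 0 <= s <= r -> (gpay b c s <= gpay b c r)%E.
Proof.
move=> b0 /andP[s0 sr].
have r0 : 0 <= r by exact: le_trans sr.
have rs : 0 <= r ^+ 2 - s ^+ 2 by rewrite subr_ge0 ler_sqr.
rewrite -(@gpay_conv b c s (Num.sqrt (r ^+ 2 - s ^+ 2)) r)//; last first.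
  by rewrite sqr_sqrtr// addrC subrK.
apply: ge0_le_integral => //.
- by move=> x _; rewrite lee_fin max0_ge0.
- exact: measurable_gpay_integrand.
- apply: (@measurable_fun_fubini_tonelli_F _ _ R R R gam (fun xz =>
    (Num.max 0 (b * lrn s xz.1 * lrn (Num.sqrt (r ^+ 2 - s ^+ 2)) xz.2 + c))%:E)).
    apply: measurable_max0; apply: measurable_funD => //; apply: measurable_funM.
      apply: measurable_funM => //; apply: measurableT_comp => //; exact: measurable_lrn.
    by apply: measurableT_comp => //; exact: measurable_lrn.
  by move=> xz; rewrite lee_fin max0_ge0.
- by move=> x _; apply: gpay_ge; rewrite mulr_ge0// lrn_ge0.
Qed.

(** Each coordinate multiplies the weight [b] by its own ratio [lrn (v i)], and these ratios combine
    into the one for the Euclidean length of [v]. The weight [c1 - c2] of the unshifted law may have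
    either sign, so its two parts stay on opposite sides. *)
Lemma gauss_shift_ord {d} {T : measurableType d} (P : probability T R) (n : nat)
    (zeta : 'I_n -> T -> R) (v : 'I_n -> R) (phi : n.-tuple R -> R) (b c1 c2 s : R) :
  mutually_independent P zeta ->
  (forall i A, measurable A -> P (zeta i @^-1` A) = gam A) ->
  is_test phi -> 0 <= b -> 0 <= c1 -> 0 <= c2 ->
  0 <= s -> s ^+ 2 = \sum_(i < n) v i ^+ 2 ->
  (b%:E * \int[P]_w (phi [tuple zeta i w + v i | i < n])%:E
   + c1%:E * \int[P]_w (phi [tuple zeta i w | i < n])%:E <=
   c2%:E * \int[P]_w (phi [tuple zeta i w | i < n])%:E + gpay b (c1 - c2) s)%E.
Proof.
elim: n zeta v phi b s => [|n IH] zeta v phi b s iz gz tp b0 c10 c20 s0.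
  rewrite big_ord0 => /eqP; rewrite sqrf_eq0 => /eqP ->.
  pose z0 : 0.-tuple R := [tuple].
  under eq_integral do rewrite (tuple0 [tuple _ | i < 0]).
  under [X in (_ + _ * X)%E]eq_integral do rewrite (tuple0 [tuple _ | i < 0]).
  under [in leRHS]eq_integral do rewrite (tuple0 [tuple _ | i < 0]).
  rewrite !exp_cst -!EFinM -EFinD.
  have := test_ge0 [tuple] tp; have := test_le1 [tuple] tp; set c := phi _ => c1' c0.
  apply: (@le_trans _ _ ((c2 * c)%:E + (Num.max 0 (b + (c1 - c2)))%:E))%E; last first.
    by rewrite leeD2l// gpay_ge.
  rewrite -EFinD lee_fin.
  have := max0_ge (b + (c1 - c2)); have := max0_ge0 (b + (c1 - c2)).
  set M := Num.max _ _ => M0 Mb.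
  have : (b + (c1 - c2)) * c <= M * c by rewrite ler_wpM2r.
  have : M * c <= M by rewrite ler_piMr.
  lra.
rewrite big_ord_recl => sE.
pose s' := Num.sqrt (\sum_(i < n) v (lift ord0 i) ^+ 2).
have s'E : s' ^+ 2 = \sum_(i < n) v (lift ord0 i) ^+ 2.
  by rewrite sqr_sqrtr// sumr_ge0// => i _; exact: sqr_ge0.
pose zv i w := zeta i w + v i.
have izv : mutually_independent P zv.
  split=> [i|A mA]; first by apply: measurable_funD => //; exact: iz.1.
  pose B i := (fun x : R => x + v i) @^-1` A i.
  have mB i : measurable (B i).
    by rewrite -[X in measurable X]setTI; apply: (measurable_funD (@measurable_id _ _ setT) (measurable_cst _)).
  exact: (iz.2 B mB).
have mz0 := iz.1 ord0.
have lawE (f : R -> \bar R) : measurable_fun setT f -> (forall x, 0 <= f x)%E ->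
    (\int[P]_w f (zeta ord0 w) = \int[gam]_x f x)%E.
  move=> mf f0; rewrite -(ge0_integral_law P mz0)//.
  by apply: eq_measure_integral => A mA _; exact: gz.
pose g x : \bar R := (\int[P]_w (phi [tuple of x :: [tuple zeta (lift ord0 i) w | i < n]])%:E)%E.
pose g' x : \bar R := (\int[P]_w (phi [tuple of x :: [tuple zv (lift ord0 i) w | i < n]])%:E)%E.
have [mg Eg] : measurable_fun setT g /\
    (\int[P]_w (phi [tuple zeta i w | i < n.+1])%:E = \int[P]_w g (zeta ord0 w))%E :=
  exp_first mz0 iz tp.
have [mg' Eg'] : measurable_fun setT g' /\
    (\int[P]_w (phi [tuple zv i w | i < n.+1])%:E = \int[P]_w g' (zv ord0 w))%E :=
  exp_first (izv.1 ord0) izv tp.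
have g0 x : (0 <= g x)%E by apply: integral_ge0 => w _; rewrite lee_fin test_ge0.
have g'0 x : (0 <= g' x)%E by apply: integral_ge0 => w _; rewrite lee_fin test_ge0.
have {Eg}Eg : (\int[P]_w (phi [tuple zeta i w | i < n.+1])%:E = \int[gam]_x g x)%E.
  by rewrite Eg (lawE g).
have mgs : measurable_fun setT (fun x : R => g' (x + v ord0)%R).
  by apply: (measurableT_comp mg'); exact: measurable_funD.
have {Eg'}Eg' : (\int[P]_w (phi [tuple zv i w | i < n.+1])%:E =
    \int[gam]_x (g' x * (lrn (v ord0) x)%:E))%E.
  rewrite -(ge0_integral_gam_shift _ mg' g'0).
  by rewrite -(lawE (fun x : R => g' (x + v ord0)%R))// Eg'.
rewrite [X in (b%:E * X)%E]Eg' [X in (_ + _ * X <= _)%E]Eg [X in (_ <= _ * X + _)%E]Eg.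
have ml := measurable_lrn (v ord0).
have mgl : measurable_fun setT (fun x => g' x * (lrn (v ord0) x)%:E)%E.
  by apply: emeasurable_funM => //; exact/measurable_EFinP.
have gl0 x : (0 <= g' x * (lrn (v ord0) x)%:E)%E.
  by rewrite mule_ge0// lee_fin lrn_ge0.
rewrite -(@gpay_conv b _ (v ord0) s' s)//; [|exact: sqrtr_ge0|by rewrite s'E].
have mgp : measurable_fun setT (fun x => gpay (b * lrn (v ord0) x) (c1 - c2) s').
  apply: (@measurable_fun_fubini_tonelli_F _ _ R R R gam (fun xz =>
    (Num.max 0 (b * lrn (v ord0) xz.1 * lrn s' xz.2 + (c1 - c2)))%:E)).
    apply: measurable_max0; apply: measurable_funD => //; apply: measurable_funM.
      by apply: measurable_funM => //; exact: measurableT_comp.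
    by apply: measurableT_comp => //; exact: measurable_lrn.
  by move=> xz; rewrite lee_fin max0_ge0.
have gp0 x : (0 <= gpay (b * lrn (v ord0) x) (c1 - c2) s')%E.
  by apply: integral_ge0 => z _; rewrite lee_fin max0_ge0.
rewrite -!ge0_integralZl_EFin//.
have mcg c : measurable_fun setT (fun x => c%:E * g x)%E by exact: measurable_funeM.
have mbg : measurable_fun setT (fun x => b%:E * (g' x * (lrn (v ord0) x)%:E))%E.
  exact: measurable_funeM.
have cg0 c x : 0 <= c -> (0 <= c%:E * g x)%E by move=> c0; rewrite mule_ge0.
have bg0 x : (0 <= b%:E * (g' x * (lrn (v ord0) x)%:E))%E by rewrite mule_ge0.
rewrite -!ge0_integralD//; try (by move=> x _; exact: cg0).
apply: ge0_le_integral => //.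
- by move=> x _; rewrite adde_ge0// cg0.
- exact: emeasurable_funD.
- exact: emeasurable_funD.
move=> x _; rewrite [(g' x * _)%E]muleC muleA -EFinM.
apply: (IH _ (fun i => v (lift ord0 i)) (fun z => phi [tuple of x :: z])) => //.
- exact: ind_tail iz.
- by move=> i A mA; exact: gz.
- exact: (is_test_cons x tp).
- by rewrite mulr_ge0// lrn_ge0.
- exact: sqrtr_ge0.
Qed.

End gaussian_shift.

Section gaussian_shift_fin.
Context {R : realType}.

Lemma ind_inj {dY} {Y : measurableType dY} {d} {T : measurableType d}
    (P : probability T R) (I J : finType) (X : I -> T -> Y) (e : J -> I) :
  injective e -> mutually_independent P X -> mutually_independent P (X \o e).
Proof.
move=> ie iX; split=> [j|A mA]; first exact: iX.1.
pose B i := if [pick j | e j == i] is Some j then A j else setT.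
have Be j : B (e j) = A j.
  rewrite /B; case: pickP => [k /eqP/ie -> //|/(_ j)]; by rewrite eqxx.
have mB i : measurable (B i) by rewrite /B; case: pickP.
have := ind_sub (mem (codom e)) iX mB.
rewrite (_ : [set w | _] = \bigcap_j ((X \o e) j @^-1` A j)); last first.
  apply/seteqP; split => w /= Aw i.
    by move=> _ /=; rewrite -Be; apply: Aw; exact: codom_f.
  by move=> /codomP[j ->]; rewrite Be; exact: Aw.
move=> ->; rewrite -big_filter (perm_big (map e (index_enum J))); last first.
  apply: uniq_perm; rewrite ?filter_uniq ?index_enum_uniq// ?map_inj_uniq ?index_enum_uniq//.
  move=> i; rewrite mem_filter mem_index_enum andbT; apply/idP/mapP.
    by move=> /codomP[j ->]; exists j => //; rewrite mem_index_enum.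
  by move=> [j _ ->]; exact: codom_f.
by rewrite big_map; apply: eq_bigr => j _; rewrite Be.
Qed.

(** An upper bound on the length of the shift suffices because [gpay] increases with that length. *)
Lemma gauss_shift {d} {T : measurableType d} (P : probability T R) (I : finType)
    (zeta : I -> T -> R) (v : I -> R) (phi : (I -> R) -> R) (b c1 c2 r : R) :
  mutually_independent P zeta ->
  (forall i A, measurable A -> P (zeta i @^-1` A) = gam A) ->
  measurable_fun setT (fun z : #|I|.-tuple R => phi (fun i => tnth z (enum_rank i))) ->
  (forall z, 0 <= phi z <= 1) -> 0 <= b -> 0 <= c1 -> 0 <= c2 ->
  0 <= r -> \sum_(i : I) v i ^+ 2 <= r ^+ 2 ->
  (b%:E * \int[P]_w (phi (fun i => zeta i w + v i))%:E
   + c1%:E * \int[P]_w (phi (zeta ^~ w))%:E <=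
   c2%:E * \int[P]_w (phi (zeta ^~ w))%:E + gpay b (c1 - c2) r)%E.
Proof.
move=> iz gz mphi phi01 b0 c10 c20 r0 vr.
pose s := Num.sqrt (\sum_(i : I) v i ^+ 2).
have v0 : 0 <= \sum_(i : I) v i ^+ 2 by apply: sumr_ge0 => i _; exact: sqr_ge0.
have sr : 0 <= s <= r.
  by rewrite sqrtr_ge0 -(ger0_norm r0) -sqrtr_sqr ler_sqrt// sqr_ge0.
apply: (@le_trans _ _ (c2%:E * \int[P]_w (phi (zeta ^~ w))%:E + gpay b (c1 - c2) s)%E);
  last by apply: leeD2l; exact: gpay_le.
pose phi' (z : #|I|.-tuple R) := phi (fun i => tnth z (enum_rank i)).
have tphi : is_test phi' by split=> // y; exact: phi01.
have e1 (f : I -> R) : phi' [tuple f (enum_val k) | k < #|I|] = phi f.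
  by congr phi; apply/funext => i; rewrite tnth_mktuple enum_rankK.
have sE : s ^+ 2 = \sum_(k < #|I|) v (enum_val k) ^+ 2.
  rewrite sqr_sqrtr// (reindex (@enum_val I predT))//=.
  by exists enum_rank => i _; [rewrite enum_valK|rewrite enum_rankK].
have iz' := ind_reindex (@enum_valK I) (@enum_rankK I) iz.
have := @gauss_shift_ord R _ _ P #|I| (zeta \o enum_val) (v \o enum_val) phi' b c1 c2 s
  iz' (fun i => gz (enum_val i)) tphi b0 c10 c20 (sqrtr_ge0 _) sE.
under eq_integral do rewrite (e1 (fun i => zeta i _ + v i)).
under [X in (_ + _ * X <= _ -> _)%E]eq_integral do rewrite (e1 (zeta ^~ _)).
by under [X in (_ <= _ * X + _ -> _)%E]eq_integral do rewrite (e1 (zeta ^~ _)).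
Qed.

End gaussian_shift_fin.

(** * Bernoulli selectors and a single release *)

Section bernoulli_law.
Context {R : realType} {d} {T : measurableType d} (P : probability T R).
Variables (X : T -> R) (q : R).
Hypotheses (mX : measurable_fun setT X)
  (X1 : P (X @^-1` [set 1]) = q%:E) (X0 : P (X @^-1` [set 0]) = (1 - q)%:E).

Let mpre (A : set R) : measurable A -> measurable (X @^-1` A).
Proof. by move=> mA; rewrite -[Y in measurable Y]setTI; exact: mX. Qed.

(** The masses at 1 and 0 add up to 1, so the complement of these two points is null and the two
    masses determine the law. *)
Lemma bernoulli_lawE (A : set R) : measurable A ->
  P (X @^-1` A) = (q * \1_A 1 + (1 - q) * \1_A 0)%:E.
Proof.
move=> mA.
have m01 : measurable ([set 0; 1] : set R) by exact: measurableU.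
have P01 : P (X @^-1` [set 0; 1]) = 1%E.
  rewrite preimage_setU measureU//; [by rewrite [X in (X + _)%E]X0 [X in (_ + X)%E]X1 -EFinD subrK|exact: mpre..|].
  by apply/seteqP; split => w //= [-> /eqP]; rewrite eq_sym oner_eq0.
have PC : P (X @^-1` ~` [set 0; 1]) = 0%E.
  by rewrite -preimage_setC probability_setC; [rewrite [X in (_ - X)%E]P01 subee|exact: mpre].
have -> : P (X @^-1` A) = P (X @^-1` (A `&` [set 0; 1])).
  apply/eqP; rewrite eq_le; apply/andP; split; last first.
    by apply: le_measure; rewrite ?inE; [apply: mpre; exact: measurableI|exact: mpre|
       move=> w []].
  rewrite -[leRHS]adde0 -PC -measureU; [|exact: mpre (measurableI _ _ mA m01)|exact: mpre (measurableC m01)|].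
    rewrite -preimage_setU; apply: le_measure; rewrite ?inE.
    - exact: mpre.
    - by apply: mpre; apply: measurableU; [exact: measurableI|exact: measurableC].
    - by move=> w Aw /=; case: (pselect ([set 0; 1] (X w))); [left|right].
  by apply/seteqP; split => w //= [[_ ?] /(_ _)].
have -> : A `&` [set 0; 1] = (A `&` [set 0]) `|` (A `&` [set 1]) by rewrite setIUr.
rewrite preimage_setU measureU; [|exact: mpre (measurableI _ _ mA _)..|]; last first.
  by apply/seteqP; split => w //= [[_ ->] [_ /eqP]]; rewrite eq_sym oner_eq0.
have one r : A `&` [set r] = if r \in A then [set r] else set0.
  case: ifPn => [/set_mem rA|/negP rA]; apply/seteqP; split => x //=.
  - by move=> [].
  - by move=> ->.
  - by move=> [Ax xr]; apply: rA; rewrite -xr; exact: mem_set.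
rewrite !one !indicE EFinD addeC; congr (_ + _)%E.
  by case: ifPn => _; rewrite ?X1 ?preimage_set0 ?measure0 ?mulr1 ?mulr0.
by case: ifPn => _; rewrite ?X0 ?preimage_set0 ?measure0 ?mulr1 ?mulr0.
Qed.

Lemma exp_bernoulli_if (A B : \bar R) : (0 <= A)%E -> (0 <= B)%E ->
  (\int[P]_w (if (X w == 1)%R then A else B) = q%:E * A + (1 - q)%:E * B)%E.
Proof.
move=> A0 B0.
have m1 : measurable (X @^-1` [set 1]) by exact: mpre.
rewrite -(setUv (X @^-1` [set 1])) ge0_integral_setU//=; last 4 first.
- exact: measurableC.
- by rewrite setUv; apply: measurable_fun_ifT => //; exact: measurable_fun_eqr.
- by move=> w _; case: ifP.
- by rewrite disj_set2E setICr.
rewrite (eq_integral (fun=> A)); last by move=> w; rewrite inE /= => ->; rewrite eqxx.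
rewrite [X in (_ + X)%E](eq_integral (fun=> B)); last first.
  by move=> w; rewrite inE /= => /eqP/negbTE ->.
rewrite !integral_cst//; last exact: measurableC.
rewrite [X in (A * X)%E]X1 muleC; congr (_ + _)%E.
by rewrite [X in (B * X)%E]probability_setC// X1 muleC.
Qed.

End bernoulli_law.

(* One release. [Z] are the selectors and the noise for the smaller dataset, whose
   records are indexed by [I]; [Z'] those for the larger one, with [None] the extra
   record. Selecting the extra record amounts to shifting the noise by [v]. *)
Section one_release.
Context {R : realType} {dY : measure_display} {Y : measurableType dY}.
Context {d d'} {T : measurableType d} {T' : measurableType d'}.
Variables (P : probability T R) (P' : probability T' R) (I J : finType).
Variables (Z : I + J -> T -> R) (Z' : option I + J -> T' -> R) (q mu0 : R).
Variables (out : (I -> bool) -> (J -> R) -> Y)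
  (out' : (option I -> bool) -> (J -> R) -> Y) (v : J -> R).
Hypotheses (q01 : 0 <= q <= 1) (mu00 : 0 <= mu0)
  (iZ : mutually_independent P Z) (iZ' : mutually_independent P' Z')
  (Zsel : forall i, P (Z (inl i) @^-1` [set 1]) = q%:E /\
                    P (Z (inl i) @^-1` [set 0]) = (1 - q)%:E)
  (Zsel' : forall i, P' (Z' (inl i) @^-1` [set 1]) = q%:E /\
                     P' (Z' (inl i) @^-1` [set 0]) = (1 - q)%:E)
  (Znoise : forall j A, measurable A -> P (Z (inr j) @^-1` A) = gam A)
  (Znoise' : forall j A, measurable A -> P' (Z' (inr j) @^-1` A) = gam A)
  (mout : measurable_fun setT (fun z : #|{: I + J}|.-tuple R =>
     out (fun i => tnth z (enum_rank (inl i)) == 1) (fun j => tnth z (enum_rank (inr j)))))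
  (mout' : measurable_fun setT (fun z : #|{: option I + J}|.-tuple R =>
     out' (fun i => tnth z (enum_rank (inl i)) == 1) (fun j => tnth z (enum_rank (inr j)))))
  (out_None : forall s z, s None = false -> out' s z = out (s \o some) z)
  (out_Some : forall s z, s None = true ->
     out' s z = out (s \o some) (fun j => z j + v j))
  (v_le : \sum_j v j ^+ 2 <= mu0 ^+ 2).

(** Removing the selector of the extra record from [Z'] leaves a copy of [Z] on the other
    probability space, so both mechanisms can be compared under [P] alone. *)
Let Zr : I + J -> T' -> R := fun k =>
  match k with inl i => Z' (inl (Some i)) | inr j => Z' (inr j) end.

Let iZr : mutually_independent P' Zr.
Proof.
have -> : Zr = Z' \o (fun k => match k with inl i => inl (Some i) | inr j => inr j end).
  by apply/funext => -[].
by apply: ind_inj iZ' => -[i|j] [i'|j'] // [->].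
Qed.

Let ZZr k A : measurable A -> P (Z k @^-1` A) = P' (Zr k @^-1` A).
Proof.
case: k => [i|j] mA; last by rewrite Znoise// -(Znoise' j).
have [Z1 Z0] := Zsel i; have [Z'1 Z'0] := Zsel' (Some i).
rewrite (bernoulli_lawE (iZ.1 (inl i)) Z1 Z0)//.
by rewrite -(bernoulli_lawE (iZ'.1 (inl (Some i))) Z'1 Z'0).
Qed.

Let sel {K : finType} (z : K + J -> R) (i : K) : bool := z (inl i) == 1.
Let noi {K : finType} (z : K + J -> R) (j : J) : R := z (inr j).

Lemma hs_one_release :
  hs_dominated P (fun w => out (sel (Z ^~ w)) (noi (Z ^~ w)))
    P' (fun w => out' (sel (Z' ^~ w)) (noi (Z' ^~ w)))
    (hs (fun x => 1 - q + q * lrn mu0 x) 1).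
Proof.
move=> phi a b tp a0 b0.
have /andP[q0 q1] := q01.
pose F (u : J -> R) (z : I + J -> R) : \bar R :=
  (phi (out (sel z) (fun j => noi z j + u j)))%:E.
pose F' (z : option I + J -> R) : \bar R := (phi (out' (sel z) (noi z)))%:E.
have F0 u z : (0 <= F u z)%E by rewrite lee_fin test_ge0.
have F'0 z : (0 <= F' z)%E by rewrite lee_fin test_ge0.
have mF' : fmeasurable F' by apply/measurable_EFinP; exact: (measurableT_comp tp.1 mout').
have mFb : fmeasurable (fun z : I + J -> R => (phi (out (sel z) (noi z)))%:E).
  by apply/measurable_EFinP; exact: (measurableT_comp tp.1 mout).
have mF u : fmeasurable (F u).
  pose X (k : I + J) (z : #|{: I + J}|.-tuple R) :=
    tnth z (enum_rank k) + (if k is inr j then u j else 0).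
  have mX k : measurable_fun setT (X k).
    by apply: measurable_funD => //; exact: measurable_tnth.
  have := fmeasurable_comp mFb mX; apply: eq_measurable_fun => z _.
  rewrite /F /X; congr (phi (out _ _))%:E.
  by apply/funext => i; rewrite /sel addr0.
have FE z : F (fun=> 0) z = (phi (out (sel z) (noi z)))%:E.
  by rewrite /F; congr (phi (out _ _))%:E; apply/funext => j; rewrite addr0.
(* Only the selector of the extra record is frozen here. Its two values turn [out'] into [out] with
   or without the shift [v], and the remaining randomness is moved to [P] through [Zr]. *)
have E' : (\int[P']_w F' (Z' ^~ w) =
    q%:E * \int[P]_w F v (Z ^~ w) + (1 - q)%:E * \int[P]_w F (fun=> 0%R) (Z ^~ w))%E.
  rewrite (exp_decouple (pred1 (inl None)) iZ' mF')//.
  rewrite -(exp_bernoulli_if (iZ'.1 (inl None)) (Zsel' None).1); [|exact: integral_ge0..].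
  apply: eq_integral => w1 _.
  rewrite (ind_exp_eqF iZ iZr ZZr (mF v))// (ind_exp_eqF iZ iZr ZZr (mF (fun=> 0)))//.
  case: eqP => Zw; apply: eq_integral => w2 _; rewrite /F' /F; congr (phi _)%:E.
    rewrite out_Some; last by rewrite /sel/= Zw eqxx.
    by congr (out _ _).
  rewrite out_None; last by rewrite /sel/=; apply/eqP.
  by congr (out _ _); apply/funext => j; rewrite addr0.
rewrite -/(F' _) [X in (b%:E * X)%E]E'.
have -> : (\int[P]_w (phi (out (sel (Z ^~ w)) (noi (Z ^~ w))))%:E =
    \int[P]_w F (fun=> 0%R) (Z ^~ w))%E by apply: eq_integral => w _; rewrite FE.
(* A second decoupling: the selectors are frozen at [w1] while the noise is integrated over [w2]. *)
pose isl (k : I + J) := if k is inl _ then true else false.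
pose A u w1 : \bar R := (\int[P]_w2 F u (fun k => Z k (if isl k then w1 else w2)))%E.
have DE u : (\int[P]_w F u (Z ^~ w) = \int[P]_w1 A u w1)%E.
  by rewrite (exp_decouple isl iZ (mF u)).
have A0 u w1 : (0 <= A u w1)%E by exact: integral_ge0.
have mA u : measurable_fun setT (A u).
  apply: (@measurable_fun_fubini_tonelli_F _ _ T T R P
    (fun ww : T * T => F u (fun k => Z k (if isl k then ww.1 else ww.2)))) => //.
  apply: (fmeasurable_comp (X := fun k ww => Z k (if isl k then ww.1 else ww.2)) (mF u)) => k.
  by case: (isl k); apply: measurableT_comp => //; exact: iZ.1.
have bq0 : 0 <= b * q by rewrite mulr_ge0.
have bq1 : 0 <= b * (1 - q) by rewrite mulr_ge0// subr_ge0.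
(* For frozen selectors this is a pure test of a Gaussian shift: the shifted law has weight [b * q],
   the unshifted one [b * (1 - q)] on the left and [a] on the right. *)
have key w1 : ((b * q)%:E * A v w1 + (b * (1 - q))%:E * A (fun=> 0%R) w1 <=
    a%:E * A (fun=> 0%R) w1 + gpay (b * q) (b * (1 - q) - a) mu0)%E.
  pose psi (z : J -> R) := phi (out (fun i => Z (inl i) w1 == 1) z).
  have izeta : mutually_independent P (fun j => Z (inr j)).
    by apply: (ind_inj (e := inr) _ iZ) => j j' [].
  have mpsi : measurable_fun setT (fun z : #|J|.-tuple R => psi (fun i => tnth z (enum_rank i))).
    apply/measurable_EFinP.
    pose X (k : I + J) (z : #|J|.-tuple R) :=
      match k with inl i => Z (inl i) w1 | inr j => tnth z (enum_rank j) end.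
    have mX k : measurable_fun setT (X k).
      by case: k => [i|j]; [exact: measurable_cst|exact: measurable_tnth].
    exact: (fmeasurable_comp mFb mX).
  have := gauss_shift izeta Znoise mpsi (fun z => tp.2 _) bq0 bq1 a0 mu00 v_le.
  rewrite /A (_ : (\int[P]_w2 F (fun=> 0%R) _ = \int[P]_w (psi (fun j => Z (inr j) w))%:E)%E) //.
  by apply: eq_integral => w _; rewrite FE.
have -> : hs (fun x => 1 - q + q * lrn mu0 x) 1 a b = gpay (b * q) (b * (1 - q) - a) mu0.
  apply: eq_integral => x _; rewrite /payoff /=; congr (Num.max _ _)%:E.
  by ring.
rewrite !DE ge0_muleDr; [|by rewrite mule_ge0// integral_ge0|by rewrite mule_ge0 ?lee_fin ?subr_ge0// integral_ge0].
rewrite !muleA -!EFinM.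
rewrite -!ge0_integralZl_EFin//.
have mZA (c : R) u : measurable_fun setT (fun w => c%:E * A u w)%E by exact: measurable_funeM.
have ZA0 (c : R) u w : 0 <= c -> (0 <= c%:E * A u w)%E by move=> c0; rewrite mule_ge0.
rewrite -ge0_integralD//; try (by move=> w _; exact: ZA0).
(* The bound is the same for all selections; written as the integral of a constant under [P], it is
   compared with the left side under one integral sign. *)
rewrite -[X in (_ <= _ + X)%E](mule1 (gpay _ _ _)) -(@probability_setT _ _ _ P).
rewrite -(@integral_cst _ _ _ P)// -ge0_integralD//.
- apply: ge0_le_integral => //.
  + by move=> w _; rewrite adde_ge0// ZA0.
  + exact: emeasurable_funD.
  + by apply: emeasurable_funD.
- by move=> w _; exact: ZA0.
- by move=> w _; apply: integral_ge0 => x _; rewrite lee_fin max0_ge0.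
Qed.

End one_release.

(** * The release as a function of selectors and noise, and its independent rounds *)

Section release_function.
Context {R : realType}.

Lemma sqr_norm2 k (u : k.-tuple R) : norm2 u ^+ 2 = \sum_(j < k) tnth u j ^+ 2.
Proof. by rewrite sqr_sqrtr// sumr_ge0// => j _; exact: sqr_ge0. Qed.

Lemma sqr_norm2_clip_le k (C : R) (u : k.-tuple R) : 0 < C ->
  \sum_(j < k) tnth (clip C u) j ^+ 2 <= C ^+ 2.
Proof.
move=> C0.
set M := Num.max 1 (norm2 u / C).
have M1 : 1 <= M by rewrite le_max lexx.
have M0 : 0 < M by exact: lt_le_trans M1.
(* Clipping divides by [M], so this inequality is the whole norm bound. *)
have uM : norm2 u <= C * M by rewrite -ler_pdivrMl// mulrC le_max lexx orbT.
rewrite (eq_bigr (fun j => M ^- 2 * tnth u j ^+ 2)); last first.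
  by move=> j _; rewrite tnth_mktuple expr_div_n mulrC.
rewrite -mulr_sumr -sqr_norm2 mulrC ler_pdivrMr ?exprn_gt0// -exprMn.
by rewrite ler_sqr// ?nnegrE ?sqrtr_ge0// mulr_ge0// ltW.
Qed.

Variables (D K : nat) (m cx cy : R).

Definition release {I : finType} (vx : I -> D.-tuple R) (vy : I -> K.-tuple R)
    (s : I -> bool) (z : 'I_D + 'I_K -> R) : D.-tuple R * K.-tuple R :=
  ([tuple m^-1 * (\sum_(i | s i) tnth (vx i) j) + cx * z (inl j) | j < D],
   [tuple m^-1 * (\sum_(i | s i) tnth (vy i) k) + cy * z (inr k) | k < K]).

Lemma measurable_release {I : finType} (vx : I -> D.-tuple R) (vy : I -> K.-tuple R)
    {d} {T : measurableType d} (f : I -> T -> R) (g : 'I_D + 'I_K -> T -> R) :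
  (forall i, measurable_fun setT (f i)) -> (forall k, measurable_fun setT (g k)) ->
  measurable_fun setT (fun w => release vx vy (fun i => f i w == 1) (g ^~ w)).
Proof.
move=> mf mg.
have msum (c : I -> R) : measurable_fun setT (fun w => \sum_(i | f i w == 1) c i).
  under eq_fun do rewrite big_mkcond.
  apply: measurable_sum => i; apply: measurable_fun_ifT => //.
  exact: measurable_fun_eqr.
apply: measurable_fun_pair.
  apply: (measurable_mktuple (X := fun j w =>
    m^-1 * (\sum_(i | f i w == 1) tnth (vx i) j) + cx * g (inl j) w)) => j.
  by apply: measurable_funD; apply: measurable_funM.
apply: (measurable_mktuple (X := fun k w =>
    m^-1 * (\sum_(i | f i w == 1) tnth (vy i) k) + cy * g (inr k) w)) => k.
by apply: measurable_funD; apply: measurable_funM.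
Qed.

Lemma sum_option {I : finType} (s : option I -> bool) (F : option I -> R) :
  \sum_(o | s o) F o = (if s None then F None else 0) + \sum_(i | s (Some i)) F (Some i).
Proof.
have tail (p : pred (option I)) : (forall o, p o = s o && (o != None)) ->
    \sum_(o | p o) F o = \sum_(i | s (Some i)) F (Some i).
  move=> pE; rewrite (reindex_omap some id); last by move=> [i|]; rewrite pE ?andbF.
  by apply: eq_bigl => i; rewrite pE eqxx !andbT.
case: ifPn => sN; first by rewrite (bigD1 None)//= tail.
by rewrite add0r tail// => -[i|]; rewrite ?andbT// (negbTE sN).
Qed.

Lemma release_None {I : finType} (vx : option I -> D.-tuple R)
    (vy : option I -> K.-tuple R) s z : s None = false ->
  release vx vy s z = release (vx \o some) (vy \o some) (s \o some) z.
Proof.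
move=> sN; congr pair; apply: eq_from_tnth => j; rewrite !tnth_mktuple sum_option sN add0r//.
Qed.

(** The standard noise is multiplied by [cx] or [cy] after being drawn, so a contribution [m^-1 * c]
    to the mean is a shift of that noise by [c / (m * cx)] or [c / (m * cy)]. *)
Lemma release_Some {I : finType} (vx : option I -> D.-tuple R)
    (vy : option I -> K.-tuple R) s z : m != 0 -> cx != 0 -> cy != 0 -> s None = true ->
  release vx vy s z = release (vx \o some) (vy \o some) (s \o some)
    (fun k => z k + match k with inl j => tnth (vx None) j / (m * cx)
                             | inr j => tnth (vy None) j / (m * cy) end).
Proof.
move=> m0 cx0 cy0 sN; congr pair; apply: eq_from_tnth => j; rewrite !tnth_mktuple sum_option sN.
  by set S := \sum_(i | _) _; field; rewrite ?cx0 ?m0.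
by set S := \sum_(i | _) _; field; rewrite ?cy0 ?m0.
Qed.

Lemma release_reindex {I I' : finType} (g : I -> I') (vx : I' -> D.-tuple R)
    (vy : I' -> K.-tuple R) s z : bijective g ->
  release vx vy s z = release (vx \o g) (vy \o g) (s \o g) z.
Proof.
move=> [g' gg' g'g].
by congr pair; apply: eq_from_tnth => j; rewrite !tnth_mktuple (reindex g)//; exists g' => i _.
Qed.

End release_function.

Section insertion.
Context {A : Type}.

Lemma ex_insertion (s1 s2 : seq A) (r : A) :
  exists g : option 'I_(size (s1 ++ s2)) -> 'I_(size (s1 ++ r :: s2)),
    [/\ bijective g, tnth (in_tuple (s1 ++ r :: s2)) (g None) = r &
      forall i, tnth (in_tuple (s1 ++ r :: s2)) (g (Some i)) =
                tnth (in_tuple (s1 ++ s2)) i].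
Proof.
set N := size (s1 ++ s2).
have eN : N.+1 = size (s1 ++ r :: s2) by rewrite /N !size_cat /= addnS.
have l0 : (size s1 < N.+1)%N by rewrite /N size_cat ltnS leq_addr.
pose j0 := Ordinal l0.
exists (fun o => cast_ord eN (if o is Some i then lift j0 i else j0)); split.
- exists (fun k => unlift j0 (cast_ord (esym eN) k)).
    by move=> [i|]; rewrite cast_ordK ?liftK// unlift_none.
  by move=> k; case: unliftP => [i|] <-; rewrite cast_ordKV.
- by rewrite (tnth_nth r) /= nth_cat ltnn subnn.
- move=> i; rewrite !(tnth_nth r) /= /bump !nth_cat.
  have [si|si] := leqP (size s1) i; last by rewrite add0n si.
  by rewrite add1n ltnNge leqW// subSn//= leqNgt ltnS si ltnNge si.
Qed.

End insertion.

Section mechanism.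
Context {R : realType} {X : Type} {D K : nat} (f1 : X -> D.-tuple R) (m T : nat)
  (sx sy Cx Cy : R).
Hypotheses (m0 : (0 < m)%N) (sx0 : 0 < sx) (sy0 : 0 < sy) (Cx0 : 0 < Cx) (Cy0 : 0 < Cy).
Implicit Types (S : seq (X * K.-tuple R)).

Let cx := Cx * sx / m%:R.
Let cy := Cy * sy / m%:R.

Definition noise_index {N : nat} (t : 'I_T) (k : 'I_D + 'I_K) : mech_index T N D K :=
  match k with inl j => inr (inl (t, j)) | inr j => inr (inr (t, j)) end.

Definition block_index {N : nat} (t : 'I_T) (k : 'I_N + ('I_D + 'I_K)) :
    mech_index T N D K :=
  match k with inl i => inl (t, i) | inr k => noise_index t k end.

Definition block_of {N : nat} (k : mech_index T N D K) : 'I_T :=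
  match k with inl ti => ti.1 | inr (inl tj) => tj.1 | inr (inr tk) => tk.1 end.

Lemma block_index_inj {N : nat} (t : 'I_T) : injective (@block_index N t).
Proof. by move=> [i|[i|i]] [j|[j|j]] //= [->]. Qed.

Definition step S (t : 'I_T) (z : mech_index T (size S) D K -> R) :
    D.-tuple R * K.-tuple R :=
  release m%:R cx cy (fun i => clip Cx (f1 (tnth (in_tuple S) i).1))
    (fun i => clip Cy (tnth (in_tuple S) i).2)
    (fun i => z (inl (t, i)) == 1) (fun k => z (noise_index t k)).

Lemma ind_step S {dO} {Omega : measurableType dO} (P : probability Omega R)
    (Z : mech_index T (size S) D K -> Omega -> R) :
  mutually_independent P Z ->
  mutually_independent P (fun t w => step t (Z ^~ w)).
Proof.
move=> iZ; apply: (ind_group (blk := block_of) (h := @step S) iZ) => [t|t z z' zz'].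
  apply: (@measurable_release _ _ _ _ _ _ _ _ _ _ _
    (fun i z => tnth z (enum_rank (inl (t, i))))
    (fun k z => tnth z (enum_rank (noise_index t k)))) => i; exact: measurable_tnth.
rewrite /step; congr (release _ _ _ _ _ _ _).
  by apply/funext => i; rewrite zz'.
by apply/funext => -[j|j]; rewrite zz'.
Qed.

Lemma hs_dpfmix (q : R) (s1 s2 : seq (X * K.-tuple R)) (r : X * K.-tuple R)
    {dO} {Omega : measurableType dO} (P : probability Omega R)
    (Z : mech_index T (size (s1 ++ s2)) D K -> Omega -> R)
    {dO'} {Omega' : measurableType dO'} (P' : probability Omega' R)
    (Z' : mech_index T (size (s1 ++ r :: s2)) D K -> Omega' -> R) :
  0 <= q <= 1 -> mech_randomness P q Z -> mech_randomness P' q Z' ->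
  hs_dominated P (dpfmix f1 m sx sy Cx Cy Z)
    P' (dpfmix f1 m sx sy Cx Cy Z')
    (hs (fun x => 1 - q + q * lrn (Num.sqrt (sx ^-2 + sy ^-2)) x) T).
Proof.
move=> q01 [iZ Zb Znx Zny] [iZ' Zb' Znx' Zny'].
have /andP[q0 q1] := q01.
have [g [bg gN gS]] := ex_insertion s1 s2 r.
apply: (hs_composition_upper _ _ (ind_step iZ) (ind_step iZ')).
- apply: measurable_funD => //; apply: measurable_funM => //; exact: measurable_lrn.
- by move=> x; rewrite addr_ge0 ?subr_ge0// mulr_ge0// lrn_ge0.
move=> t.
set S := s1 ++ s2; set S' := s1 ++ r :: s2.
pose vx i := clip Cx (f1 (tnth (in_tuple S') i).1).
pose vy i := clip Cy (tnth (in_tuple S') i).2.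
have mn0 : (m%:R : R) != 0 by rewrite pnatr_eq0 -lt0n.
have m0R : 0 < (m%:R : R) by rewrite ltr0n.
have cx0 : cx != 0 by rewrite gt_eqF// divr_gt0// mulr_gt0.
have cy0 : cy != 0 by rewrite gt_eqF// divr_gt0// mulr_gt0.
pose v (k : 'I_D + 'I_K) : R := match k with
  | inl j => tnth (vx (g None)) j / (m%:R * cx)
  | inr j => tnth (vy (g None)) j / (m%:R * cy) end.
pose out := release m%:R cx cy (vx \o g \o some) (vy \o g \o some).
pose out' := release m%:R cx cy (vx \o g) (vy \o g).
pose e' (k : option 'I_(size S) + ('I_D + 'I_K)) : mech_index T (size S') D K :=
  match k with inl i => inl (t, g i) | inr k => noise_index t k end.
have ig : injective g by case: bg => g' gg' _; exact: can_inj gg'.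
have ie' : injective e'.
  by move=> [i|[i|i]] [j|[j|j]] //= [] // => [/ig ->|->|->].
(* Since [m%:R * cx] is [Cx * sx] and a clipped vector has length at most [Cx], the first block
   contributes at most [sx ^-2]; likewise the second contributes at most [sy ^-2]. *)
have v_le : \sum_k v k ^+ 2 <= Num.sqrt (sx ^-2 + sy ^-2) ^+ 2.
  rewrite sqr_sqrtr ?addr_ge0 ?invr_ge0 ?sqr_ge0// big_sumType /=.
  have bound (k : nat) (C s : R) (u : k.-tuple R) : 0 < C -> 0 < s ->
      \sum_(j < k) (tnth (clip C u) j / (m%:R * (C * s / m%:R))) ^+ 2 <= s ^-2.
    move=> C0 s0; rewrite (eq_bigr (fun j => (C * s) ^-2 * tnth (clip C u) j ^+ 2)).
      rewrite -mulr_sumr; apply: (le_trans (ler_wpM2l _ (sqr_norm2_clip_le u C0))).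
        by rewrite invr_ge0 sqr_ge0.
      by rewrite exprMn invfM mulrC mulrA divff ?mul1r// expf_neq0// gt_eqF.
    move=> j _; rewrite mulrCA [m%:R / m%:R]divff// mulr1 expr_div_n mulrC.
    by congr (_ * _).
  by apply: lerD; exact: bound.
have iZt := ind_inj (@block_index_inj (size S) t) iZ.
have iZt' := ind_inj ie' iZ'.
have E1 : (fun w => step t (Z ^~ w)) = (fun w => out (fun i => Z (block_index t (inl i)) w == 1)
  (fun j => Z (block_index t (inr j)) w)).
  apply/funext => w; rewrite /step /out /=; congr (release _ _ _ _ _ _ _).
    by apply/funext => i; rewrite /vx/= gS.
  by apply/funext => i; rewrite /vy/= gS.
have E2 : (fun w => step t (Z' ^~ w)) = (fun w => out' (fun i => Z' (e' (inl i)) w == 1)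
  (fun j => Z' (e' (inr j)) w)).
  by apply/funext => w; rewrite /step /out' /= (release_reindex _ _ _ _ _ _ _ bg).
rewrite -[hs_dominated _ _ _ _ _]/(hs_dominated P (fun w => step t (Z ^~ w)) P'
  (fun w => step t (Z' ^~ w)) (hs _ 1)) E1 E2.
apply: (@hs_one_release _ _ (D.-tuple R * K.-tuple R)%type _ _ _ _ P P' _ _
  (fun k => Z (block_index t k)) (fun k => Z' (e' k)) q (Num.sqrt (sx ^-2 + sy ^-2))
  out out' v q01 (sqrtr_ge0 _) iZt iZt' (fun i => Zb t i) (fun i => Zb' t (g i))) => //.
- by move=> [j|j] A mA; rewrite ?Znx ?Zny.
- by move=> [j|j] A mA; rewrite ?Znx' ?Zny'.
1,2: apply: (@measurable_release _ _ _ _ _ _ _ _ _ _ _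
    (fun i z => tnth z (enum_rank (inl i))) (fun k z => tnth z (enum_rank (inr k)))) => i;
    exact: measurable_tnth.
- by move=> s z sN; exact: release_None.
- by move=> s z sN; exact: release_Some.
Qed.

End mechanism.

(** * The normal distribution function and the curve [G] *)

Section normal_cdf.
Context {R : realType}.
Implicit Types (s t q x : R).

Lemma PhiE x : (Phi x)%:E = gam `]-oo, x]%classic.
Proof. by rewrite /Phi fineK// ; exact: (@fin_num_measure _ _ _ (@gam R)). Qed.

Lemma gam_itvoc s t : gam `]s, t]%classic = (\int[leb]_(x in `]s, t]) (npdf x)%:E)%E.
Proof.
rewrite [LHS](_ : _ = (\int[gam]_x (\1_`]s, t] x)%:E)%E); last first.
  by rewrite integral_indic// setIT.
rewrite ge0_integral_gam//; last by apply/measurable_EFinP; exact: measurable_indic.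
rewrite [RHS]integral_mkcond; apply: eq_integral => x _.
rewrite patchE indicE; case: ifPn => _; first by rewrite mul1e.
by rewrite mul0e.
Qed.

Lemma Phi_diff s t : s <= t -> (Phi t - Phi s)%:E = gam `]s, t]%classic.
Proof.
move=> st; rewrite EFinB !PhiE.
have -> : `]-oo, t]%classic = `]-oo, s] `|` `]s, t] :> set R.
  by rewrite -itv_bndbnd_setU//= bnd_simp.
rewrite measureU//; last first.
  apply/seteqP; split => x //=; rewrite !in_itv/= => -[xs /andP[sx _]].
  by have := lt_le_trans sx xs; rewrite ltxx.
by rewrite addeAC subee ?add0e//; exact: (@fin_num_measure _ _ _ (@gam R)).
Qed.

Lemma leb_itvoc s t : s <= t -> leb `]s, t]%classic = (t - s)%:E.
Proof.
move=> st; rewrite -[LHS]/(lebesgue_measure `]s, t]%classic) lebesgue_measure_itv/= lte_fin.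
by move: st; rewrite le_eqVlt => /predU1P[->|->]; rewrite ?ltxx ?subrr.
Qed.

Lemma Phi_lipschitz s t : s <= t -> Phi t - Phi s <= normal_peak 1 * (t - s).
Proof.
move=> st; rewrite -lee_fin Phi_diff// gam_itvoc EFinM -(leb_itvoc st).
rewrite -(@integral_cst _ _ _ leb)//; apply: ge0_le_integral => //.
- by move=> x _; rewrite lee_fin npdf_ge0.
- by apply/measurable_funTS/measurable_EFinP; exact: measurable_npdf.
- move=> x _; rewrite lee_fin -npdfE; apply: normal_pdf_ub; exact: oner_neq0.
Qed.

Lemma Phi_lt s t : s < t -> Phi s < Phi t.
Proof.
move=> st; rewrite -subr_gt0 -lte_fin Phi_diff ?ltW// gam_itvoc.
(* The density decreases with the absolute value, so on the interval it is at least its value at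
   [M]. *)
pose M := Num.max (`|s|) (`|t|).
pose c := normal_peak 1 * expR (- (M ^+ 2 / 2)).
have c0 : 0 < c by rewrite mulr_gt0 ?expR_gt0// normal_peak_gt0// oner_neq0.
apply: (@lt_le_trans _ _ (\int[leb]_(x in `]s, t]) c%:E)%E).
  by rewrite integral_cst// [X in (_ * X)%E]leb_itvoc ?ltW// -EFinM lte_fin mulr_gt0// subr_gt0.
apply: ge0_le_integral => //.
- by move=> x _; rewrite lee_fin ltW.
- by apply/measurable_funTS/measurable_EFinP; exact: measurable_npdf.
- move=> x; rewrite /= in_itv/= => H; have {H}[sx xt] := andP H; rewrite lee_fin ler_wpM2l ?normal_peak_ge0//.
  rewrite ler_expR lerN2 ler_pM2r ?invr_gt0// -[x ^+ 2]ger0_norm ?sqr_ge0// normrX.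
  have sM : `|s| <= M by rewrite le_max lexx.
  have tM : `|t| <= M by rewrite le_max lexx orbT.
  have xM : `|x| <= M.
    rewrite ler_norml; have := ler_norm (- s); rewrite normrN => h1.
    by have := ler_norm t => h2; apply/andP; split; lra.
  by rewrite ler_sqr// nnegrE// (le_trans _ xM).
Qed.

Lemma Phi_le s t : s <= t -> Phi s <= Phi t.
Proof. by rewrite le_eqVlt => /predU1P[->//|/Phi_lt/ltW]. Qed.

Lemma Phi_le_iff s t : (Phi s <= Phi t) = (s <= t).
Proof.
apply/idP/idP; last exact: Phi_le.
by apply: contraTT; rewrite -!ltNge; exact: Phi_lt.
Qed.

Lemma Phi_dist_le x y : `|Phi x - Phi y| <= normal_peak 1 * `|x - y|.
Proof.
wlog yx : x y / y <= x => [H|].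
  have [|/ltW] := leP y x; first exact: H.
  by rewrite (distrC (Phi x)) (distrC x); exact: H.
by rewrite !ger0_norm ?subr_ge0// ?Phi_le// Phi_lipschitz.
Qed.

Lemma Phi_continuous : continuous (@Phi R).
Proof.
move=> x; apply/cvgrPdist_le => e e0.
have k0 : 0 < normal_peak 1 :> R by rewrite normal_peak_gt0// oner_neq0.
have ek : 0 < e / normal_peak 1 by rewrite divr_gt0.
near=> y.
have xy : `|x - y| <= e / normal_peak 1 by near: y; exact: cvgr_dist_le.
apply: (@le_trans _ _ (normal_peak 1 * `|x - y|)); last by rewrite -ler_pdivlMl// mulrC.
exact: Phi_dist_le.
Unshelve. all: by end_near. Qed.

Lemma Phi_invK t : Phi_inv (Phi t) = t.
Proof.
rewrite /Phi_inv (_ : [set x | _] = `]-oo, t]%classic) ?sup_itv//.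
by apply/seteqP; split => x /=; rewrite Phi_le_iff in_itv.
Qed.

Definition above t x : R := if t < x then 1 else 0.

Lemma is_test_above t : is_test (above t).
Proof.
split; last by move=> x; rewrite /above; case: ifP; rewrite ?lexx ?ler01.
by apply: measurable_fun_ifT => //; exact: measurable_fun_ltr.
Qed.

Lemma exp_above t : (\int[gam]_x (above t x)%:E = (1 - Phi t)%:E)%E.
Proof.
transitivity (\int[gam]_x (\1_(~` `]-oo, t]) x)%:E)%E.
  apply: eq_integral => x _; congr EFin; rewrite /above indicE in_setC.
  have [tx|xt] := ltP t x.
    by rewrite memNset//= in_itv/=; apply/negP; rewrite -ltNge.
  by rewrite mem_set//= in_itv.
rewrite integral_indic//; last exact: measurableC.
by rewrite setIT EFinB PhiE; exact: (@probability_setC _ _ _ (@gam R)).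
Qed.

Lemma exp_above_lrn mu t :
  (\int[gam]_x (above t x * lrn mu x)%:E = (1 - Phi (t - mu))%:E)%E.
Proof.
have [mab _] := is_test_above t.
rewrite -exp_above; under eq_integral do rewrite EFinM.
rewrite -(@ge0_integral_gam_shift _ mu (fun x => (above t x)%:E)).
- by apply: eq_integral => x _; rewrite /above ltrBlDr.
- exact/measurable_EFinP.
- by move=> x; rewrite lee_fin (test_ge0 _ (is_test_above t)).
Qed.

Lemma Phi_surj q : 0 < q < 1 -> exists t, Phi t = q.
Proof.
move=> /andP[q0 q1].
have mab t : measurable_fun setT (above t) by have [] := is_test_above t.
have ab0 t x : 0 <= above t x by exact: test_ge0 _ (is_test_above t).
have [b qb] : exists b, q < Phi b.
  (* Beyond this point [lrn 1] exceeds [2 / (1 - q)], and it has mean 1; by Markov's inequality the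
     upper tail has mass at most [(1 - q) / 2]. *)
  exists (2^-1 - ln ((1 - q) / 2)).
  set b := (X in Phi X).
  have : (\int[gam]_x (above b x)%:E <= \int[gam]_x ((1 - q) / 2 * lrn 1 x)%:E)%E.
    apply: ge0_exp_le => //; first by apply: measurable_funM => //; exact: measurable_lrn.
    move=> x; rewrite /above; case: ifPn => bx; last first.
      by rewrite mulr_ge0 ?lrn_ge0// divr_ge0// subr_ge0 ltW.
    rewrite -{1}(@lnK _ ((1 - q) / 2)) ?posrE ?divr_gt0 ?subr_gt0// /lrn -expRD.
    rewrite -[leLHS]expR0 ler_expR; move: bx; rewrite /b; lra.
  rewrite exp_above ge0_expZ//; last 3 first.
  - exact: measurable_lrn.
  - by rewrite divr_ge0// subr_ge0 ltW.
  - by move=> x; exact: lrn_ge0.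
  by rewrite exp_lrn mule1 lee_fin; lra.
have [a aq] : exists a, Phi a < q.
  (* The mirror argument with [lrn (-1)]: the lower tail has mass at most [q / 2]. *)
  exists (ln (q / 2) - 2^-1).
  set a := (X in Phi X).
  have : (\int[gam]_x (1 : R)%:E <= \int[gam]_x (above a x + q / 2 * lrn (-1) x)%:E)%E.
    apply: ge0_exp_le => //.
      by apply: measurable_funD => //; apply: measurable_funM => //; exact: measurable_lrn.
    move=> x; rewrite /above; case: ifPn => ax.
      by rewrite lerDl mulr_ge0 ?lrn_ge0// divr_ge0// ltW.
    rewrite add0r -{1}(@lnK _ (q / 2)) ?posrE ?divr_gt0// /lrn -expRD.
    rewrite -[leLHS]expR0 ler_expR; move: ax; rewrite -leNgt /a; lra.
  rewrite exp_cst ge0_expD//; last 2 first.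
  - by apply: measurable_funM => //; exact: measurable_lrn.
  - by move=> x; rewrite mulr_ge0 ?lrn_ge0// divr_ge0// ltW.
  rewrite exp_above ge0_expZ//; last 3 first.
  - exact: measurable_lrn.
  - by rewrite divr_ge0// ltW.
  - by move=> x; exact: lrn_ge0.
  by rewrite exp_lrn mule1 -EFinD lee_fin; lra.
have ab : a <= b by rewrite -Phi_le_iff ltW// (lt_trans aq qb).
have [||c _ cq] := @IVT R (@Phi R) a b q ab.
- by apply: continuous_subspaceT; exact: Phi_continuous.
- by rewrite ge_min le_max !(ltW aq) (ltW qb) orbT.
by exists c.
Qed.

(** The test rejecting above [t] has level [1 - Phi t] and type II error [Phi (t - mu)]; with the
    threshold as parameter, [Phi_inv] disappears from all later arguments. *)
Lemma G_Phi mu t : G mu (1 - Phi t) = Phi (t - mu) .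
Proof.
have Phi01 (x : R) : 0 < Phi x < 1.
  have h0 (y : R) : 0 <= Phi y by rewrite -lee_fin PhiE.
  have h1 (y : R) : Phi y <= 1 by rewrite -lee_fin PhiE; exact: (@probability_le1 _ _ _ (@gam R)).
  apply/andP; split; first by apply: (le_lt_trans (h0 (x - 1))); rewrite Phi_lt// ltrBlDr ltrDl.
  by apply: (lt_le_trans _ (h1 (x + 1))); rewrite Phi_lt// ltrDl.
have /andP[P0 P1] := Phi01 t.
rewrite /G leNgt subr_gt0 P1/= leNgt gtrBl P0/=.
by rewrite subKr Phi_invK.
Qed.

Lemma G_param alpha : 0 < alpha < 1 -> exists t, alpha = 1 - Phi t.
Proof.
move=> /andP[a0 a1]; have [|t tE] := @Phi_surj (1 - alpha).
  by rewrite subr_gt0 a1 gtrBl a0.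
by exists t; rewrite tE subKr.
Qed.

End normal_cdf.

(** * Convex duality between [G] and [gpay] *)

Section gaussian_tradeoff_dual.
Context {R : realType}.
Implicit Types (a b c t alpha mu p : R).

Lemma max0_sub c : c = Num.max 0 c - Num.max 0 (- c).
Proof.
have [c0|c0] := leP 0 c; first by rewrite max_l ?oppr_le0// subr0.
by rewrite max_r ?oppr_ge0 ?ltW// opprK add0r.
Qed.

Let m1 b c1 t mu := fun x : R => above t x * (b * lrn mu x + c1).

Let mabove t : measurable_fun setT (above t). Proof. by have [] := is_test_above t. Qed.
Let above0 t x : 0 <= above t x. Proof. exact: test_ge0 _ (is_test_above t). Qed.

Let exp_m1 b c1 t mu : 0 <= b -> 0 <= c1 ->
  (\int[gam]_x (m1 b c1 t mu x)%:E = (b * (1 - Phi (t - mu)) + c1 * (1 - Phi t))%:E)%E.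
Proof.
move=> b0 c10; have ml := @measurable_lrn R mu.
have al0 x : 0 <= above t x * lrn mu x by rewrite mulr_ge0// lrn_ge0.
transitivity (\int[gam]_x (b * (above t x * lrn mu x) + c1 * above t x)%:E)%E.
  by apply: eq_integral => x _; rewrite /m1; congr EFin; ring.
rewrite ge0_expD; last 4 first.
- by apply: measurable_funM => //; exact: measurable_funM.
- exact: measurable_funM.
- by move=> x; rewrite mulr_ge0.
- by move=> x; rewrite mulr_ge0.
rewrite !ge0_expZ//; last exact: measurable_funM.
by rewrite exp_above exp_above_lrn.
Qed.

Let exp_max0 b c t mu : 0 <= b ->
  (\int[gam]_x (Num.max 0 (b * lrn mu x + c) + Num.max 0 (- c) * above t x)%:E =
   gpay b c mu + (Num.max 0 (- c) * (1 - Phi t))%:E)%E.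
Proof.
move=> b0; rewrite ge0_expD; last 4 first.
- by apply/measurable_EFinP; exact: measurable_gpay_integrand.
- exact: measurable_funM.
- by move=> x; exact: max0_ge0.
- by move=> x; rewrite mulr_ge0// max0_ge0.
by rewrite ge0_expZ ?max0_ge0// exp_above.
Qed.

(** The left side integrates [b * lrn mu x + c] over the rejection region of the threshold test,
    which is at most the integral of the positive part. *)
Lemma gpay_above_le b c mu t : 0 <= b ->
  ((b * (1 - Phi (t - mu)) + c * (1 - Phi t))%:E <= gpay b c mu)%E.
Proof.
move=> b0; have ml := @measurable_lrn R mu.
have : (\int[gam]_x (m1 b (Num.max 0 c) t mu x)%:E <=
  \int[gam]_x (Num.max 0 (b * lrn mu x + c) + Num.max 0 (- c) * above t x)%:E)%E.
  apply: ge0_exp_le.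
  - apply: measurable_funM => //; apply: measurable_funD => //; exact: measurable_funM.
  - apply: measurable_funD; last exact: measurable_funM.
    by apply/measurable_EFinP; exact: measurable_gpay_integrand.
  - by move=> x; rewrite mulr_ge0// addr_ge0 ?max0_ge0// mulr_ge0// lrn_ge0.
  - move=> x; rewrite /m1 /above; case: ifP => _; last by rewrite mul0r mulr0 addr0 max0_ge0.
    by have := max0_ge (b * lrn mu x + c); have := max0_sub c; lra.
rewrite exp_m1 ?max0_ge0// exp_max0// -leeBlDr// -EFinB.
set A := 1 - Phi t; have -> // : b * (1 - Phi (t - mu)) + Num.max 0 c * A - Num.max 0 (- c) * A =
  b * (1 - Phi (t - mu)) + c * A.
by rewrite [in RHS](max0_sub c) mulrBl addrA.
Qed.

Lemma gpay_aboveE b c mu t : 0 <= b ->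
  (forall x, (t < x) = (0 < b * lrn mu x + c)) ->
  gpay b c mu = (b * (1 - Phi (t - mu)) + c * (1 - Phi t))%:E.
Proof.
move=> b0 tx.
have : (\int[gam]_x (m1 b (Num.max 0 c) t mu x)%:E =
  \int[gam]_x (Num.max 0 (b * lrn mu x + c) + Num.max 0 (- c) * above t x)%:E)%E.
  apply: eq_integral => x _; congr EFin; rewrite /m1 /above tx.
  have [pos|neg] := ltP 0 (b * lrn mu x + c).
    by rewrite mul1r mulr1; have := max0_sub c; lra.
  by rewrite mul0r mulr0 addr0.
rewrite exp_m1 ?max0_ge0// exp_max0// => H.
rewrite -[LHS](@addeK _ (Num.max 0 (- c) * (1 - Phi t))%:E)// -H -EFinB; congr EFin.
by rewrite [in RHS](max0_sub c); ring.
Qed.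

Lemma G_dual_le b c mu alpha : 0 <= b -> 0 <= alpha <= 1 ->
  ((b * (1 - G mu alpha) + c * alpha)%:E <= gpay b c mu)%E.
Proof.
move=> b0 /andP[]; rewrite le_eqVlt => /predU1P[<- _|a0].
  by rewrite /G lexx subrr !mulr0 addr0; apply: integral_ge0 => x _; rewrite lee_fin max0_ge0.
rewrite le_eqVlt => /predU1P[->|a1].
  rewrite /G ler10 lexx subr0 !mulr1; apply: le_trans (gpay_ge c mu b0).
  by rewrite lee_fin max0_ge.
have [|t ->] := @G_param R alpha; first by rewrite a0 a1.
by rewrite G_Phi; exact: gpay_above_le.
Qed.

Lemma lrn_threshold b c mu : 0 < mu -> 0 < b -> 0 < c ->
  forall x, ((ln (c / b) + mu ^+ 2 / 2) / mu < x) = (0 < b * lrn mu x - c).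
Proof.
move=> mu0 b0 c0 x; rewrite subr_gt0 [b * lrn _ _]mulrC -[in RHS]ltr_pdivrMr// [in LHS]ltr_pdivrMr//.
rewrite -[in RHS](@lnK _ (c / b)) ?posrE ?divr_gt0// /lrn ltr_expR ltrBrDr.
by rewrite [x * mu]mulrC.
Qed.

Lemma Phi_bounds t : 0 <= Phi t <= 1.
Proof.
apply/andP; split; first by rewrite -lee_fin PhiE.
by rewrite -lee_fin PhiE; exact: (@probability_le1 _ _ _ (@gam R)).
Qed.

(** The maximizing test rejects always if [c] is nonnegative, never if [b] vanishes and [c] is
    negative, and otherwise above the point where [b * lrn mu x + c] changes sign; [0 < mu] makes
    the ratio increasing, so the region is a half-line. *)
Lemma G_dual_attained b c mu : 0 < mu -> 0 <= b -> exists2 alpha, 0 <= alpha <= 1 &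
  gpay b c mu = (b * (1 - G mu alpha) + c * alpha)%:E.
Proof.
move=> mu0 b0; have [c0|c0] := leP 0 c.
  exists 1; first by rewrite ler01 lexx.
  rewrite /G ler10 lexx subr0 !mulr1 /gpay.
  have ml := @measurable_lrn R mu.
  under eq_integral do rewrite max_r ?addr_ge0 ?mulr_ge0 ?lrn_ge0//.
  rewrite ge0_expD//; last 2 first.
  - exact: measurable_funM.
  - by move=> x; rewrite mulr_ge0 ?lrn_ge0.
  by rewrite ge0_expZ ?exp_cst ?exp_lrn ?mule1// => x; exact: lrn_ge0.
move: b0; rewrite le_eqVlt => /predU1P[<-|b0].
  exists 0; first by rewrite ler01 lexx.
  rewrite mul0r mulr0 addr0 /gpay.
  by under eq_integral do rewrite mul0r add0r max_l ?(ltW c0)//; rewrite exp_cst.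
have nc0 : 0 < - c by rewrite oppr_gt0.
have thr := lrn_threshold mu0 b0 nc0.
set t := (_ / mu) in thr.
exists (1 - Phi t); first by have := Phi_bounds t; lra.
by rewrite G_Phi; apply: gpay_aboveE; [exact: ltW|move=> x; rewrite thr opprK].
Qed.

(** The slope of [G mu] at [1 - Phi t] is [- lrn mu t], the likelihood ratio at the threshold. *)
Lemma G_dual_support mu alpha : 0 < mu -> 0 < alpha < 1 -> exists2 a, 0 <= a &
  gpay 1 (- a) mu = (1 - G mu alpha - a * alpha)%:E.
Proof.
move=> mu0 /G_param[t ->]; exists (lrn mu t); first exact: lrn_ge0.
rewrite (@gpay_aboveE _ _ _ t)//; first by rewrite G_Phi mul1r mulNr.
move=> x; rewrite mul1r subr_gt0 /lrn ltr_expR ltrD2r ltr_pM2l//.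
Qed.

End gaussian_tradeoff_dual.

(** * Supporting lines of a trade-off function *)

Section tradeoff_support.
Context {R : realType} {d d' dY} {T : measurableType d} {T' : measurableType d'}
  {Y : measurableType dY}.
Variables (P : probability T R) (P' : probability T' R) (X : T -> Y) (X' : T' -> Y)
  (mX : measurable_fun setT X) (mX' : measurable_fun setT X').
Implicit Types (phi psi : Y -> R) (a alpha e r : R) (h : R -> R -> \bar R).

Let E phi : R := fine (\int[P]_w (phi (X w))%:E)%E.
Let E' phi : R := fine (\int[P']_w (phi (X' w))%:E)%E.

Let EE phi : is_test phi -> (\int[P]_w (phi (X w))%:E = (E phi)%:E)%E.
Proof. by move=> tp; rewrite /E fineK//; exact: exp_test_fin. Qed.
Let EE' phi : is_test phi -> (\int[P']_w (phi (X' w))%:E = (E' phi)%:E)%E.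
Proof. by move=> tp; rewrite /E' fineK//; exact: exp_test_fin. Qed.

Let E'01 phi : is_test phi -> 0 <= E' phi <= 1.
Proof.
by move=> tp; rewrite -!lee_fin -EE'// exp_test_ge0// exp_test_le1.
Qed.

Lemma is_test_cst a : 0 <= a <= 1 -> is_test (fun _ : Y => a).
Proof. by move=> a01; split. Qed.

Let E_cst a : E (fun=> a) = a.
Proof. by rewrite /E exp_cst. Qed.
Let E'_cst a : E' (fun=> a) = a.
Proof. by rewrite /E' exp_cst. Qed.

Lemma is_test_mix a phi psi : 0 <= a <= 1 -> is_test phi -> is_test psi ->
  is_test (fun y => a * phi y + (1 - a) * psi y).
Proof.
move=> /andP[a0 a1] [mp p01] [mq q01]; split.
  by apply: measurable_funD; exact: measurable_funM.
move=> y; have /andP[p0 p1] := p01 y; have /andP[q0 q1] := q01 y.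
have b0 : 0 <= 1 - a by rewrite subr_ge0.
apply/andP; split; first by rewrite addr_ge0// mulr_ge0.
have : a * phi y <= a by rewrite ler_piMr.
have : (1 - a) * psi y <= 1 - a by rewrite ler_piMr.
lra.
Qed.

Let exp_mix {d0} {T0 : measurableType d0} (P0 : probability T0 R) (X0 : T0 -> Y) a phi psi :
  measurable_fun setT X0 -> 0 <= a <= 1 -> is_test phi -> is_test psi ->
  fine (\int[P0]_w (a * phi (X0 w) + (1 - a) * psi (X0 w))%:E)%E =
  a * fine (\int[P0]_w (phi (X0 w))%:E)%E + (1 - a) * fine (\int[P0]_w (psi (X0 w))%:E)%E.
Proof.
move=> mX0 /andP[a0 a1] tp tq.
have b0 : 0 <= 1 - a by rewrite subr_ge0.
have mp := measurableT_comp tp.1 mX0; have mq := measurableT_comp tq.1 mX0.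
have p0 w : 0 <= phi (X0 w) by exact: test_ge0.
have q0 w : 0 <= psi (X0 w) by exact: test_ge0.
have fp := exp_test_fin P0 mX0 tp; have fq := exp_test_fin P0 mX0 tq.
rewrite ge0_expD; last 4 first.
- exact: measurable_funM.
- exact: measurable_funM.
- by move=> w; rewrite mulr_ge0.
- by move=> w; rewrite mulr_ge0.
rewrite !ge0_expZ// fineD ?fineM//; by rewrite fin_numM.
Qed.

Local Notation tf := (tradeoff P X P' X').

Let tfset alpha := [set r : R | exists phi : Y -> R,
     [/\ measurable_fun setT phi, (forall y, 0 <= phi y <= 1),
         (\int[P]_w (phi (X w))%:E <= alpha%:E)%E &
         r = 1 - fine (\int[P']_w (phi (X' w))%:E)]].

Let tfset_lb alpha : lbound (tfset alpha) 0.
Proof.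
move=> _ [phi [mp p01 _ ->]].
by have := E'01 (conj mp p01); rewrite /E'; lra.
Qed.

Let tfset_n0 alpha : 0 <= alpha -> tfset alpha !=set0.
Proof.
move=> a0; exists (1 - E' (fun=> 0)), (fun=> 0); split => //.
- by move=> y; rewrite lexx ler01.
- by rewrite exp_cst lee_fin.
Qed.

Lemma tradeoff_ge0 alpha : 0 <= alpha -> 0 <= tf alpha.
Proof. by move=> a0; apply: lb_le_inf; [exact: tfset_n0|exact: tfset_lb]. Qed.

Lemma tradeoff_le alpha phi : is_test phi ->
  (\int[P]_w (phi (X w))%:E <= alpha%:E)%E ->
  tf alpha <= 1 - fine (\int[P']_w (phi (X' w))%:E)%E.
Proof.
move=> [mp p01] Ea; apply: ge_inf; first by exists 0; exact: tfset_lb.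
by exists phi.
Qed.

Lemma tradeoff_ge alpha r : 0 <= alpha ->
  (forall phi, is_test phi -> (\int[P]_w (phi (X w))%:E <= alpha%:E)%E ->
    r <= 1 - fine (\int[P']_w (phi (X' w))%:E)%E) -> r <= tf alpha.
Proof.
move=> a0 H; apply: lb_le_inf; first exact: tfset_n0.
by move=> _ [phi [mp p01 Ea ->]]; exact: H.
Qed.

Lemma tradeoff_approach alpha e : 0 <= alpha -> 0 < e -> exists2 phi, is_test phi &
  (\int[P]_w (phi (X w))%:E <= alpha%:E)%E /\
  1 - fine (\int[P']_w (phi (X' w))%:E)%E < tf alpha + e.
Proof.
move=> a0 e0.
have hi : has_inf (tfset alpha) by split; [exact: tfset_n0|exists 0; exact: tfset_lb].
have [_ [phi [mp p01 Ea ->]] lt] := inf_adherent e0 hi.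
by exists phi.
Qed.

Lemma tradeoff_le1 alpha : 0 <= alpha <= 1 -> tf alpha <= 1 - alpha.
Proof.
move=> a01; rewrite -[in leRHS](E'_cst alpha).
by apply: tradeoff_le; [exact: is_test_cst|rewrite exp_cst].
Qed.

(* The supporting slope at [alpha] is the best trade of power against level for tests
   of level more than [alpha]; mixing with a test of level less than [alpha] shows
   that it works on the other side as well. *)
Lemma tradeoff_support alpha : 0 < alpha < 1 -> exists2 a, 0 <= a &
  forall phi, is_test phi ->
  fine (\int[P']_w (phi (X' w))%:E)%E <=
  a * fine (\int[P]_w (phi (X w))%:E)%E + (1 - tf alpha - a * alpha).
Proof.
move=> /andP[a0 a1].
set k := 1 - tf alpha.
have k_ge phi : is_test phi -> E phi <= alpha -> E' phi <= k.
  move=> tp Ea; have := @tradeoff_le alpha phi tp; rewrite EE// lee_fin => /(_ Ea).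
  by rewrite -/(E' phi) /k; lra.
pose A := [set s : R | exists phi, [/\ is_test phi, alpha < E phi &
  s = (E' phi - k) / (E phi - alpha)]].
have cross phi psi : is_test phi -> is_test psi -> alpha < E phi -> E psi <= alpha ->
    (E' phi - k) * (alpha - E psi) <= (k - E' psi) * (E phi - alpha).
  move=> tp tq pa qa.
  have D0 : 0 < E phi - E psi by rewrite subr_gt0 (le_lt_trans qa).
  (* With this weight the mixture of [phi] and [psi] has level exactly [alpha], so its power is at
     most [k]. *)
  pose l := (alpha - E psi) / (E phi - E psi).
  have l01 : 0 <= l <= 1.
    apply/andP; split; first by apply: divr_ge0; [rewrite subr_ge0|exact: ltW].
    by rewrite ler_pdivrMr// mul1r; have := ltW pa; lra.
  have := k_ge _ (is_test_mix l01 tp tq).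
  rewrite /E /E' !exp_mix// -/(E phi) -/(E psi) -/(E' phi) -/(E' psi).
  have lE : l * (E phi - E psi) = alpha - E psi by rewrite /l divfK// gt_eqF.
  have -> : l * E phi + (1 - l) * E psi = alpha by lra.
  move=> /(_ (lexx _)) H.
  have : (l * E' phi + (1 - l) * E' psi) * (E phi - E psi) <= k * (E phi - E psi).
    by rewrite ler_pM2r.
  have -> : (l * E' phi + (1 - l) * E' psi) * (E phi - E psi) =
    E' phi * (l * (E phi - E psi)) + E' psi * ((E phi - E psi) - l * (E phi - E psi)) by ring.
  rewrite lE; set u := E phi; set v := E psi; set u' := E' phi; set v' := E' psi; nra.
have t0 : is_test (fun _ : Y => 0 : R) by apply: is_test_cst; rewrite lexx ler01.
have t1 : is_test (fun _ : Y => 1 : R) by apply: is_test_cst; rewrite ler01 lexx.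
have ubA psi : is_test psi -> E psi < alpha -> ubound A ((k - E' psi) / (alpha - E psi)).
  move=> tq qa _ [phi [tp pa ->]].
  rewrite ler_pdivrMr ?subr_gt0// mulrAC ler_pdivlMr ?subr_gt0//.
  by apply: cross => //; exact: ltW.
have hA : has_sup A.
  split; last by exists ((k - E' (fun=> 0)) / (alpha - E (fun=> 0))); apply: ubA => //; rewrite E_cst.
  by exists ((E' (fun=> 1) - k) / (E (fun=> 1) - alpha)), (fun=> 1); split => //; rewrite E_cst.
have supge phi : is_test phi -> alpha < E phi -> (E' phi - k) / (E phi - alpha) <= sup A.
  by move=> tp pa; apply: ub_le_sup; [exact: hA.2|exists phi].
exists (sup A).
  apply: le_trans (supge _ t1 _); last by rewrite E_cst.
  rewrite E_cst E'_cst divr_ge0 ?subr_ge0 ?(ltW a1)//.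
  by rewrite /k gerBl tradeoff_ge0// ltW.
move=> phi tp; rewrite -/(E phi) -/(E' phi).
suff : E' phi - k <= sup A * (E phi - alpha) by rewrite /k; lra.
have [pa|pa|pa] := ltgtP (E phi) alpha.
- have : sup A <= (k - E' phi) / (alpha - E phi).
    by apply: ge_sup; [exact: hA.1|exact: ubA].
  by rewrite ler_pdivlMr ?subr_gt0//; lra.
- by rewrite -ler_pdivrMr ?subr_gt0//; exact: supge.
- by rewrite pa subrr mulr0 subr_le0; apply: k_ge; rewrite // pa.
Qed.

Lemma tradeoff_ge_dominated h alpha a r : hs_dominated P X P' X' h -> 0 <= a -> 0 <= alpha ->
  (h a 1%R <= r%:E)%E -> 1 - a * alpha - r <= tf alpha.
Proof.
move=> H a0 al0 hr; apply: tradeoff_ge => // phi tp.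
rewrite -/(E' phi).
rewrite EE// lee_fin => Ea.
have := H phi a 1 tp a0 ler01; rewrite mul1e EE// EE'// => /le_trans.
move=> /(_ (a%:E * (E phi)%:E + r%:E))%E; rewrite leeD2l// => /(_ isT).
rewrite -EFinM -EFinD lee_fin.
have : a * E phi <= a * alpha by rewrite ler_wpM2l.
by move: (E phi) (E' phi) (a * E phi) (a * alpha) => x y z t; lra.
Qed.

(** The supporting line bounds the power of every test affinely in its level, in particular that of
    the tests approaching [h a 1]; the slope [a] comes from the line, not from [h]. *)
Lemma tradeoff_le_approached h alpha : hs_approached P X P' X' h -> 0 < alpha < 1 ->
  exists2 a, 0 <= a & (h a 1%R <= (1 - tf alpha - a * alpha)%:E)%E.
Proof.
move=> H al01; have [a a0 Ha] := tradeoff_support al01; exists a => //.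
apply/lee_addgt0Pr => e e0.
have [phi tp] := H a 1 e a0 ler01 e0.
rewrite mul1e EE// EE'// -EFinM -EFinD => hphi.
have := Ha phi tp; rewrite -/(E phi) -/(E' phi) => HE.
have := leeD2r (- (a * E phi)%:E)%E hphi.
rewrite addeK// -EFinB => /le_trans; apply.
by rewrite -EFinD lee_fin; lra.
Qed.

End tradeoff_support.

(** * Divergences of a pair with trade-off function [mixG] *)

Section subsampled_gaussian.
Context {R : realType}.

Definition sub_lr (p mu : R) (x : R) : R := 1 - p + p * lrn mu x.

Lemma measurable_sub_lr (p mu : R) : measurable_fun setT (sub_lr p mu).
Proof. by apply: measurable_funD => //; apply: measurable_funM => //; exact: measurable_lrn. Qed.

Lemma sub_lr_ge0 (p mu x : R) : 0 <= p <= 1 -> 0 <= sub_lr p mu x.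
Proof. by move=> /andP[p0 p1]; rewrite addr_ge0 ?subr_ge0// mulr_ge0// lrn_ge0. Qed.

Lemma hs_sub_lr (p mu a b : R) :
  hs (sub_lr p mu) 1 a b = gpay (b * p) (b * (1 - p) - a) mu.
Proof.
apply: eq_integral => x _; rewrite /payoff /sub_lr /=; congr (Num.max _ _)%:E; by ring.
Qed.

Context {d d' dY} {T : measurableType d} {T' : measurableType d'} {Y : measurableType dY}.
Variables (P : probability T R) (P' : probability T' R) (X : T -> Y) (X' : T' -> Y)
  (mX : measurable_fun setT X) (mX' : measurable_fun setT X') (p mu : R).
Hypotheses (p01 : 0 <= p <= 1) (mu0 : 0 < mu)
  (tfE : forall alpha, 0 <= alpha <= 1 -> tradeoff P X P' X' alpha = mixG p mu alpha).

(** The [Id_tf] part of [mixG] is affine and matches the constant [1 - p] in [sub_lr]; what remains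
    is the dual inequality for [G] with weight [b * p]. *)
Lemma mixG_hs_dominated : hs_dominated P X P' X' (hs (sub_lr p mu) 1).
Proof.
move=> phi a b tp a0 b0; have /andP[p0 p1] := p01.
have fP := exp_test_fin P mX tp; have fP' := exp_test_fin P' mX' tp.
set x := fine (\int[P]_w (phi (X w))%:E)%E.
set y := fine (\int[P']_w (phi (X' w))%:E)%E.
have xE : (\int[P]_w (phi (X w))%:E = x%:E)%E by rewrite /x fineK.
have yE : (\int[P']_w (phi (X' w))%:E = y%:E)%E by rewrite /y fineK.
have x01 : 0 <= x <= 1 by rewrite -!lee_fin -xE exp_test_ge0// exp_test_le1.
have := @tradeoff_le R _ _ _ _ _ _ P P' X X' mX' x phi tp.
rewrite xE lexx tfE// -/y => /(_ isT) H.
rewrite yE hs_sub_lr -EFinM.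
have bp0 : 0 <= b * p by rewrite mulr_ge0.
apply: (@le_trans _ _ ((a * x)%:E + (b * p * (1 - G mu x) + (b * (1 - p) - a) * x)%:E)%E);
  last by apply: leeD2l; exact: G_dual_le.
rewrite -EFinD lee_fin.
have : b * mixG p mu x <= b * (1 - y) by rewrite ler_wpM2l.
by rewrite /mixG /Id_tf; move: (G mu x) => g; lra.
Qed.

Lemma mixG_hs_approached : hs_approached P X P' X' (hs (sub_lr p mu) 1).
Proof.
move=> a b e a0 b0 e0; have /andP[p0 p1] := p01.
have bp0 : 0 <= b * p by rewrite mulr_ge0.
have [al al01 gE] := @G_dual_attained R (b * p) (b * (1 - p) - a) mu mu0 bp0.
have /andP[al0 al1] := al01.
have b10 : 0 < b + 1 by rewrite ltr_wpDl.
(* The slack in the error is later multiplied by [b], which may be 0, hence the division by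
   [b + 1]. *)
have eb0 : 0 < e / (b + 1) by rewrite divr_gt0.
have [phi tp [Ea Elt]] := @tradeoff_approach R _ _ _ _ _ _ P P' X X' mX' al (e / (b + 1)) al0 eb0.
exists phi => //.
have fP := exp_test_fin P mX tp; have fP' := exp_test_fin P' mX' tp.
move: Ea Elt; set y := fine (\int[P']_w (phi (X' w))%:E)%E.
have yE : (\int[P']_w (phi (X' w))%:E = y%:E)%E by rewrite /y fineK.
set x := fine (\int[P]_w (phi (X w))%:E)%E.
have xE : (\int[P]_w (phi (X w))%:E = x%:E)%E by rewrite /x fineK.
rewrite xE yE lee_fin tfE// hs_sub_lr gE -!EFinM -!EFinD lee_fin => xal ylt.
have h1 : a * x <= a * al by rewrite ler_wpM2l.
have h2 : b * (1 - y) <= b * (mixG p mu al + e / (b + 1)) by rewrite ler_wpM2l// ltW.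
have h3 : b * (e / (b + 1)) <= e.
  by rewrite mulrCA ler_piMr ?(ltW e0)// ler_pdivrMr// mul1r lerDl.
move: h2; rewrite /mixG /Id_tf mulrDr; move: (G mu al) => g; lra.
Qed.

End subsampled_gaussian.

(** * Decay of the divergence for large [a] *)

Section second_moments.
Context {R : realType}.

(** The constant is that of the tangency in [4 * a * (b - a) <= b ^+ 2], which is the square of
    [b - 2 * a]. *)
Lemma payoff_le_sq (a b : R) : 0 < a -> (payoff a b <= ((4 * a)^-1 * b ^+ 2)%:E)%E.
Proof.
move=> a0; rewrite lee_fin; have a40 : 0 < 4 * a by rewrite mulr_gt0.
have [ba|ab] := leP 0 (b - a); last by rewrite mulr_ge0 ?invr_ge0 ?(ltW a40) ?sqr_ge0.
rewrite mulrC ler_pdivlMr//; have := sqr_ge0 (b - 2 * a); nra.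
Qed.

(** Monomials are eigenfunctions of [kop L], with the moment of [L] as eigenvalue. *)
Lemma iter_kop_pow (L : R -> R) (k n : nat) (c r b : R) :
  measurable_fun setT L -> (forall x, 0 <= L x) -> 0 <= c -> 0 <= b -> 0 <= r ->
  (\int[gam]_x (L x ^+ k)%:E = r%:E)%E ->
  iter n (kop L) (fun b => (c * b ^+ k)%:E) b = (c * r ^+ n * b ^+ k)%:E.
Proof.
move=> mL L0 c0 b0 r0 rE; elim: n b b0 => [|n IH] b b0 /=; first by rewrite expr0 mulr1.
rewrite /kop; under eq_integral do rewrite IH ?mulr_ge0//.
transitivity (\int[gam]_x (c * r ^+ n * b ^+ k * L x ^+ k)%:E)%E.
  by apply: eq_integral => x _; rewrite exprMn mulrA.
rewrite ge0_expZ.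
- by rewrite rE -EFinM exprS; congr EFin; ring.
- exact: measurable_funX.
- by rewrite !mulr_ge0// exprn_ge0.
- by move=> x; rewrite exprn_ge0.
Qed.

Lemma iter_kop_le (L : R -> R) n (F F' : R -> \bar R) (b : R) :
  measurable_fun setT L -> (forall x, 0 <= L x) -> 0 <= b ->
  measurable_fun setT F -> measurable_fun setT F' ->
  (forall b, 0 <= F b)%E -> (forall b, 0 <= F' b)%E ->
  (forall c, (0 <= c)%R -> F c <= F' c)%E ->
  (iter n (kop L) F b <= iter n (kop L) F' b)%E.
Proof.
move=> mL L0 + mF mF' F0 F'0 FF'; elim: n b => [|n IH] b b0 /=; first exact: FF'.
by apply: kop_le => //; solve [exact: measurable_iter_kop | exact: iter_kop_ge0].
Qed.

Lemma hs_le_inv (L : R -> R) (n : nat) (r a : R) :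
  measurable_fun setT L -> (forall x, 0 <= L x) -> 0 <= r ->
  (\int[gam]_x (L x ^+ 2)%:E = r%:E)%E -> 0 < a ->
  (hs L n a 1 <= (r ^+ n / (4 * a))%:E)%E.
Proof.
move=> mL L0 r0 rE a0; have a40 : 0 <= (4 * a)^-1 by rewrite invr_ge0 mulr_ge0// ltW.
apply: (@le_trans _ _ (iter n (kop L) (fun b => ((4 * a)^-1 * b ^+ 2)%:E) 1)%R).
  apply: iter_kop_le => //.
  - exact: measurable_payoff.
  - by apply/measurable_EFinP; apply: measurable_funM => //; exact: measurable_funX.
  - by move=> b; exact: payoff_ge0.
  - by move=> b; rewrite lee_fin mulr_ge0// sqr_ge0.
  - by move=> b _; exact: payoff_le_sq.
by rewrite (@iter_kop_pow L 2 n _ r)// expr1n mulr1 mulrC.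
Qed.

End second_moments.

(** * From divergences to trade-off functions *)

Section comparison.
Context {R : realType}.

(** At level 0 the term with slope [a] vanishes, so [a] can be taken as large as desired; the decay
    of [h a 1] then leaves no power at all. *)
Lemma tradeoff0_dominated {d3 d4 dW} {O3 : measurableType d3} {O4 : measurableType d4}
    {W : measurableType dW} (P3 : probability O3 R) (P4 : probability O4 R)
    (X : O3 -> W) (X' : O4 -> W) (h : R -> R -> \bar R) (C : R) :
  measurable_fun setT X -> measurable_fun setT X' -> hs_dominated P3 X P4 X' h ->
  (forall a, 0 < a -> (h a 1%R <= (C / a)%:E)%E) -> 1 <= tradeoff P3 X P4 X' 0.
Proof.
move=> mX mX' hX hC; apply/ler_addgt0Pr => e e0; rewrite -lerBlDr.
have C10 : 0 < `|C| + 1 by rewrite ltr_wpDl.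
have a0 : 0 < (`|C| + 1) / e by rewrite divr_gt0.
have := @tradeoff_ge_dominated R _ _ _ _ _ _ P3 P4 X X' mX mX' h 0 _ e hX (ltW a0) (lexx _).
rewrite mulr0 subr0; apply; apply: (le_trans (hC _ a0)).
rewrite lee_fin invf_div mulrCA ger_pMr// ler_pdivrMr// mul1r.
by rewrite (le_trans (ler_norm C))// lerDl.
Qed.

(** At an interior level the supporting line of the first curve is, through [h], a lower bound for
    the second. The endpoints need separate arguments: decay of [h] at 0, nonnegativity at 1. *)
Lemma tradeoff_compare {d1 d2 dY} {O1 : measurableType d1} {O2 : measurableType d2}
    {Y : measurableType dY} (P1 : probability O1 R) (P2 : probability O2 R)
    (U : O1 -> Y) (V : O2 -> Y)
    {d3 d4 dW} {O3 : measurableType d3} {O4 : measurableType d4}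
    {W : measurableType dW} (P3 : probability O3 R) (P4 : probability O4 R)
    (X : O3 -> W) (X' : O4 -> W) (h : R -> R -> \bar R) (C alpha : R) :
  measurable_fun setT U -> measurable_fun setT V ->
  measurable_fun setT X -> measurable_fun setT X' ->
  hs_approached P1 U P2 V h -> hs_dominated P3 X P4 X' h ->
  (forall a, 0 < a -> (h a 1%R <= (C / a)%:E)%E) -> 0 <= alpha <= 1 ->
  tradeoff P1 U P2 V alpha <= tradeoff P3 X P4 X' alpha.
Proof.
move=> mU mV mX mX' hUV hX hC al01; have /andP[al0 al1] := al01.
move: (al0); rewrite le_eqVlt => /predU1P[al0'|algt0].
  apply: (@le_trans _ _ 1).
    by rewrite (le_trans (tradeoff_le1 _ _ _ mV al01))// gerBl.
  by rewrite -al0'; exact: tradeoff0_dominated hX hC.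
move: al1; rewrite le_eqVlt => /predU1P[al1|allt1].
  apply: (@le_trans _ _ 0); last exact: tradeoff_ge0.
  by rewrite (le_trans (tradeoff_le1 _ _ _ mV al01))// al1 subrr.
have [|a a0 ha] := tradeoff_le_approached mU mV (alpha := alpha) hUV.
  by rewrite algt0.
have := @tradeoff_ge_dominated R _ _ _ _ _ _ P3 P4 X X' mX mX' h alpha a _ hX a0 al0 ha.
lra.
Qed.

(** Replacing a test by its complement exchanges the two kinds of error: a test for the reversed
    pair with level [y] and power [x] becomes one for the original pair with level [1 - x] and type
    II error [y], so [1 - x] belongs to the set whose infimum is [tf_inv f alpha]. *)
Lemma tradeoff_inv {d3 d4 dW} {O3 : measurableType d3} {O4 : measurableType d4}
    {W : measurableType dW} (P3 : probability O3 R) (P4 : probability O4 R)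
    (X : O3 -> W) (X' : O4 -> W) (f : R -> R) (alpha : R) :
  measurable_fun setT X -> measurable_fun setT X' -> 0 <= alpha ->
  (forall t, 0 <= t <= 1 -> f t <= tradeoff P3 X P4 X' t) ->
  tf_inv f alpha <= tradeoff P4 X' P3 X alpha.
Proof.
move=> mX mX' al0 Hf; apply: tradeoff_ge => // phi tp.
have fP := exp_test_fin P3 mX tp; have fP' := exp_test_fin P4 mX' tp.
set x := fine (\int[P3]_w (phi (X w))%:E)%E.
set y := fine (\int[P4]_w (phi (X' w))%:E)%E.
have xE : (\int[P3]_w (phi (X w))%:E = x%:E)%E by rewrite /x fineK.
have yE : (\int[P4]_w (phi (X' w))%:E = y%:E)%E by rewrite /y fineK.
have x01 : 0 <= x <= 1 by rewrite -!lee_fin -xE exp_test_ge0// exp_test_le1.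
rewrite yE lee_fin => yal.
apply: ge_inf; first by exists 0 => t /= [/andP[]].
have x1 : 0 <= 1 - x <= 1 by lra.
split => //; apply: (le_trans (Hf _ x1)); apply: le_trans yal.
pose psi w := 1 - phi w.
have tpsi : is_test psi.
  split; first by apply: measurable_funB => //; exact: tp.1.
  by move=> w; have := tp.2 w; rewrite /psi; lra.
have compl d0 (O0 : measurableType d0) (P0 : probability O0 R) (X0 : O0 -> W) z :
    measurable_fun setT X0 -> (\int[P0]_w (phi (X0 w))%:E = z%:E)%E ->
    (\int[P0]_w (psi (X0 w))%:E = (1 - z)%:E)%E.
  move=> mX0 zE.
  have := exp_cst P0 1.
  rewrite (_ : (\int[P0]_x 1%:E)%E = (\int[P0]_w (psi (X0 w) + phi (X0 w))%:E)%E); last first.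
    by apply: eq_integral => w _; rewrite /psi subrK.
  rewrite ge0_expD.
  - rewrite zE => /(congr1 (fun u => u - z%:E)%E).
    by rewrite addeK// -EFinB.
  - exact: measurableT_comp tpsi.1 mX0.
  - exact: measurableT_comp tp.1 mX0.
  - by move=> w; exact: test_ge0.
  - by move=> w; exact: test_ge0.
have := @tradeoff_le R _ _ _ _ _ _ P3 P4 X X' mX' (1 - x) psi tpsi.
rewrite (compl _ _ _ _ _ mX xE) (compl _ _ _ _ _ mX' yE) lexx /= => /(_ isT).
lra.
Qed.

(** Suprema are taken in the reals, so the conjugate must be known to be bounded; nonnegativity of
    [h] gives the bound [|y|]. *)
Lemma biconj_le (h : R -> R) (x : R) : (forall t, 0 <= t <= 1 -> 0 <= h t) ->
  0 <= x <= 1 -> biconj h x <= h x.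
Proof.
move=> h0 x01; apply: ge_sup; first by exists (x * 0 - conj01 h 0), 0.
move=> _ [y ->]; rewrite lerBlDr -lerBlDl.
apply: ub_le_sup; last by exists x.
exists `|y| => _ [t [t01 ->]]; have := h0 t t01; have /andP[t0 t1] := t01.
have : t * y <= `|y|.
  rewrite (le_trans (ler_wpM2l t0 (ler_norm y)))// ler_piMl//.
lra.
Qed.

End comparison.

(** * The Lindeberg exchange for cubic test functions *)

Section lindeberg.
Context {R : realType}.
Implicit Types (a b y e : R) (L : R -> R) (F G : R -> \bar R).

Definition cub a y : R := Num.max 0 (y - a) ^+ 3.

Lemma cub_ge0 a y : 0 <= cub a y.
Proof. by rewrite exprn_ge0// max0_ge0. Qed.

Lemma measurable_cub a : measurable_fun setT (cub a).
Proof.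
by apply: measurable_funX; apply: measurable_maxr => //; exact: measurable_funB.
Qed.

Lemma cub_le a y : 0 <= y -> cub a y <= 4 * `|a| ^+ 3 + 4 * y ^+ 3.
Proof.
move=> y0; have a0 := normr_ge0 a.
have : cub a y <= (`|a| + y) ^+ 3.
  rewrite lerXn2r ?nnegrE ?max0_ge0 ?addr_ge0// ge_max addr_ge0//=.
  by have := ler_norm (- a); rewrite normrN; lra.
move/le_trans; apply; set u := `|a| in a0 *.
(* Three times this product is the difference [4 * (u ^+ 3 + y ^+ 3) - (u + y) ^+ 3]. *)
have : 0 <= (u + y) * (u - y) ^+ 2 by rewrite mulr_ge0 ?sqr_ge0// addr_ge0.
nra.
Qed.

(** The second derivative of [cub a] is 6 times a positive part, hence Lipschitz with constant 6,
    and the second order remainder carries the factor [6 / 3! = 1]. *)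
Lemma cub_taylor a b y h : h = Num.max 0 (b - a) ->
  `|cub a y - (h ^+ 3 + 3 * h ^+ 2 * (y - b) + 3 * h * (y - b) ^+ 2)| <= `|y - b| ^+ 3.
Proof.
move=> ->; rewrite -normrX /cub.
have -> : y - a = (b - a) + (y - b) by lra.
move: (b - a) (y - b) => u k.
have [u0|u0] := leP 0 u.
  have [v0|v0] := leP 0 (u + k).
    rewrite (_ : _ - _ = k ^+ 3); first by [].
    by ring.
  rewrite expr0n/= sub0r normrN.
  have k0 : k < 0 by lra.
  rewrite [leRHS]ler0_norm; last by rewrite exprn_odd_le0// ltW.
  rewrite ler_norml; apply/andP; split.
    have : 0 <= u * ((u + 3 / 2 * k) ^+ 2 + 3 / 4 * k ^+ 2) by rewrite mulr_ge0// addr_ge0 ?sqr_ge0// mulr_ge0 ?sqr_ge0//; lra.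
    have : 0 <= - k ^+ 3 by rewrite oppr_ge0 exprn_odd_le0// ltW.
    nra.
  have : 0 <= - (u + k) ^+ 3 by rewrite oppr_ge0 exprn_odd_le0// ltW.
  nra.
rewrite expr0n/= !(expr0n, mulr0, mul0r, addr0, subr0)/=.
have [v0|v0] := leP 0 (u + k); last by rewrite expr0n/= normr0.
rewrite ger0_norm ?exprn_ge0// ger0_norm; last by rewrite exprn_ge0//; lra.
by rewrite lerXn2r ?nnegrE//; lra.
Qed.

(** Where [y - a] is at least [e] the second difference of the cube is exactly
    [6 * e ^+ 2 * (y - a)]; only the window of width [e] around [a] contributes an error,
    nonnegative and at most [6 * e ^+ 3]. *)
Lemma cub_second_difference a e y : 0 < e ->
  6 * e ^+ 2 * Num.max 0 (y - a) + 2 * cub a y <= cub (a - e) y + cub (a + e) y /\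
  cub (a - e) y + cub (a + e) y <= 6 * e ^+ 2 * (Num.max 0 (y - a) + e) + 2 * cub a y.
Proof.
move=> e0; rewrite /cub.
have -> : y - (a - e) = (y - a) + e by lra.
have -> : y - (a + e) = (y - a) - e by lra.
move: (y - a) => h.
have e3 : 0 < e ^+ 3 by rewrite exprn_gt0.
have [h0|h0] := leP 0 h.
  rewrite (max_r (addr_ge0 h0 (ltW e0))).
  have [he|he] := leP 0 (h - e).
    have -> : (h + e) ^+ 3 + (h - e) ^+ 3 = 6 * e ^+ 2 * h + 2 * h ^+ 3 by ring.
    by split; first by []; rewrite mulrDr -!addrA lerD2l lerDr mulr_ge0 ?(ltW e0)// mulr_ge0 ?sqr_ge0.
  have h1 : 0 <= (e - h) ^+ 3 by rewrite exprn_ge0// subr_ge0; lra.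
  have h2 : (e - h) ^+ 3 <= e ^+ 3 by rewrite lerXn2r ?nnegrE//; lra.
  by rewrite expr0n/=; split; nra.
rewrite !expr0n/= mulr0 !add0r !mulr0.
have [he|he] := leP 0 (h - e); first by lra.
rewrite expr0n/= !addr0.
have [hp|hp] := leP 0 (h + e); last first.
  by rewrite expr0n/=; split => //; rewrite mulr_ge0 ?(ltW e0)// mulr_ge0 ?sqr_ge0.
split; first by rewrite exprn_ge0.
have : (h + e) ^+ 3 <= e ^+ 3 by rewrite lerXn2r ?nnegrE//; lra.
nra.
Qed.

Lemma kopD L F G b : measurable_fun setT L ->
  measurable_fun setT F -> measurable_fun setT G ->
  (forall b, 0 <= F b)%E -> (forall b, 0 <= G b)%E ->
  kop L (fun b => F b + G b)%E b = (kop L F b + kop L G b)%E.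
Proof.
move=> mL mF mG F0 G0; rewrite /kop ge0_integralD//.
- by apply: measurableT_comp => //; exact: measurable_funM.
- by apply: measurableT_comp => //; exact: measurable_funM.
Qed.

Lemma iter_kopD L n F G b : measurable_fun setT L ->
  measurable_fun setT F -> measurable_fun setT G ->
  (forall b, 0 <= F b)%E -> (forall b, 0 <= G b)%E ->
  iter n (kop L) (fun b => F b + G b)%E b = (iter n (kop L) F b + iter n (kop L) G b)%E.
Proof.
move=> mL mF mG F0 G0; elim: n b => //= n IH b.
rewrite (_ : iter n (kop L) _ = (fun b => iter n (kop L) F b + iter n (kop L) G b)%E);
  last exact/funext.
by apply: kopD => //; solve [exact: measurable_iter_kop | exact: iter_kop_ge0].
Qed.

Lemma kopC L L' F b : measurable_fun setT L -> measurable_fun setT L' ->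
  measurable_fun setT F -> (forall b, 0 <= F b)%E ->
  kop L (kop L' F) b = kop L' (kop L F) b.
Proof.
move=> mL mL' mF F0; rewrite /kop.
pose f (xy : R * R) := F (b * L xy.1 * L' xy.2).
transitivity (\int[gam]_x \int[gam]_y f (x, y))%E; first by [].
rewrite (@fubini_tonelli _ _ R R R gam gam f)//.
- by apply: eq_integral => y _; apply: eq_integral => x _; rewrite /f/= mulrAC.
- apply: measurableT_comp => //; apply: measurable_funM.
    by apply: measurable_funM => //; exact: measurableT_comp.
  exact: measurableT_comp.
- by move=> xy; exact: F0.
Qed.

Lemma iter_kopC L L' n F b : measurable_fun setT L -> measurable_fun setT L' ->
  measurable_fun setT F -> (forall b, 0 <= F b)%E ->
  iter n (kop L) (kop L' F) b = kop L' (iter n (kop L) F) b.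
Proof.
move=> mL mL' mF F0; elim: n b => //= n IH b.
rewrite (_ : iter n (kop L) _ = kop L' (iter n (kop L) F)); last exact/funext.
by apply: kopC => //; [exact: measurable_iter_kop|exact: iter_kop_ge0].
Qed.

End lindeberg.

Section lindeberg_exchange.
Context {R : realType}.

Lemma iter_kop_pow_norm (L : R -> R) (n : nat) (c r b : R) :
  measurable_fun setT L -> (forall x, 0 <= L x) -> 0 <= b -> 0 <= r ->
  (\int[gam]_x (L x ^+ 3)%:E = r%:E)%E ->
  0 <= c -> iter n (kop L) (fun b => (c * `|b| ^+ 3)%:E) b = (c * r ^+ n * b ^+ 3)%:E.
Proof.
move=> mL L0 b0 r0 rE c0; rewrite -(@iter_kop_pow R L 3 n c r b)//.
elim: n b b0 => [|n IH] b b0 /=; first by rewrite ger0_norm.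
by apply: eq_integral => x _; rewrite IH// mulr_ge0.
Qed.

(** The data of the exchange: equal moments of order 1 and 2 cancel the Taylor polynomials, [k]
    prices one replacement, and [rho] controls how the cube of the current weight grows along the
    remaining factors. *)
Record lr_moments (L : R -> R) (x rho k : R) : Prop := LrMoments {
  lrm_measurable : measurable_fun setT L;
  lrm_ge0 : forall y, 0 <= L y;
  lrm_1 : (\int[gam]_y (L y)%:E = 1)%E;
  lrm_2 : (\int[gam]_y (L y ^+ 2)%:E = x%:E)%E;
  lrm_3 : exists2 r, 0 <= r <= rho & (\int[gam]_y (L y ^+ 3)%:E = r%:E)%E;
  lrm_abs3 : (\int[gam]_y (`|L y - 1| ^+ 3)%:E <= k%:E)%E
}.

Variables (x rho k : R).
Hypotheses (x0 : 0 <= x) (rho1 : 1 <= rho) (k0 : 0 <= k).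

Section one_factor.
Variable (L : R -> R).
Hypothesis (HL : lr_moments L x rho k).
Variables (a b : R).
Hypothesis (b0 : 0 <= b).
Let h := Num.max 0 (b - a).
Let h0 : 0 <= h. Proof. exact: max0_ge0. Qed.
Let mL := lrm_measurable HL.
Let L0 := lrm_ge0 HL.
Let rem y := b ^+ 3 * `|L y - 1| ^+ 3.
(** Expanded in powers of [L], the Taylor polynomial has terms of both signs. [taylor_l] is the
    expectation of the subtracted ones and [taylor_r] that of the others, kept on opposite sides. *)
Let taylor_l := 3 * h ^+ 2 * b + 6 * h * b ^+ 2.
Let taylor_r := h ^+ 3 + 3 * h * b ^+ 2 + 3 * h ^+ 2 * b + 3 * h * b ^+ 2 * x.

Let c10 : 0 <= 3 * h ^+ 2 * b. Proof. by rewrite !mulr_ge0 ?sqr_ge0. Qed.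
Let c20 : 0 <= 3 * h * b ^+ 2. Proof. by rewrite !mulr_ge0 ?sqr_ge0. Qed.
Let c30 : 0 <= 6 * h * b ^+ 2. Proof. by rewrite !mulr_ge0 ?sqr_ge0. Qed.
Let h30 : 0 <= h ^+ 3 + 3 * h * b ^+ 2. Proof. by rewrite addr_ge0// exprn_ge0. Qed.

Let mcL : measurable_fun setT (fun y => cub a (b * L y)).
Proof. by apply: (measurableT_comp (@measurable_cub R a)); exact: measurable_funM. Qed.
Let mrem : measurable_fun setT rem.
Proof.
apply: measurable_funM => //; apply: measurable_funX; apply: measurableT_comp => //.
exact: measurable_funB.
Qed.
Let rem0 y : 0 <= rem y. Proof. by rewrite mulr_ge0// exprn_ge0. Qed.
Let cL0 y : 0 <= cub a (b * L y). Proof. exact: cub_ge0. Qed.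

Let quad (c0 c1 c2 : R) y := c0 + c1 * L y + c2 * L y ^+ 2.

Let mquad c0 c1 c2 : measurable_fun setT (quad c0 c1 c2).
Proof.
apply: measurable_funD; first by apply: measurable_funD => //; exact: measurable_funM.
by apply: measurable_funM => //; exact: measurable_funX.
Qed.

Let quad0 c0 c1 c2 y : 0 <= c0 -> 0 <= c1 -> 0 <= c2 -> 0 <= quad c0 c1 c2 y.
Proof. by move=> *; rewrite /quad addr_ge0 ?mulr_ge0 ?sqr_ge0// addr_ge0 ?mulr_ge0. Qed.

Let exp_quad (c0 c1 c2 : R) (f : R -> R) : 0 <= c0 -> 0 <= c1 -> 0 <= c2 ->
  measurable_fun setT f -> (forall y, 0 <= f y) ->
  (\int[gam]_y (f y + quad c0 c1 c2 y)%:E =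
   \int[gam]_y (f y)%:E + (c0 + c1 + c2 * x)%:E)%E.
Proof.
move=> c00 c1_ c2_ mf f0.
rewrite ge0_expD//; last by move=> y; exact: quad0.
rewrite ge0_expD; last 4 first.
- by apply: measurable_funD => //; exact: measurable_funM.
- by apply: measurable_funM => //; exact: measurable_funX.
- by move=> y; rewrite addr_ge0 ?mulr_ge0.
- by move=> y; rewrite mulr_ge0 ?sqr_ge0.
rewrite ge0_expD//; last 2 first.
- exact: measurable_funM.
- by move=> y; rewrite mulr_ge0.
rewrite !ge0_expZ//; last 2 first.
- exact: measurable_funX.
- by move=> y; exact: sqr_ge0.
by rewrite exp_cst (lrm_1 HL) (lrm_2 HL) mule1 -EFinM -!EFinD.
Qed.

Let exp_rem : (\int[gam]_y (rem y)%:E <= (b ^+ 3 * k)%:E)%E.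
Proof.
rewrite [leLHS]ge0_expZ.
- rewrite [leRHS]EFinM; apply: lee_wpmul2l; last exact: lrm_abs3 HL.
  by rewrite lee_fin exprn_ge0.
- by apply: measurable_funX; apply: measurableT_comp => //; exact: measurable_funB.
- by rewrite exprn_ge0.
- by move=> y; rewrite exprn_ge0.
Qed.

Let taylor y : `|cub a (b * L y) + quad (3 * h ^+ 2 * b) (6 * h * b ^+ 2) 0 y
    - quad (h ^+ 3 + 3 * h * b ^+ 2) (3 * h ^+ 2 * b) (3 * h * b ^+ 2) y| <= rem y.
Proof.
have -> : rem y = `|b * L y - b| ^+ 3.
  by rewrite -[X in _ - X]mulr1 -mulrBr normrM (ger0_norm b0) exprMn.
apply: le_trans (cub_taylor (b * L y) (erefl h)).
by rewrite /quad le_eqVlt; apply/orP; left; apply/eqP; congr `|_|; ring.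
Qed.

Lemma exp_cub_upper :
  (\int[gam]_y (cub a (b * L y))%:E + taylor_l%:E <= (taylor_r + b ^+ 3 * k)%:E)%E.
Proof.
apply: (@le_trans _ _ (\int[gam]_y (rem y)%:E + taylor_r%:E)%E);
  last by rewrite [leRHS]EFinD [leRHS]addeC; exact: leeD2r.
have -> : taylor_l = 3 * h ^+ 2 * b + 6 * h * b ^+ 2 + 0 * x by rewrite mul0r addr0.
rewrite -!exp_quad//; apply: ge0_exp_le.
- exact: measurable_funD.
- exact: measurable_funD.
- by move=> y; rewrite addr_ge0// quad0.
- by move=> y; have := taylor y; rewrite ler_norml => /andP[_]; rewrite lerBlDr.
Qed.

Lemma exp_cub_lower :
  (taylor_r%:E <= \int[gam]_y (cub a (b * L y))%:E + (taylor_l + b ^+ 3 * k)%:E)%E.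
Proof.
apply: (@le_trans _ _ (\int[gam]_y (cub a (b * L y) + rem y)%:E + taylor_l%:E)%E); last first.
  have -> : (taylor_l + b ^+ 3 * k)%:E = ((b ^+ 3 * k)%:E + taylor_l%:E)%E.
    by rewrite -EFinD addrC.
  rewrite ge0_expD// [leRHS]addeA.
  by apply: leeD2r; exact: leeD2l.
have -> : taylor_l = 3 * h ^+ 2 * b + 6 * h * b ^+ 2 + 0 * x by rewrite mul0r addr0.
have -> : taylor_r%:E =
    (\int[gam]_y (0 + quad (h ^+ 3 + 3 * h * b ^+ 2) (3 * h ^+ 2 * b) (3 * h * b ^+ 2) y)%:E)%E.
  by rewrite exp_quad// exp_cst add0e.
rewrite -exp_quad//; [|exact: measurable_funD|by move=> y; rewrite addr_ge0].
apply: ge0_exp_le.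
- exact: measurable_funD.
- by apply: measurable_funD => //; exact: measurable_funD.
- by move=> y; rewrite addr_ge0// quad0.
- by move=> y; have := taylor y; rewrite ler_norml => /andP[+ _]; rewrite add0r; lra.
Qed.

End one_factor.

(** Both expectations lie within [k * b ^+ 3] of the same Taylor value, which depends only on the
    common first and second moments. *)
Lemma kop_cub_exchange L L' a b : lr_moments L x rho k -> lr_moments L' x rho k ->
  0 <= b ->
  (kop L (EFin \o cub a) b <= kop L' (EFin \o cub a) b + (2 * k * b ^+ 3)%:E)%E.
Proof.
move=> HL HL' b0.
set h := Num.max 0 (b - a).
pose tl := 3 * h ^+ 2 * b + 6 * h * b ^+ 2.
pose tr := h ^+ 3 + 3 * h * b ^+ 2 + 3 * h ^+ 2 * b + 3 * h * b ^+ 2 * x.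
have low : (tr%:E <= kop L' (EFin \o cub a) b + (tl + b ^+ 3 * k)%:E)%E := exp_cub_lower HL' a b0.
have up : (kop L (EFin \o cub a) b + tl%:E <= (tr + b ^+ 3 * k)%:E)%E := exp_cub_upper HL a b0.
have up2 : ((tr + b ^+ 3 * k)%:E <= kop L' (EFin \o cub a) b + (tl + b ^+ 3 * k)%:E + (b ^+ 3 * k)%:E)%E.
  by rewrite [leLHS]EFinD; exact: leeD2r.
move: (kop L (EFin \o cub a) b) up up2 {low} => A up up2.
move: (kop L' (EFin \o cub a) b) up2 => B up2.
rewrite -[leLHS](@addeK _ tl%:E)// leeBlDr//; apply: (le_trans up); apply: (le_trans up2).
rewrite -!addeA; apply: leeD2l.
move: tl {up up2} => u; rewrite -!EFinD lee_fin; lra.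
Qed.

(** A hybrid argument, one factor at a time. The cost [2 * k * z ^+ 3] arises at the weight [z]
    reached by the other factors, and averaging over those produces powers of third moments, bounded
    by powers of [rho]. *)
Lemma iter_kop_cub_exchange L L' a n b : lr_moments L x rho k -> lr_moments L' x rho k ->
  0 <= b ->
  (iter n (kop L) (EFin \o cub a) b <=
   iter n (kop L') (EFin \o cub a) b + (n%:R * (2 * k) * rho ^+ n * b ^+ 3)%:E)%E.
Proof.
move=> HL HL'; elim: n b => [|n IH] b b0 /=.
  by rewrite !mul0r adde0.
have mL := lrm_measurable HL; have mL' := lrm_measurable HL'.
have L0 := lrm_ge0 HL; have L'0 := lrm_ge0 HL'.
have mc : measurable_fun setT (EFin \o cub a).
  by apply/measurable_EFinP; exact: measurable_cub.
have c0 z : (0 <= (EFin \o cub a) z)%E by rewrite lee_fin cub_ge0.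
pose cube (c : R) (z : R) : \bar R := (c * `|z| ^+ 3)%:E.
have mcube c : measurable_fun setT (cube c).
  apply/measurable_EFinP; apply: measurable_funM => //; apply: measurable_funX.
  exact: normr_measurable.
have cube0 c z : 0 <= c -> (0 <= cube c z)%E.
  by move=> c0'; rewrite lee_fin mulr_ge0// exprn_ge0.
have [r /andP[r0 rrho] rE] := lrm_3 HL; have [r' /andP[r'0 r'rho] r'E] := lrm_3 HL'.
have rho0 : 0 <= rho by exact: le_trans rho1.
have k20 : 0 <= 2 * k by rewrite mulr_ge0.
rewrite -iterS iterSr.
set F := EFin \o cub a in mc c0 IH *.
have mK' := measurable_kop mL' mc c0; have K'0 := kop_ge0 L' c0.
have mKn := measurable_iter_kop n mL mc c0; have Kn0 := iter_kop_ge0 L n c0.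
have mK'n := measurable_iter_kop n mL' mc c0; have K'n0 := iter_kop_ge0 L' n c0.
pose en := n%:R * (2 * k) * rho ^+ n.
have en0 : 0 <= en by rewrite mulr_ge0 ?exprn_ge0// mulr_ge0.
apply: (@le_trans _ _ (iter n (kop L) (fun z => kop L' F z + cube (2 * k)%R z)%E b)).
  apply: iter_kop_le => //.
  - exact: measurable_kop.
  - exact: emeasurable_funD.
  - exact: kop_ge0.
  - by move=> z; rewrite adde_ge0 ?cube0.
  - by move=> z z0; rewrite /cube ger0_norm//; exact: kop_cub_exchange.
rewrite iter_kopD//; last by move=> z; exact: cube0.
(* The factor just replaced is moved outermost, so the induction hypothesis applies to the [n]
   remaining ones. *)
rewrite iter_kopC//.
have -> : iter n (kop L) (cube (2 * k)) b = (2 * k * r ^+ n * b ^+ 3)%:E.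
  by rewrite (iter_kop_pow_norm n mL L0 b0 r0 rE).
apply: (@le_trans _ _ (kop L' (fun z => iter n (kop L') F z + cube en z)%E b +
   (2 * k * r ^+ n * b ^+ 3)%:E)%E).
  apply: leeD2r; apply: kop_le => //.
  - exact: emeasurable_funD.
  - by move=> z; rewrite adde_ge0 ?cube0.
  - by move=> z z0; rewrite /cube ger0_norm//; exact: IH.
rewrite kopD//; last by move=> z; exact: cube0.
have -> : kop L' (cube en) b = (en * r' * b ^+ 3)%:E.
  by rewrite -[kop L' _ _]/(iter 1 (kop L') _ _) (iter_kop_pow_norm 1 mL' L'0 b0 r'0 r'E).
rewrite -addeA; apply: leeD2l; rewrite -EFinD lee_fin -mulrDl ler_wpM2r ?exprn_ge0//.
have h1 : r ^+ n <= rho ^+ n.+1.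
  apply: (@le_trans _ _ (rho ^+ n)); first by rewrite lerXn2r ?nnegrE.
  by rewrite exprS ler_peMl ?exprn_ge0.
have h2 : en * r' <= en * rho by rewrite ler_wpM2l.
have h3 : 2 * k * r ^+ n <= 2 * k * rho ^+ n.+1 by rewrite ler_wpM2l.
apply: (le_trans (lerD h2 h3)); rewrite /en exprS -natr1.
by rewrite le_eqVlt; apply/orP; left; apply/eqP; ring.
Qed.

End lindeberg_exchange.

Section hockey_stick_exchange.
Context {R : realType}.

Lemma iter_kop_cst (L : R -> R) n (c b : R) : 0 <= c ->
  iter n (kop L) (fun=> c%:E) b = c%:E.
Proof.
move=> c0; elim: n b => //= n IH b; rewrite /kop.
by under eq_integral do rewrite IH; rewrite exp_cst.
Qed.

Lemma iter_kopZ (L : R -> R) n (c b : R) (F : R -> \bar R) :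
  measurable_fun setT L -> 0 <= c -> measurable_fun setT F -> (forall b, 0 <= F b)%E ->
  iter n (kop L) (fun b => c%:E * F b)%E b = (c%:E * iter n (kop L) F b)%E.
Proof.
move=> mL c0 mF F0; elim: n b => //= n IH b; rewrite /kop.
under eq_integral do rewrite IH.
rewrite ge0_integralZl_EFin//.
- by move=> x _; exact: iter_kop_ge0.
- apply: measurableT_comp; first exact: measurable_iter_kop.
  exact: measurable_funM.
Qed.

(** Finiteness is what allows the cubic terms to be cancelled from both sides of the second
    difference inequality. *)
Lemma iter_kop_cub_fin (L : R -> R) (x rho k : R) (n : nat) (a b : R) :
  lr_moments L x rho k -> 0 <= b -> iter n (kop L) (EFin \o cub a) b \is a fin_num.
Proof.
move=> HL b0.
have mL := lrm_measurable HL; have L0 := lrm_ge0 HL.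
have [r /andP[r0 _] rE] := lrm_3 HL.
have mc : measurable_fun setT (EFin \o cub a) by apply/measurable_EFinP; exact: measurable_cub.
have c0 z : (0 <= (EFin \o cub a) z)%E by rewrite lee_fin cub_ge0.
rewrite ge0_fin_numE; last exact: iter_kop_ge0.
have mn : measurable_fun setT (fun z : R => (4 * `|z| ^+ 3)%:E).
  apply/measurable_EFinP; apply: measurable_funM => //; apply: measurable_funX.
  exact: normr_measurable.
have n0 z : (0 <= (4 * `|z| ^+ 3)%:E :> \bar R)%E by rewrite lee_fin mulr_ge0// exprn_ge0.
have a0 : 0 <= 4 * `|a| ^+ 3 by rewrite mulr_ge0// exprn_ge0.
apply: (@le_lt_trans _ _ (iter n (kop L)
  (fun z => (fun=> (4 * `|a| ^+ 3)%:E) z + (4 * `|z| ^+ 3)%:E)%E b)).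
  apply: iter_kop_le => //.
  - exact: emeasurable_funD.
  - by move=> z; rewrite adde_ge0// lee_fin.
  - move=> z z0 /=; rewrite -EFinD lee_fin (ger0_norm z0); exact: cub_le.
rewrite iter_kopD//.
by rewrite iter_kop_cst// (iter_kop_pow_norm n mL L0 b0 r0 rE)// -EFinD ltry.
Qed.

Variables (x rho k : R).
Hypotheses (rho1 : 1 <= rho) (k0 : 0 <= k).

(** The positive part is bracketed by second differences of cubes divided by [6 * e ^+ 2]. The
    smoothing costs [e], and the exchange is paid four times: once at [a - e], once at [a + e], and
    twice at [a]. *)
Lemma hs_exchange (L L' : R -> R) (n : nat) (a b e : R) :
  lr_moments L x rho k -> lr_moments L' x rho k -> 0 <= b -> 0 < e ->
  (hs L n a b <= hs L' n a b +
    (e + 4 * (n%:R * (2 * k) * rho ^+ n * b ^+ 3) / (6 * e ^+ 2))%:E)%E.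
Proof.
move=> HL HL' b0 e0.
set err := n%:R * (2 * k) * rho ^+ n * b ^+ 3.
have mL := lrm_measurable HL; have L0 := lrm_ge0 HL.
have mL' := lrm_measurable HL'; have L'0 := lrm_ge0 HL'.
have mc a' : measurable_fun setT (EFin \o (cub a' : R -> R)).
  by apply/measurable_EFinP; exact: measurable_cub.
have c0 a' z : (0 <= (EFin \o (cub a' : R -> R)) z)%E by rewrite lee_fin cub_ge0.
pose K a' := iter n (kop L) (EFin \o cub a') b.
pose K' a' := iter n (kop L') (EFin \o cub a') b.
have KK' a' : (K a' <= K' a' + err%:E)%E.
  by apply: (@iter_kop_cub_exchange R x rho k).
have K'K a' : (K' a' <= K a' + err%:E)%E.
  by apply: (@iter_kop_cub_exchange R x rho k).
pose g := 6 * e ^+ 2.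
have g0 : 0 < g by rewrite mulr_gt0 ?exprn_gt0.
have mp := @measurable_payoff R a.
have p0 := @payoff_ge0 R a.
have m2c : measurable_fun setT (fun z => 2%:E * (EFin \o cub a) z)%E by exact: measurable_funeM.
have z2c z : (0 <= 2%:E * (EFin \o cub a) z :> \bar R)%E by rewrite mule_ge0// lee_fin.
have mgp : measurable_fun setT (fun z => g%:E * payoff a z)%E by exact: measurable_funeM.
have z2p z : (0 <= g%:E * payoff a z)%E by rewrite mule_ge0// lee_fin ltW.
have low : (g%:E * hs L n a b + 2%:E * K a <= K (a - e)%R + K (a + e)%R)%E.
  rewrite /hs /K -!iter_kopZ ?(ltW g0)// -!iter_kopD//.
  apply: iter_kop_le => //.
  - exact: emeasurable_funD.
  - exact: emeasurable_funD.
  - by move=> z; rewrite adde_ge0.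
  - by move=> z; rewrite adde_ge0.
  - move=> z z0 /=; rewrite /payoff -!EFinM -!EFinD lee_fin.
    by have [] := cub_second_difference a z e0.
have up : (K' (a - e)%R + K' (a + e)%R <= g%:E * hs L' n a b + (g * e)%:E + 2%:E * K' a)%E.
  have ge0' : 0 <= g * e by rewrite mulr_ge0 ?ltW.
  rewrite -(iter_kop_cst L' n b ge0') /hs /K' -!iter_kopZ ?(ltW g0)// -!iter_kopD//; last 2 first.
  - exact: emeasurable_funD.
  - by move=> z; rewrite adde_ge0// lee_fin.
  apply: iter_kop_le => //.
  - exact: emeasurable_funD.
  - by apply: emeasurable_funD => //; exact: emeasurable_funD.
  - by move=> z; rewrite adde_ge0.
  - by move=> z; rewrite !adde_ge0// lee_fin.
  - move=> z z0 /=; rewrite /payoff -!EFinM -!EFinD lee_fin.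
    by have [_ H] := cub_second_difference a z e0; rewrite /g; lra.
have Kfin : K a \is a fin_num := iter_kop_cub_fin n a HL b0.
have : (g%:E * hs L n a b + 2%:E * K a <=
    g%:E * hs L' n a b + (g * e + 4 * err)%:E + 2%:E * K a)%E.
  apply: (le_trans low); apply: (le_trans (leeD (KK' (a - e)) (KK' (a + e)))).
  rewrite addeACA -EFinD; apply: (le_trans (leeD2r _ up)).
  have h : (2%:E * K' a <= 2%:E * (K a + err%:E))%E by apply: lee_wpmul2l => //; rewrite lee_fin.
  apply: (le_trans (leeD2r _ (leeD2l _ h))).
  move: (hs L' n a b) => H'.
  rewrite -(fineK Kfin); move: (fine (K a)) => u.
  rewrite -!EFinD -!EFinM -!addeA -!EFinD; apply: leeD2l; rewrite lee_fin; lra.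
rewrite leeD2rE; last by rewrite fin_numM.
have -> : (g * e + 4 * err)%:E = (g%:E * (e + 4 * err / g)%:E)%E.
  by rewrite -EFinM mulrDr [g * (_ / g)]mulrC divfK ?gt_eqF.
rewrite -ge0_muleDr; [|exact: hs_ge0|].
  by rewrite lee_pmul2l// ?lte_fin.
rewrite lee_fin addr_ge0 ?(ltW e0)// divr_ge0 ?(ltW g0)// mulr_ge0// /err.
by rewrite mulr_ge0 ?exprn_ge0// mulr_ge0 ?exprn_ge0 ?(le_trans _ rho1)// !mulr_ge0.
Qed.

End hockey_stick_exchange.

(** * Hockey-stick integrals of pure Gaussian shifts *)

Section gaussian_hockey_stick.
Context {R : realType}.

Lemma hs_lrn (m : R) (n : nat) (a b : R) : 0 <= m -> 0 <= b ->
  hs (lrn m) n a b = gpay b (- a) (m * Num.sqrt n%:R).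
Proof.
move=> m0; elim: n b => [|n IH] b b0.
  rewrite sqrtr0 mulr0 /gpay /lrn.
  under eq_integral do rewrite mul0r expr0n/= mul0r subr0 expR0 mulr1.
  by rewrite exp_cst.
rewrite hsS; under eq_integral do rewrite IH ?mulr_ge0 ?lrn_ge0//.
apply: gpay_conv; rewrite ?mulr_ge0 ?sqrtr_ge0//.
by rewrite !exprMn !sqr_sqrtr// -natr1 mulrDr mulr1 addrC.
Qed.

(** The positive part is 1-Lipschitz and [2 * |u| <= e + u ^+ 2 / e]; the numerator in the error is
    the squared L2 distance of the two ratios. *)
Lemma gpay_dist (c s t e : R) : 0 < e ->
  (gpay 1 c s <= gpay 1 c t + ((e + (expR (s ^+ 2) + expR (t ^+ 2) - 2 * expR (s * t)) / e) / 2)%:E)%E.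
Proof.
move=> e0.
have ms := @measurable_lrn R s; have mt := @measurable_lrn R t.
have mst : measurable_fun setT (fun x => lrn s x - lrn t x) by exact: measurable_funB.
pose D x := (e + (lrn s x - lrn t x) ^+ 2 / e) / 2.
have D0 x : 0 <= D x by rewrite divr_ge0// addr_ge0 ?(ltW e0)// divr_ge0 ?sqr_ge0 ?(ltW e0).
have mD : measurable_fun setT D.
  apply: measurable_funM => //; apply: measurable_funD => //; apply: measurable_funM => //.
  exact: measurable_funX.
have Q x : `|lrn s x - lrn t x| <= D x.
  rewrite /D; set u := lrn s x - lrn t x.
  rewrite ler_pdivlMr// -(ler_pM2r e0) mulrDl divfK ?gt_eqF//.
  by rewrite -[u ^+ 2]real_normK ?num_real//; have := sqr_ge0 (`|u| - e); nra.
apply: (@le_trans _ _ (\int[gam]_x (Num.max 0 (1 * lrn t x + c) + D x)%:E)%E).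
  apply: ge0_exp_le.
  - by apply/measurable_EFinP; exact: measurable_gpay_integrand.
  - by apply: measurable_funD => //; apply/measurable_EFinP; exact: measurable_gpay_integrand.
  - by move=> x; exact: max0_ge0.
  - move=> x; rewrite ge_max addr_ge0 ?max0_ge0//= !mul1r.
    have := max0_ge (lrn t x + c); have := Q x; have := ler_norm (lrn s x - lrn t x); lra.
rewrite ge0_expD//; last 2 first.
- by apply/measurable_EFinP; exact: measurable_gpay_integrand.
- by move=> x; exact: max0_ge0.
apply: leeD2l.
have sq0 x : 0 <= (lrn s x - lrn t x) ^+ 2 by exact: sqr_ge0.
have msq : measurable_fun setT (fun x => (lrn s x - lrn t x) ^+ 2) by exact: measurable_funX.
have E2 : (\int[gam]_x ((lrn s x - lrn t x) ^+ 2)%:E =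
    (expR (s ^+ 2) + expR (t ^+ 2) - 2 * expR (s * t))%:E)%E.
  (* The cross term of the square, [2 * lrn s x * lrn t x], is a multiple of [lrn (s + t) x], hence
     explicitly integrable. *)
  have : (\int[gam]_x ((lrn s x - lrn t x) ^+ 2 + 2 * expR (s * t) * lrn (s + t) x)%:E =
    \int[gam]_x (lrn s x ^+ 2 + lrn t x ^+ 2)%:E)%E.
    apply: eq_integral => x _; congr EFin.
    have -> : 2 * expR (s * t) * lrn (s + t) x = 2 * (lrn s x * lrn t x).
      by rewrite -mulrA /lrn -!expRD; congr (_ * expR _); field.
    by ring.
  rewrite ge0_expD//; last 2 first.
  - by apply: measurable_funM => //; exact: measurable_lrn.
  - by move=> x; rewrite !mulr_ge0 ?expR_ge0 ?lrn_ge0.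
  rewrite ge0_expZ ?mulr_ge0 ?expR_ge0//; last 2 first.
  - exact: measurable_lrn.
  - by move=> x; exact: lrn_ge0.
  rewrite exp_lrn mule1 ge0_expD; last 4 first.
  - exact: measurable_funX.
  - exact: measurable_funX.
  - by move=> x; exact: sqr_ge0.
  - by move=> x; exact: sqr_ge0.
  rewrite !exp_lrnX !expr1 => /(congr1 (fun u => u - (2 * expR (s * t))%:E)%E).
  by rewrite addeK// -!EFinD.
rewrite (_ : (\int[gam]_x (D x)%:E = \int[gam]_x (e / 2 + (2 * e)^-1 * (lrn s x - lrn t x) ^+ 2)%:E)%E);
  last by apply: eq_integral => x _; rewrite /D; congr EFin; field; rewrite gt_eqF.
have e20 : 0 <= e / 2 by rewrite divr_ge0// ltW.
have ie0 : 0 <= (2 * e)^-1 by rewrite invr_ge0 mulr_ge0// ltW.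
rewrite ge0_expD//; last 2 first.
- exact: measurable_funM.
- by move=> x; rewrite mulr_ge0.
rewrite exp_cst ge0_expZ// E2 -EFinM -EFinD lee_fin le_eqVlt; apply/orP; left; apply/eqP.
by field; rewrite gt_eqF.
Qed.

End gaussian_hockey_stick.

(** * Matching the moments of [sub_lr] and [lrn] *)

Section moments_of_the_two_ratios.
Context {R : realType}.
Variables (p mu : R).
Hypotheses (p_gt0 : 0 < p) (p_le1 : p <= 1).
Let w : R := expR (mu ^+ 2).

Let w1 : 1 <= w. Proof. by rewrite -expR0 ler_expR sqr_ge0. Qed.
Let p0 : 0 <= p. Proof. exact: ltW. Qed.
Let q0 : 0 <= 1 - p. Proof. by rewrite subr_ge0. Qed.

Lemma exp_cubic_lrn (s c0 c1 c2 c3 : R) : 0 <= c0 -> 0 <= c1 -> 0 <= c2 -> 0 <= c3 ->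
  (\int[gam]_y (c0 + c1 * lrn s y + c2 * lrn s y ^+ 2 + c3 * lrn s y ^+ 3)%:E =
   (c0 + c1 + c2 * expR (s ^+ 2) + c3 * expR (s ^+ 2) ^+ 3)%:E)%E.
Proof.
move=> h0 h1 h2 h3; have ml := @measurable_lrn R s; have l0 := @lrn_ge0 R s.
have mX k (c : R) : measurable_fun setT (fun y => c * lrn s y ^+ k).
  by apply: measurable_funM => //; exact: measurable_funX.
have X0 k (c : R) y : 0 <= c -> 0 <= c * lrn s y ^+ k by move=> ?; rewrite mulr_ge0 ?exprn_ge0.
have m1 : measurable_fun setT (fun y => c0 + c1 * lrn s y).
  by apply: measurable_funD => //; exact: measurable_funM.
have m2 : measurable_fun setT (fun y => c0 + c1 * lrn s y + c2 * lrn s y ^+ 2).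
  exact: measurable_funD.
have n1 y : 0 <= c0 + c1 * lrn s y by rewrite addr_ge0 ?mulr_ge0.
rewrite ge0_expD//; last 2 first.
- by move=> y; rewrite addr_ge0 ?X0.
- by move=> y; exact: X0.
rewrite ge0_expD//; last by move=> y; exact: X0.
rewrite ge0_expD//; last 2 first.
- exact: measurable_funM.
- by move=> y; rewrite mulr_ge0.
rewrite !ge0_expZ//; try (by move=> y; rewrite exprn_ge0); try exact: measurable_funX.
by rewrite exp_cst exp_lrn !exp_lrnX mule1 expr1 -!EFinM -!EFinD.
Qed.

(** [lr_x] is the second moment of [sub_lr p mu], and [lr_m] below is the shift for which [lrn] has
    the same one. [lr_rho] and [lr_k] are chosen large enough for both ratios: in [lr_k] the part
    [1 + w ^+ 3] serves [sub_lr], the part [w + 6 * w ^+ 6] serves [lrn]. *)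
Definition lr_x : R := 1 + p ^+ 2 * (w - 1).
Definition lr_rho : R := 1 + p ^+ 2 * (3 * w + w ^+ 3).
Definition lr_k : R := p ^+ 3 * (1 + w + w ^+ 3 + 6 * w ^+ 6).
Definition lr_m : R := Num.sqrt (ln lr_x).

Let p2_le1 : p ^+ 2 <= 1. Proof. by rewrite expr_le1. Qed.
Let p2_ge0 : 0 <= p ^+ 2. Proof. exact: sqr_ge0. Qed.

Lemma lr_x_ge1 : 1 <= lr_x.
Proof. by rewrite /lr_x lerDl mulr_ge0// subr_ge0. Qed.

Let x_le_w : lr_x <= w.
Proof.
rewrite /lr_x; have : p ^+ 2 * (w - 1) <= w - 1 by rewrite ler_piMl// subr_ge0.
lra.
Qed.

Let w0 : 0 <= w. Proof. exact: le_trans w1. Qed.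

Lemma lr_rho_ge1 : 1 <= lr_rho.
Proof. by rewrite /lr_rho lerDl mulr_ge0// addr_ge0 ?exprn_ge0// mulr_ge0. Qed.

Lemma lr_k_ge0 : 0 <= lr_k.
Proof. by rewrite /lr_k mulr_ge0 ?exprn_ge0// !addr_ge0 ?mulr_ge0 ?exprn_ge0. Qed.

Let p3_le : p ^+ 3 <= p ^+ 2.
Proof. by rewrite exprS ler_piMl. Qed.

Lemma lr_moments_sub : lr_moments (sub_lr p mu) lr_x lr_rho lr_k.
Proof.
have l0 := @lrn_ge0 R mu.
split.
- exact: measurable_sub_lr.
- by move=> y; apply: sub_lr_ge0; rewrite p0 p_le1.
- transitivity (\int[gam]_y (1 - p + p * lrn mu y + 0 * lrn mu y ^+ 2 + 0 * lrn mu y ^+ 3)%:E)%E.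
    by apply: eq_integral => y _; rewrite /sub_lr !mul0r !addr0.
  by rewrite exp_cubic_lrn// !mul0r !addr0 subrK.
- transitivity (\int[gam]_y ((1 - p) ^+ 2 + 2 * p * (1 - p) * lrn mu y + p ^+ 2 * lrn mu y ^+ 2
      + 0 * lrn mu y ^+ 3)%:E)%E.
    by apply: eq_integral => y _; rewrite /sub_lr; congr EFin; ring.
  rewrite exp_cubic_lrn//; [|by rewrite sqr_ge0|by rewrite !mulr_ge0].
  by congr EFin; rewrite /lr_x -/w; ring.
- exists ((1 - p) ^+ 3 + 3 * p * (1 - p) ^+ 2 + 3 * p ^+ 2 * (1 - p) * w + p ^+ 3 * w ^+ 3).
    rewrite !addr_ge0 ?mulr_ge0 ?exprn_ge0//= /lr_rho.
    have h1 : p ^+ 3 * w ^+ 3 <= p ^+ 2 * w ^+ 3 by rewrite ler_wpM2r ?exprn_ge0.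
    have h2 : 0 <= p ^+ 3 * w by rewrite mulr_ge0 ?exprn_ge0.
    have h3 : 0 <= p ^+ 2 * w by rewrite mulr_ge0.
    have h4 : 0 <= p ^+ 2 by [].
    have h5 : 0 <= p ^+ 3 by rewrite exprn_ge0.
    have h6 : p ^+ 3 <= p ^+ 2 by exact: p3_le.
    have -> : (1 - p) ^+ 3 + 3 * p * (1 - p) ^+ 2 + 3 * p ^+ 2 * (1 - p) * w + p ^+ 3 * w ^+ 3 =
      1 - 3 * p ^+ 2 + 2 * p ^+ 3 + 3 * (p ^+ 2 * w) - 3 * (p ^+ 3 * w) + p ^+ 3 * w ^+ 3 by ring.
    have -> : p ^+ 2 * (3 * w + w ^+ 3) = 3 * (p ^+ 2 * w) + p ^+ 2 * w ^+ 3 by ring.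
    lra.
  transitivity (\int[gam]_y ((1 - p) ^+ 3 + 3 * p * (1 - p) ^+ 2 * lrn mu y
      + 3 * p ^+ 2 * (1 - p) * lrn mu y ^+ 2 + p ^+ 3 * lrn mu y ^+ 3)%:E)%E.
    by apply: eq_integral => y _; rewrite /sub_lr; congr EFin; ring.
  by rewrite exp_cubic_lrn// ?mulr_ge0 ?exprn_ge0.
(* Here [sub_lr p mu y - 1] is [p * (lrn mu y - 1)], and the cube of [|z - 1|] is at most
   [1 + z ^+ 3] for nonnegative [z]. *)
- apply: (@le_trans _ _ (\int[gam]_y (p ^+ 3 + 0 * lrn mu y + 0 * lrn mu y ^+ 2
      + p ^+ 3 * lrn mu y ^+ 3)%:E)%E).
    apply: ge0_exp_le.
    + apply: measurable_funX; apply: measurableT_comp => //.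
      by apply: measurable_funB => //; exact: measurable_sub_lr.
    + have ml := @measurable_lrn R mu.
      by do ![apply: measurable_funD => //| apply: measurable_funM => // | apply: measurable_funX => //].
    + by move=> y; rewrite exprn_ge0.
    + move=> y; rewrite !mul0r !addr0.
      have -> : p ^+ 3 + p ^+ 3 * lrn mu y ^+ 3 = p ^+ 3 * (1 + lrn mu y ^+ 3) by ring.
      have -> : sub_lr p mu y - 1 = p * (lrn mu y - 1) by rewrite /sub_lr; ring.
      rewrite normrM exprMn (ger0_norm p0) ler_wpM2l ?exprn_ge0//.
      have := l0 y; move: (lrn mu y) => z z0.
      have [z1|z1] := leP 0 (z - 1).
        rewrite (ger0_norm z1).
        have : (z - 1) ^+ 3 <= z ^+ 3 by rewrite lerXn2r ?nnegrE//; lra.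
        by move/le_trans; apply; rewrite lerDr.
      rewrite (ltr0_norm z1).
      have : (- (z - 1)) ^+ 3 <= 1 by rewrite exprn_ile1//; lra.
      by move/le_trans; apply; rewrite lerDl exprn_ge0.
  rewrite exp_cubic_lrn ?exprn_ge0// !mul0r !addr0 lee_fin -/w /lr_k.
  have -> : p ^+ 3 + p ^+ 3 * w ^+ 3 = p ^+ 3 * (1 + w ^+ 3) by ring.
  rewrite ler_wpM2l ?exprn_ge0//.
  have : 0 <= 6 * w ^+ 6 by rewrite mulr_ge0 ?exprn_ge0.
  by have := w0; lra.
Qed.

Let mE : expR (lr_m ^+ 2) = lr_x.
Proof.
by rewrite sqr_sqrtr ?ln_ge0 ?lr_x_ge1// lnK// posrE (lt_le_trans _ lr_x_ge1).
Qed.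

Lemma lr_moments_lrn : lr_moments (lrn lr_m) lr_x lr_rho lr_k.
Proof.
have l0 := @lrn_ge0 R lr_m; have ml := @measurable_lrn R lr_m.
have x1 := lr_x_ge1; have xw := x_le_w.
have x0 : 0 <= lr_x by exact: le_trans x1.
split => //.
- exact: exp_lrn.
- by rewrite exp_lrnX mE expr1.
- exists (lr_x ^+ 3); last by rewrite exp_lrnX mE.
  rewrite exprn_ge0//= /lr_x /lr_rho.
  set v := w - 1; have v0 : 0 <= v by rewrite subr_ge0.
  have vw : v <= w by rewrite /v; lra.
  move: p2_le1 p2_ge0; move: (p ^+ 2) => q ql qg.
  have -> : (1 + q * v) ^+ 3 = 1 + q * (3 * v + 3 * q * v ^+ 2 + q ^+ 2 * v ^+ 3) by ring.
  rewrite lerD2l ler_wpM2l//.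
  have h1 : 3 * q * v ^+ 2 <= 3 * v ^+ 2 by rewrite ler_wpM2r ?sqr_ge0// ler_piMr.
  have h2 : q ^+ 2 * v ^+ 3 <= v ^+ 3 by rewrite ler_piMl ?exprn_ge0// expr_le1.
  have -> : w = v + 1 by rewrite /v; lra.
  have : 0 <= 3 * v by rewrite mulr_ge0.
  have -> : (v + 1) ^+ 3 = v ^+ 3 + 3 * v ^+ 2 + 3 * v + 1 by ring.
  lra.
- set u := fun y => lrn lr_m y - 1.
  have mu_ : measurable_fun setT u by exact: measurable_funB.
  have mA : measurable_fun setT (fun y => `|u y| ^+ 3).
    by apply: measurable_funX; exact: measurableT_comp.
  (* The odd absolute moment is interpolated between even ones: [2 * p * |u| ^+ 3 <= p ^+ 2 * u ^+ 2
     + u ^+ 4]. The weight [p] is the typical size of [u], and makes both terms on the right of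
     order [p ^+ 4]. The powers of [u] are expanded, with negative terms moved left. *)
  have : (\int[gam]_y (2 * p * `|u y| ^+ 3 +
        (0 + (2 * p ^+ 2 + 4) * lrn lr_m y + 0 * lrn lr_m y ^+ 2 + 4 * lrn lr_m y ^+ 3))%:E <=
      \int[gam]_y ((p ^+ 2 + 1 + 0 * lrn lr_m y + (p ^+ 2 + 6) * lrn lr_m y ^+ 2
         + 0 * lrn lr_m y ^+ 3) + lrn lr_m y ^+ 4)%:E)%E.
    apply: ge0_exp_le.
    + by do ![apply: measurable_funD => //| apply: measurable_funM => // | apply: measurable_funX => //].
    + by do ![apply: measurable_funD => //| apply: measurable_funM => // | apply: measurable_funX => //].
    + by move=> y; rewrite !addr_ge0 ?mulr_ge0 ?addr_ge0 ?mulr_ge0 ?exprn_ge0.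
    + move=> y; rewrite /u; move: (lrn lr_m y) => z.
      have : 0 <= (`|z - 1| * (p - `|z - 1|)) ^+ 2 by exact: sqr_ge0.
      have := real_normK (num_real (z - 1)); set n := `|z - 1| => nE.
      have n4 : n ^+ 4 = (z - 1) ^+ 4 by rewrite -[4%N]/(2 * 2)%N exprM nE -exprM.
      have -> : (n * (p - n)) ^+ 2 = p ^+ 2 * n ^+ 2 - 2 * p * n ^+ 3 + n ^+ 4 by ring.
      rewrite nE n4 => H.
      have E4 : (z - 1) ^+ 4 = z ^+ 4 - 4 * z ^+ 3 + 6 * z ^+ 2 - 4 * z + 1 by ring.
      have E2 : p ^+ 2 * (z - 1) ^+ 2 = p ^+ 2 * z ^+ 2 - 2 * p ^+ 2 * z + p ^+ 2 by ring.
      have E3 : (p ^+ 2 + 6) * z ^+ 2 = p ^+ 2 * z ^+ 2 + 6 * z ^+ 2 by ring.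
      have E5 : (2 * p ^+ 2 + 4) * z = 2 * p ^+ 2 * z + 4 * z by ring.
      move: H; rewrite E4 E2 E3 E5 !mul0r !addr0 !add0r; lra.
  have mcub c0 c1 c2 c3 : measurable_fun setT (fun y => c0 + c1 * lrn lr_m y
      + c2 * lrn lr_m y ^+ 2 + c3 * lrn lr_m y ^+ 3).
    by do ![apply: measurable_funD => //| apply: measurable_funM => // | apply: measurable_funX => //].
  rewrite ge0_expD//; last 3 first.
  - exact: measurable_funM.
  - by move=> y; rewrite !mulr_ge0 ?exprn_ge0.
  - by move=> y; rewrite !addr_ge0 ?mulr_ge0 ?addr_ge0 ?mulr_ge0 ?exprn_ge0.
  rewrite [leRHS]ge0_expD//; last 3 first.
  - exact: measurable_funX.
  - by move=> y; rewrite !addr_ge0 ?mulr_ge0 ?addr_ge0 ?mulr_ge0 ?exprn_ge0.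
  - by move=> y; rewrite exprn_ge0.
  rewrite !exp_cubic_lrn//; try (by rewrite !addr_ge0 ?mulr_ge0).
  have pp0 : 0 < 2 * p by rewrite mulr_gt0.
  rewrite (ge0_expZ gam mA (ltW pp0)); last by move=> y; rewrite exprn_ge0.
  rewrite exp_lrnX mE -EFinD.
  have : (0 <= \int[gam]_y (`|u y| ^+ 3)%:E)%E.
    by apply: integral_ge0 => y _; rewrite lee_fin exprn_ge0.
  case: (\int[gam]_y _)%E => [r| |]//; last by rewrite gt0_muley ?lte_fin.
  move=> _; rewrite -EFinM -EFinD !lee_fin !mul0r !addr0 add0r => H.
  rewrite -(ler_pM2l pp0).
  set v := w - 1; have v0 : 0 <= v by rewrite subr_ge0.
  have vw : v <= w by rewrite /v; lra.
  have w6 : 0 <= w ^+ 6 by rewrite exprn_ge0.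
  have w3 : 0 <= w ^+ 3 by rewrite exprn_ge0.
  have x1E : lr_x - 1 = p ^+ 2 * v by rewrite /lr_x addrAC subrr add0r.
  have tail : lr_x ^+ 4 + 2 * lr_x ^+ 3 + 3 * lr_x ^+ 2 - 3 <= 6 * w ^+ 4.
    have xk k : (k <= 4)%N -> lr_x ^+ k <= w ^+ 4.
      move=> k4; apply: (@le_trans _ _ (w ^+ k)); first by rewrite lerXn2r ?nnegrE.
      exact: ler_weXn2l.
    have := xk 4%N isT; have := xk 3%N isT; have := xk 2%N isT; lra.
  (* This is the fourth moment of [u]. It has a double zero at [lr_x = 1], and [lr_x - 1] is of
     order [p ^+ 2]. *)
  have poly : lr_x ^+ 6 - 4 * lr_x ^+ 3 + 6 * lr_x - 3 <= p ^+ 4 * (6 * w ^+ 6).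
    have -> : lr_x ^+ 6 - 4 * lr_x ^+ 3 + 6 * lr_x - 3 =
      (lr_x - 1) ^+ 2 * (lr_x ^+ 4 + 2 * lr_x ^+ 3 + 3 * lr_x ^+ 2 - 3) by ring.
    rewrite x1E exprMn -exprM -mulrA ler_wpM2l ?exprn_ge0//.
    apply: (@le_trans _ _ (v ^+ 2 * (6 * w ^+ 4))); first by rewrite ler_wpM2l ?sqr_ge0.
    have -> : 6 * w ^+ 6 = w ^+ 2 * (6 * w ^+ 4) by ring.
    by rewrite ler_wpM2r ?mulr_ge0 ?exprn_ge0// lerXn2r ?nnegrE.
  have quad : p ^+ 2 * (lr_x - 1) <= p ^+ 4 * w.
    rewrite x1E mulrA -exprD ler_wpM2l ?exprn_ge0//.
  have p4 : 0 <= p ^+ 4 by rewrite exprn_ge0.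
  have kE : 2 * p * lr_k = 2 * (p ^+ 4 * (1 + w + w ^+ 3 + 6 * w ^+ 6)) by rewrite /lr_k; ring.
  have : p ^+ 4 * w + p ^+ 4 * (6 * w ^+ 6) <= 2 * (p ^+ 4 * (1 + w + w ^+ 3 + 6 * w ^+ 6)).
    have -> : 2 * (p ^+ 4 * (1 + w + w ^+ 3 + 6 * w ^+ 6)) =
       p ^+ 4 * (2 * (1 + w + w ^+ 3 + 6 * w ^+ 6)) by ring.
    by rewrite -mulrDr ler_wpM2l//; have := w0; lra.
  rewrite kE; move: H quad poly; rewrite (_ : 'C(4, 2) = 6%N)//; lra.
Qed.

End moments_of_the_two_ratios.

(** * Limits along the sequence of sampling rates *)

Section limits.
Context {R : realType}.

Lemma lnD1_le (y : R) : 0 <= y -> ln (1 + y) <= y.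
Proof. by move=> y0; apply: le_ln1Dx; lra. Qed.

Lemma lnD1_ge (y : R) : 0 <= y -> y / (1 + y) <= ln (1 + y).
Proof.
move=> y0; have y1 : 0 < 1 + y by rewrite ltr_pwDl.
rewrite -[leRHS]opprK lerNr -lnV ?posrE//.
have := @expR_ge1Dx R (ln (1 + y)^-1).
rewrite lnK ?posrE ?invr_gt0// => H.
have -> : - (y / (1 + y)) = (1 + y)^-1 - 1 by field; rewrite gt_eqF.
lra.
Qed.

Lemma cvg_inv_sqrt : (fun T : nat => (Num.sqrt (T%:R : R))^-1) @ \oo --> 0.
Proof.
apply/cvgrPdist_lt => e e0.
near=> T.
rewrite sub0r normrN ger0_norm ?invr_ge0 ?sqrtr_ge0//.
have T_gt : e ^- 2 < T%:R by near: T; exact: nbhs_infty_gtr.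
have e2 : 0 < e ^- 2 by rewrite invr_gt0 exprn_gt0.
rewrite -[ltRHS]invrK ltf_pV2 ?posrE ?invr_gt0 ?sqrtr_gt0//; last exact: lt_trans T_gt.
rewrite -[e^-1]ger0_norm ?invr_ge0 ?ltW// -sqrtr_sqr ltr_sqrt ?exprVn//.
exact: lt_trans T_gt.
Unshelve. all: by end_near. Qed.

Variables (p : nat -> R) (nu mu0 : R).
Hypotheses (p_gt0 : forall T, 0 < p T) (p_le1 : forall T, p T <= 1)
  (p_cvg : (fun T : nat => p T * Num.sqrt T%:R) @ \oo --> nu).
Let w : R := expR (mu0 ^+ 2).
Let w1 : 1 <= w. Proof. by rewrite -expR0 ler_expR sqr_ge0. Qed.
Let u T := p T * Num.sqrt T%:R.
Let s T : R := (Num.sqrt T%:R)^-1.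

Let u_ge0 T : 0 <= u T. Proof. by rewrite mulr_ge0 ?sqrtr_ge0 ?ltW. Qed.
Let pE T : (0 < T)%N -> p T = u T * s T.
Proof.
by move=> T0; rewrite /u /s mulfK// gt_eqF// sqrtr_gt0 ltr0n.
Qed.
Let u2E T : u T ^+ 2 = T%:R * p T ^+ 2.
Proof. by rewrite exprMn sqr_sqrtr// mulrC. Qed.

(** With [u T] the convergent product of [p T] and [Num.sqrt T%:R], [T * p ^+ 3] is [u T ^+ 3]
    divided by that square root, while [lr_rho ^+ T] is at most [expR (K' * u T ^+ 2)] and stays
    bounded. *)
Lemma cvg_lindeberg_error :
  (fun T : nat => T%:R * (2 * lr_k (p T) mu0) * lr_rho (p T) mu0 ^+ T) @ \oo --> 0.
Proof.
pose K := 1 + w + w ^+ 3 + 6 * w ^+ 6.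
pose K' := 3 * w + w ^+ 3.
have w0 : 0 <= w by exact: le_trans w1.
have K0 : 0 <= K by rewrite !addr_ge0 ?mulr_ge0 ?exprn_ge0.
have K'0 : 0 <= K' by rewrite !addr_ge0 ?mulr_ge0 ?exprn_ge0.
apply: (@squeeze_cvgr _ _ _ _ (fun=> 0)
  (fun T => 2 * K * u T ^+ 3 * expR (K' * u T ^+ 2) * s T)).
- near=> T.
  have T0 : (0 < T)%N by near: T; exact: nbhs_infty_gt.
  have p0 := ltW (p_gt0 T).
  rewrite !mulr_ge0 ?lr_k_ge0 ?exprn_ge0 ?(le_trans _ (lr_rho_ge1 _ _))//=.
  have -> : T%:R * (2 * lr_k (p T) mu0) = 2 * K * u T ^+ 3 * s T.
    have -> : T%:R * (2 * lr_k (p T) mu0) = 2 * K * (T%:R * p T ^+ 2) * p T.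
      by rewrite /lr_k -/w -/K; ring.
    by rewrite -u2E (pE T0); ring.
  rewrite mulrAC ler_wpM2r ?invr_ge0 ?sqrtr_ge0// ler_wpM2l ?mulr_ge0 ?exprn_ge0//.
  rewrite u2E mulrCA mulrC expRM_natr.
  rewrite lerXn2r ?nnegrE ?expR_ge0 ?(le_trans _ (lr_rho_ge1 _ _))//.
  by rewrite /lr_rho -/w -/K' [K' * _]mulrC expR_ge1Dx.
- exact: cvg_cst.
- rewrite [X in _ --> X](_ : 0 = 2 * K * nu ^+ 3 * expR (K' * nu ^+ 2) * 0); last by rewrite mulr0.
  have cu2 : (fun T => u T ^+ 2) @ \oo --> nu ^+ 2 by apply: cvgM.
  apply: cvgM; last exact: cvg_inv_sqrt.
  apply: cvgM.
    apply: cvgMr; rewrite exprS; under eq_fun do rewrite exprS.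
    exact: cvgM.
  apply: continuous_cvg; first exact: continuous_expR.
  exact: cvgMr.
Unshelve. all: by end_near. Qed.

(** The square of the left side is [T * ln (1 + y)] with [y = p T ^+ 2 * (w - 1)]; since [p] tends
    to 0, the bounds [y / (1 + y)] and [y] for the logarithm give the same limit. *)
Lemma cvg_gaussian_mean :
  (fun T : nat => lr_m (p T) mu0 * Num.sqrt T%:R) @ \oo --> `|nu| * Num.sqrt (w - 1).
Proof.
have v0 : 0 <= w - 1 by rewrite subr_ge0.
have ps : p @ \oo --> 0.
  have : (fun T => u T * s T) @ \oo --> nu * 0 by apply: cvgM => //; exact: cvg_inv_sqrt.
  rewrite mulr0; apply: cvg_trans; apply: near_eq_cvg; near=> T.
  by rewrite -pE//; near: T; exact: nbhs_infty_gt.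
have cu2 : (fun T => u T ^+ 2 * (w - 1)) @ \oo --> nu ^+ 2 * (w - 1).
  by apply: cvgMl; exact: cvgM.
have -> : `|nu| * Num.sqrt (w - 1) = Num.sqrt (nu ^+ 2 * (w - 1)).
  by rewrite sqrtrM ?sqr_ge0// sqrtr_sqr.
rewrite (_ : (fun T => _) = (fun T => Num.sqrt (T%:R * ln (lr_x (p T) mu0)))); last first.
  by apply/funext => T; rewrite /lr_m mulrC -sqrtrM.
apply: continuous_cvg; first exact: sqrt_continuous.
apply: (@squeeze_cvgr _ _ _ _ (fun T => u T ^+ 2 * (w - 1) / (1 + p T ^+ 2 * (w - 1)))
  (fun T => u T ^+ 2 * (w - 1))).
- near=> T.
  have y0 : 0 <= p T ^+ 2 * (w - 1) by rewrite mulr_ge0 ?sqr_ge0.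
  have -> : u T ^+ 2 * (w - 1) / (1 + p T ^+ 2 * (w - 1)) =
      T%:R * ((p T ^+ 2 * (w - 1)) / (1 + p T ^+ 2 * (w - 1))) by rewrite u2E !mulrA.
  have -> : u T ^+ 2 * (w - 1) = T%:R * (p T ^+ 2 * (w - 1)) by rewrite u2E mulrA.
  by rewrite !ler_wpM2l// ?lnD1_le//; exact: (lnD1_ge y0).
- rewrite [X in _ --> X](_ : _ = nu ^+ 2 * (w - 1) / (1 + 0 ^+ 2 * (w - 1))); last first.
    by rewrite expr0n/= mul0r addr0 divr1.
  apply: cvgM => //; apply: cvgV; first by rewrite expr0n/= mul0r addr0 oner_neq0.
  by apply: cvgD; [exact: cvg_cst|apply: cvgMl; exact: cvgM].
- exact: cu2.
Unshelve. all: by end_near. Qed.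

End limits.

(** * Uniform convergence of the trade-off functions *)

Section gaussian_limit.
Context {R : realType}.

(** A uniform error [eps] between the dual functions moves each supporting line vertically by at
    most [eps]. The line of [G] gives the lower bound and that of the trade-off function the upper
    one; at levels 0 and 1 the two curves coincide. *)
Lemma tradeoff_close_G {d d' dY} {T : measurableType d} {T' : measurableType d'}
    {Y : measurableType dY} (P : probability T R) (P' : probability T' R)
    (X : T -> Y) (X' : T' -> Y) (h : R -> R -> \bar R) (C mu eps alpha : R) :
  measurable_fun setT X -> measurable_fun setT X' -> 0 < mu -> 0 <= eps ->
  hs_dominated P X P' X' h -> hs_approached P X P' X' h ->
  (forall a, 0 < a -> (h a 1%R <= (C / a)%:E)%E) ->
  (forall a, (h a 1%R <= gpay 1 (- a)%R mu + eps%:E)%E) ->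
  (forall a, (gpay 1 (- a)%R mu <= h a 1%R + eps%:E)%E) ->
  0 <= alpha <= 1 -> `|tradeoff P X P' X' alpha - G mu alpha| <= eps.
Proof.
move=> mX mX' mu0 eps0 hd ha hC hle hge al01; have /andP[al0 al1] := al01.
have tle := @tradeoff_le1 R _ _ _ _ _ _ P P' X X' mX' alpha al01.
move: (al0); rewrite le_eqVlt => /predU1P[al0'|algt0].
  have := tradeoff0_dominated mX mX' hd hC.
  move: tle; rewrite -al0' /G lexx subr0 => t1 t2.
  by rewrite (_ : tradeoff _ _ _ _ _ = 1) ?subrr ?normr0//; apply/eqP; rewrite eq_le t1.
move: (al1); rewrite le_eqVlt => /predU1P[al1'|allt1].
  have := @tradeoff_ge0 R _ _ _ _ _ _ P P' X X' mX' alpha al0.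
  move: tle; rewrite al1' subrr /G ler10 lexx subr0 => t1 t2.
  by rewrite (_ : tradeoff _ _ _ _ _ = 0) ?normr0//; apply/eqP; rewrite eq_le t1.
have al : 0 < alpha < 1 by rewrite algt0.
rewrite ler_norml; apply/andP; split.
  have [a a0 gE] := G_dual_support mu0 al.
  have := hle a; rewrite gE -EFinD => H.
  have := @tradeoff_ge_dominated R _ _ _ _ _ _ P P' X X' mX mX' h alpha a _ hd a0 al0 H.
  lra.
have [a a0 hE] := tradeoff_le_approached mX mX' ha al.
have := @G_dual_le R 1 (- a) mu alpha ler01 al01.
move=> /le_trans /(_ (hge a)) /le_trans /(_ (leeD2r _ hE)).
rewrite -EFinD lee_fin; lra.
Qed.

Section tensor.
Context {T : nat} {d1 d2 dY} {O1 : measurableType d1} {O2 : measurableType d2}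
  {Y : measurableType dY} (P1 : probability O1 R) (U : 'I_T -> O1 -> Y)
  (P2 : probability O2 R) (V : 'I_T -> O2 -> Y) (p mu : R).
Hypotheses (p_gt0 : 0 < p) (p_le1 : p <= 1) (mu_gt0 : 0 < mu)
  (UV : tensor_realization (mixG p mu) P1 U P2 V).
Let p01 : 0 <= p <= 1. Proof. by rewrite ltW. Qed.

Lemma tensor_hs_dominated : hs_dominated P1 (fun w => [tuple U i w | i < T])
  P2 (fun w => [tuple V i w | i < T]) (hs (sub_lr p mu) T).
Proof.
have [iU iV _ tE] := UV.
apply: hs_composition_upper => // [||i]; first exact: measurable_sub_lr.
  by move=> x; exact: sub_lr_ge0.
by apply: mixG_hs_dominated => //; [exact: iU.1|exact: iV.1|exact: tE].
Qed.

Lemma tensor_hs_approached : hs_approached P1 (fun w => [tuple U i w | i < T])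
  P2 (fun w => [tuple V i w | i < T]) (hs (sub_lr p mu) T).
Proof.
have [iU iV _ tE] := UV.
apply: hs_composition_lower => // [||i]; first exact: measurable_sub_lr.
  by move=> x; exact: sub_lr_ge0.
by apply: mixG_hs_approached => //; [exact: iU.1|exact: iV.1|exact: tE].
Qed.

Lemma hs_sub_lr_le_inv (a : R) : 0 < a ->
  (hs (sub_lr p mu) T a 1%R <= ((lr_x p mu ^+ T / 4) / a)%:E)%E.
Proof.
move=> a0; rewrite -mulrA -invfM; apply: hs_le_inv => //.
- exact: measurable_sub_lr.
- by move=> x; exact: sub_lr_ge0.
- exact: le_trans (lr_x_ge1 p mu).
- exact: lrm_2 (lr_moments_sub mu p_gt0 p_le1).
Qed.

End tensor.

Section sequence.
Variables (p : nat -> R) (nu mu0 : R).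
Hypotheses (p_gt0 : forall T, 0 < p T) (p_le1 : forall T, p T <= 1) (nu_gt0 : 0 < nu)
  (p_cvg : (fun T : nat => p T * Num.sqrt T%:R) @ \oo --> nu).
Let mu := nu * Num.sqrt (expR (mu0 ^+ 2) - 1).

Lemma hs_sub_lr_near_gpay (eps : R) : 0 < eps -> \forall T \near \oo, forall a,
  (hs (sub_lr (p T) mu0) T a 1%R <= gpay 1 (- a)%R mu + eps%:E)%E /\
  (gpay 1 (- a)%R mu <= hs (sub_lr (p T) mu0) T a 1%R + eps%:E)%E.
Proof.
(* The budget: [e] for smoothing, [e] for the exchange error, and [2 * e] for replacing the shift
   [M T] by [mu]. None of these errors depends on [a], hence the uniformity. *)
move=> eps0; pose e := eps / 4; have e0 : 0 < e by rewrite divr_gt0.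
pose M T := lr_m (p T) mu0 * Num.sqrt T%:R.
pose D T := expR (M T ^+ 2) + expR (mu ^+ 2) - 2 * expR (M T * mu).
have cM : M @ \oo --> mu.
  by rewrite /mu -{1}(gtr0_norm nu_gt0); exact: cvg_gaussian_mean.
have cD : D @ \oo --> 0.
  rewrite [X in _ --> X](_ : _ = expR (mu ^+ 2) + expR (mu ^+ 2) - 2 * expR (mu * mu)); last first.
    by rewrite -expr2; ring.
  apply: cvgB.
    apply: cvgD; last exact: cvg_cst.
    by apply: continuous_cvg; [exact: continuous_expR|exact: cvgM].
  by apply: cvgMr; apply: continuous_cvg; [exact: continuous_expR|exact: cvgMl].
near=> T.
(* The threshold for which four exchange errors divided by [6 * e ^+ 2] amount to at most [e]. *)
have errle : T%:R * (2 * lr_k (p T) mu0) * lr_rho (p T) mu0 ^+ T <= 6 * e ^+ 3 / 4.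
  apply: ltW; apply: le_lt_trans (ler_norm _) _; rewrite -[X in `|X|]subr0 distrC.
  near: T; have /cvgrPdist_lt := cvg_lindeberg_error mu0 p_gt0 p_cvg; apply.
  by rewrite divr_gt0// mulr_gt0// exprn_gt0.
have Dle : D T <= 2 * e ^+ 2.
  apply: ltW; apply: le_lt_trans (ler_norm _) _; rewrite -[D T]subr0 distrC.
  by near: T; move/cvgrPdist_lt : cD; apply; rewrite mulr_gt0// exprn_gt0.
move=> a; have p1 := p_gt0 T; have p2 := p_le1 T.
have hsl := hs_lrn T a (sqrtr_ge0 _ : 0 <= lr_m (p T) mu0) (@ler01 R).
have m1 := lr_moments_sub mu0 p1 p2; have m2 := lr_moments_lrn mu0 p1 p2.
set err := T%:R * _ * _ in errle *.
have err' : 4 * err / (6 * e ^+ 2) <= e.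
  rewrite ler_pdivrMr; last by rewrite mulr_gt0// exprn_gt0.
  have -> : e * (6 * e ^+ 2) = 6 * e ^+ 3 by ring.
  lra.
have D' : (e + D T / e) / 2 <= 2 * e.
  have : D T / e <= 2 * e by rewrite ler_pdivrMr// -mulrA -expr2.
  lra.
have rho1 := lr_rho_ge1 (p T) mu0; have k0 := lr_k_ge0 mu0 p1.
have x0 : 0 <= lr_x (p T) mu0 by exact: le_trans (lr_x_ge1 (p T) mu0).
have epsE : eps = 4 * e by rewrite /e mulrC divfK.
split.
  apply: (le_trans (hs_exchange rho1 k0 T a m1 m2 ler01 e0)).
  rewrite expr1n mulr1 -/err hsl -/(M T).
  apply: (le_trans (leeD2r _ (gpay_dist _ (M T) mu e0))).
  by rewrite -/(D T) -addeA -EFinD leeD2l// lee_fin; lra.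
apply: (le_trans (gpay_dist _ mu (M T) e0)).
rewrite [mu * _]mulrC [expR (mu ^+ 2) + _]addrC -/(D T) /M -hsl.
apply: (le_trans (leeD2r _ (hs_exchange rho1 k0 T a m2 m1 ler01 e0))).
by rewrite expr1n mulr1 -/err -addeA -EFinD leeD2l// lee_fin; lra.
Unshelve. all: by end_near. Qed.

End sequence.
End gaussian_limit.

(** * The mechanism against the tensor product, and the theorem *)

Section mechanism_tradeoff.
Context {R : realType} {X : Type} {D K : nat} (f1 : X -> D.-tuple R) (m T : nat)
  (sx sy Cx Cy : R).

Lemma measurable_dpfmix (S : seq (X * K.-tuple R)) (q : R) {dO} {Omega : measurableType dO}
    (P : probability Omega R) (Z : mech_index T (size S) D K -> Omega -> R) :
  mech_randomness P q Z -> measurable_fun setT (dpfmix f1 m sx sy Cx Cy Z).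
Proof.
move=> [iZ _ _ _]; exact: measurable_mktuple (ind_step f1 m sx sy Cx Cy iZ).1.
Qed.

Hypotheses (m0 : (0 < m)%N) (sx0 : 0 < sx) (sy0 : 0 < sy) (Cx0 : 0 < Cx) (Cy0 : 0 < Cy).
Let mu0 := Num.sqrt (sx ^-2 + sy ^-2).
Let mu0_gt0 : 0 < mu0.
Proof. by rewrite sqrtr_gt0 addr_gt0// invr_gt0 exprn_gt0. Qed.

Variables (q : R).
Hypotheses (q_gt0 : 0 < q) (q_le1 : q <= 1).
Context {d1 d2 dY} {O1 : measurableType d1} {O2 : measurableType d2} {Y : measurableType dY}
  (P1 : probability O1 R) (U : 'I_T -> O1 -> Y) (P2 : probability O2 R) (V : 'I_T -> O2 -> Y).
Hypothesis UV : tensor_realization (mixG q mu0) P1 U P2 V.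

(** The function [hs (sub_lr q mu0) T] mediates: tests on the realization of the tensor product
    approach it, tests on the mechanism cannot exceed it. *)
Lemma tensor_tf_le_dpfmix_add (s1 s2 : seq (X * K.-tuple R)) (r : X * K.-tuple R)
    {dO} {Omega : measurableType dO} (P : probability Omega R)
    (Z : mech_index T (size (s1 ++ s2)) D K -> Omega -> R)
    {dO'} {Omega' : measurableType dO'} (P' : probability Omega' R)
    (Z' : mech_index T (size (s1 ++ r :: s2)) D K -> Omega' -> R) (alpha : R) :
  mech_randomness P q Z -> mech_randomness P' q Z' -> 0 <= alpha <= 1 ->
  tensor_tf P1 U P2 V alpha <=
  tradeoff P (dpfmix f1 m sx sy Cx Cy Z) P' (dpfmix f1 m sx sy Cx Cy Z') alpha.
Proof.
move=> rZ rZ' al01; have [iU iV _ _] := UV.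
have q01 : 0 <= q <= 1 by rewrite ltW.
apply: (tradeoff_compare (h := hs (sub_lr q mu0) T) (C := lr_x q mu0 ^+ T / 4)) => //.
- exact: measurable_mktuple iU.1.
- exact: measurable_mktuple iV.1.
- exact: measurable_dpfmix rZ.
- exact: measurable_dpfmix rZ'.
- exact: tensor_hs_approached.
- exact: hs_dpfmix.
- by move=> a a0; exact: hs_sub_lr_le_inv.
Qed.

End mechanism_tradeoff.

Lemma tf_inv_ge0 {R : realType} (f : R -> R) (alpha : R) : 0 <= tf_inv f alpha.
Proof.
rewrite /tf_inv; have [->|/set0P n0] := eqVneq [set t : R | 0 <= t <= 1 /\ f t <= alpha] set0.
  (* The infimum of the empty set is 0 by convention, so the bound holds there too. *)
  by rewrite inf0.
by apply: lb_le_inf => // t /= [/andP[]].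
Qed.

Unset Implicit Arguments. Set Strict Implicit.

Theorem theorem1 (R : realType) :
  (* Part 1: min{f, f^{-1}}** -DP for every n, m, T *)
  (forall (X : Type) (D K : nat) (f1 : X -> D.-tuple R) (n m T : nat)
          (sx sy Cx Cy : R),
     (1 <= m)%N -> (m <= n)%N -> 0 < sx -> 0 < sy -> 0 < Cx -> 0 < Cy ->
     let mu0 := Num.sqrt (sx ^-2 + sy ^-2) in
     forall d1 d2 dY (O1 : measurableType d1) (O2 : measurableType d2)
            (Y : measurableType dY) (P1 : probability O1 R) (U : 'I_T -> O1 -> Y)
            (P2 : probability O2 R) (V : 'I_T -> O2 -> Y),
     tensor_realization (mixG (m%:R / n%:R) mu0) P1 U P2 V ->
     let f := tensor_tf P1 U P2 V in
     dpfmix_fDP K f1 n m T sx sy Cx Cy (biconj (minf f (tf_inv f)))) /\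
  (* Part 2: asymptotic mu-GDP *)
  (forall (sx sy nu : R) (n m : nat -> nat),
     0 < sx -> 0 < sy -> 0 < nu ->
     (forall T, (1 <= m T)%N /\ (m T <= n T)%N) ->
     (fun T : nat => (m T)%:R * Num.sqrt T%:R / (n T)%:R) @ \oo --> nu ->
     let mu0 := Num.sqrt (sx ^-2 + sy ^-2) in
     let mu := nu * Num.sqrt (expR (sx ^-2 + sy ^-2) - 1) in
     forall (d1 d2 dY : nat -> measure_display)
            (O1 : forall T, measurableType (d1 T)) (O2 : forall T, measurableType (d2 T))
            (Y : forall T, measurableType (dY T))
            (P1 : forall T, probability (O1 T) R) (U : forall T, 'I_T -> O1 T -> Y T)
            (P2 : forall T, probability (O2 T) R) (V : forall T, 'I_T -> O2 T -> Y T),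
     (forall T, tensor_realization (mixG ((m T)%:R / (n T)%:R) mu0) (P1 T) (U T) (P2 T) (V T)) ->
     forall eps : R, 0 < eps -> exists T0 : nat, forall T : nat, (T0 <= T)%N ->
       forall alpha : R, 0 <= alpha <= 1 ->
         `| tensor_tf (P1 T) (U T) (P2 T) (V T) alpha - G mu alpha | < eps).
Proof.
split.
- move=> X D K f1 n m T sx sy Cx Cy m1 mn sx0 sy0 Cx0 Cy0 mu0 d1 d2 dY O1 O2 Y P1 U P2 V UV f.
  move=> S S' _ _ SS' dO Omega P Z rZ dO' Omega' P' Z' rZ' alpha al01.
  have n0 : (0 < n)%N by exact: leq_trans mn.
  have q_gt0 : 0 < m%:R / n%:R :> R by rewrite divr_gt0 ?ltr0n.
  have q_le1 : m%:R / n%:R <= 1 :> R by rewrite ler_pdivrMr ?ltr0n// mul1r ler_nat.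
  have [iU iV _ _] := UV.
  (* The biconjugate lies below the minimum, and the minimum below each of its two arguments; which
     one is used depends on which dataset is larger. *)
  apply: (@le_trans _ _ (minf f (tf_inv f) alpha)).
    apply: biconj_le => // t /andP[t0 _]; rewrite /minf le_min tf_inv_ge0 andbT.
    by apply: tradeoff_ge0 => //; exact: measurable_mktuple iV.1.
  case: SS' => s1 [s2 [r [[SE S'E]|[S'E SE]]]]; subst S S'.
    rewrite /minf ge_min; apply/orP; left.
    exact: (tensor_tf_le_dpfmix_add f1 m1 sx0 sy0 Cx0 Cy0 q_gt0 q_le1 UV).
  rewrite /minf ge_min; apply/orP; right; have /andP[al0 _] := al01.
  (* Here the first dataset is the larger one, so the pair of laws is the reverse of that obtained
     by adding a record. *)
  apply: tradeoff_inv => //; [exact: measurable_dpfmix rZ'|exact: measurable_dpfmix rZ|].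
  move=> t t01.
  exact: (tensor_tf_le_dpfmix_add f1 m1 sx0 sy0 Cx0 Cy0 q_gt0 q_le1 UV).
move=> sx sy nu n m sx0 sy0 nu0 mn cvg mu0 mu d1 d2 dY O1 O2 Y P1 U P2 V UV eps eps0.
pose p T : R := (m T)%:R / (n T)%:R.
have n0 T : 0 < (n T)%:R :> R by rewrite ltr0n; have [m1 /(leq_trans m1)] := mn T.
have p_gt0 T : 0 < p T by rewrite divr_gt0// ltr0n; have [] := mn T.
have p_le1 T : p T <= 1 by rewrite ler_pdivrMr// mul1r ler_nat; have [] := mn T.
have s0 : 0 < sx ^-2 + sy ^-2 by rewrite addr_gt0// invr_gt0 exprn_gt0.
have mu0_gt0 : 0 < mu0 by rewrite sqrtr_gt0.
have mu02 : mu0 ^+ 2 = sx ^-2 + sy ^-2 by rewrite sqr_sqrtr// ltW.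
have mu_gt0 : 0 < mu by rewrite mulr_gt0// sqrtr_gt0 subr_gt0 -expR0 ltr_expR.
have p_cvg : (fun T : nat => p T * Num.sqrt T%:R) @ \oo --> nu.
  by rewrite (_ : (fun T => _) = (fun T : nat => (m T)%:R * Num.sqrt T%:R / (n T)%:R))//;
    apply/funext => T; rewrite /p mulrAC.
have e0 : 0 < eps / 2 by rewrite divr_gt0.
have [T0 _ HT0] := hs_sub_lr_near_gpay mu0 p_gt0 p_le1 nu0 p_cvg e0.
exists T0 => T T0T alpha al01; have := HT0 T T0T; rewrite mu02 -/mu => hT.
have [iU iV _ _] := UV T.
apply: (@le_lt_trans _ _ (eps / 2)); last by rewrite ltr_pdivrMr// ltr_pMr// ltr1n.
have hd := tensor_hs_dominated (p_gt0 T) (p_le1 T) (UV T).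
have ha := tensor_hs_approached (p_gt0 T) (p_le1 T) mu0_gt0 (UV T).
apply: (tradeoff_close_G (measurable_mktuple iU.1) (measurable_mktuple iV.1) mu_gt0 (ltW e0)
  hd ha (hs_sub_lr_le_inv mu0 (p_gt0 T) (p_le1 T))) => // a; by have [] := hT a.
Qed.
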